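(* (a) Let $\mu(s)$ be a rational function over $\mathbb{C}$ with a finite non-zero limit $\mu_0=\lim_{s\to\infty}\mu(s)$ such that $$ {}_2F_1\!\left(\tfrac13,\tfrac23;\tfrac43;\,z\right)=\frac{\mu_0}{\mu(1/z)}\;{}_2F_1\!\left(\tfrac13,\tfrac23;\tfrac43;\,\frac{z}{\mu(1/z)^3}\right). $$ Then there is a non-zero isogeny $E_3\to E_3$ of the elliptic curve $E_3:X^3+Y^3=1$ that transforms the $X$-coordinate or the $Y$-coordinate to $X\mu(X^3)$. (b) Let $\eta(s)$ be a rational function over $\mathbb{C}$ with a finite non-zero limit $\eta_0=\lim_{s\to\infty}\eta(s)$ such that $$ {}_2F_1\!\left(\tfrac13,\tfrac23;\tfrac43;\,z\right)=\frac{(1-z)^{1/3}\,\eta_0}{\eta(1/z)}\;{}_2F_1\!\left(\tfrac13,\tfrac23;\tfrac43;\,\frac{z\,(z-1)}{\eta(1/z)^3}\right). $$ Then there is a non-zero isogeny $E_3\to E_3$ that transforms the $X$-coordinate or the $Y$-coordinate to $\eta(X^3)\,X^2/Y$.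
   Context: $E_3$ is the elliptic curve over $\mathbb{C}$ given by (the projective closure of) $X^3+Y^3=1$, with the point at infinity $(X:Y:1)=(1:-1:0)$ as the neutral element of its additive group. An isogeny here is an isogeny endomorphism: an algebraic map $E_3\to E_3$ respecting the addition law (equivalently, fixing the neutral element). ''An isogeny $\phi$ transforms the $X$-coordinate (respectively $Y$-coordinate) to $f$'' means that the $X$-component (respectively $Y$-component) of $\phi(X,Y)$ is the function $f$ on $E_3$. ${}_2F_1(A,B;C;z)$ is the Gauss hypergeometric function. The identities are identities of analytic functions in a neighbourhood of $z=0$, with $(1-z)^{1/3}$ the branch with value $1$ at $z=0$. *)

(* Defs.v *)
From HB Require Import structures.
From mathcomp Require Import all_boot all_order all_algebra.
From mathcomp Require Import complex.
From mathcomp Require Import all_classical all_reals all_analysis.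
From mathcomp Require mpoly.
Import -(notations) mpoly.

Set Implicit Arguments.
Unset Strict Implicit.
Unset Printing Implicit Defensive.

Import Order.TTheory GRing.Theory Num.Theory.
Import numFieldNormedType.Exports.

Local Open Scope classical_set_scope.
Local Open Scope ring_scope.

(* R[i], packaged as a numClosedFieldType: this is what makes the topology of
   numFieldNormedType available on it. *)
Definition Cplx (R : realType) : numClosedFieldType := R[i].

Section Analysis.
Variable R : realType.
Local Notation C := (Cplx R).

(* Neighbourhoods of the point at infinity of the Riemann sphere. *)
Definition cinfty_nbhs : set_system C :=
  [set A | exists M : C, M \is Num.real /\ forall s, M < `|s| -> A s].

Definition pochhammer (a : C) (n : nat) : C := \prod_(i < n) (a + i%:R).

(* The Gauss series; it is only meaningful where it converges, in particular
   for |z| < 1. *)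
Definition hyp2F1 (a b c z : C) : C :=
  limn [series pochhammer a n * pochhammer b n / (pochhammer c n * n`!%:R)
                 * z ^+ n]_n.

(* g is, near 0, the branch of (1 - z)^(1/3) with value 1 at z = 0. *)
Definition is_cbrt_branch (g : C -> C) : Prop :=
  [/\ g 0 = 1,
      \forall z \near (0 : C), {for z, continuous g}
    & \forall z \near (0 : C), g z ^+ 3 = 1 - z].

Definition ratfun (p q : {poly C}) (s : C) : C := p.[s] / q.[s].

End Analysis.
Arguments cinfty_nbhs R : clear implicits.

Section Curve.
Variable R : realType.
Local Notation C := (Cplx R).

Definition iX : 'I_3 := inord 0.
Definition iY : 'I_3 := inord 1.
Definition iZ : 'I_3 := inord 2.

Definition fermat (v : 'rV[C]_3) : C :=
  v 0 iX ^+ 3 + v 0 iY ^+ 3 - v 0 iZ ^+ 3.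

(* A projective point (X:Y:Z) of the curve X^3 + Y^3 = Z^3 has Z != 0 or
   X != 0, so it has exactly one representative with Z = 1, or with Z = 0 and
   X = 1. *)
Definition normalized (v : 'rV[C]_3) : bool :=
  (v 0 iZ == 1) || (v 0 iZ == 0) && (v 0 iX == 1).

Definition E3 : Type := {v : 'rV[C]_3 | (fermat v == 0) && normalized v}.

Definition coord (P : E3) (i : 'I_3) : C := val P 0 i.

Definition O_vec : 'rV[C]_3 := \row_j (if j == iX then 1 else
                                       if j == iY then - 1 else 0).

Lemma O_subproof : (fermat O_vec == 0) && normalized O_vec.
Proof.
rewrite /fermat /normalized !mxE -!(inj_eq val_inj) /= !inordK //= !eqxx orbT.
by rewrite exprNn !expr1n mulr1 expr0n subr0 andbT -signr_odd expr1 subrr.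
Qed.

Definition O_E3 : E3 := Sub O_vec O_subproof.

(* The intersection cycle of the curve with some line is P + Q + T, counted
   with multiplicities: the rows of M span the line, and the cubic form
   restricted to the line vanishes exactly at P, Q and T. *)
Definition line_cuts (P Q T : E3) : Prop :=
  exists (M : 'M[C]_(2, 3)) (p q t : 'rV[C]_2) (k : C),
    [/\ row_free M, k != 0,
        [/\ val P = p *m M, val Q = q *m M & val T = t *m M]
      & forall w : 'rV[C]_2,
          fermat (w *m M) =
          k * \det (col_mx w p : 'M[C]_2) * \det (col_mx w q : 'M[C]_2)
            * \det (col_mx w t : 'M[C]_2)].

(* P + Q = S in the chord-tangent group law with neutral element O_E3. *)
Definition E3_sum (P Q S : E3) : Prop :=
  exists2 T, line_cuts P Q T & line_cuts O_E3 T S.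

(* phi is a morphism of projective curves: around each point it is given by
   three forms of the same degree without common zero at that point. The
   factor k may be 0 at the common zeros of the forms. *)
Definition algebraic_map (phi : E3 -> E3) : Prop :=
  forall P : E3, exists (d : nat) (F : 'I_3 -> mpoly 3 C),
    [/\ forall i, F i \is ishomog1 d mdeg,
        exists i, meval (coord P) (F i) != 0
      & forall Q : E3, exists k : C,
          forall i, meval (coord Q) (F i) = k * coord (phi Q) i].

Definition isogeny (phi : E3 -> E3) : Prop :=
  algebraic_map phi /\
  forall P Q S, E3_sum P Q S -> E3_sum (phi P) (phi Q) (phi S).

Definition nonzero_map (phi : E3 -> E3) : Prop := exists P, phi P <> O_E3.

(* The affine coordinate i (iX or iY) of phi (X, Y) is the function f (X, Y),
   at each affine point (X, Y) of the curve where the formula f is defined. *)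
Definition transforms_coord (phi : E3 -> E3) (i : 'I_3)
    (dom : C -> C -> Prop) (f : C -> C -> C) : Prop :=
  forall P : E3, coord P iZ = 1 -> dom (coord P iX) (coord P iY) ->
    coord (phi P) iZ = 1 /\ coord (phi P) i = f (coord P iX) (coord P iY).

End Curve.
Arguments O_E3 R : clear implicits.

(* Main.v *)
Require Import Defs.
From HB Require Import structures.
From mathcomp Require Import all_boot all_order all_algebra.
From mathcomp Require Import complex.
From mathcomp Require Import all_classical all_reals all_analysis.
From mathcomp Require Import ring.
From mathcomp Require mpoly.
Import -(notations) mpoly.
Set Implicit Arguments.
Unset Strict Implicit.
Unset Printing Implicit Defensive.
Import Order.TTheory GRing.Theory Num.Theory.
Import numFieldNormedType.Exports.
Local Open Scope classical_set_scope.
Local Open Scope ring_scope.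

(** Let omega = dX / Y^2 be the invariant differential of E3. The function
   F = 2F1(1/3, 2/3; 4/3; z) satisfies (F + 3 z F')^3 (1 - z)^2 = 1, which says
   that z^(1/3) F(z) is, for z = X^(-3), a primitive of a constant multiple of
   omega vanishing at the points at infinity. The substitution
   X' = X mu(X^3) turns z into z / mu(1/z)^3, so the hypothesis of the first
   part says that it multiplies this primitive by a constant. The second part
   is similar with X' = eta(X^3) X^2 / Y.

   Differentiating removes the integral and leaves an identity between rational
   functions: a first order differential equation for the numerator p and the
   denominator q ([ode_of_series], [analytic_ode]; the passage from analytic
   functions to polynomials is a comparison of Taylor polynomials of every
   order). In the first part, for coprime p and q, it reads
     (q^3 - X p^3)^2 = (1 - X)^2 (const * (p q + 3 X (p' q - p q')))^3,
   and unique factorisation of polynomials forces q^3 - X p^3 = (1 - X) b^3.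
   Hence with the argument X^3 in the polynomials, Phi = (X p : Y b : q) maps
   the cubic to itself, and what remains of the equation says that
   Phi^* omega = c omega. In the second part q is divisible by X, say q = X g,
   and Phi = (p : b : X Y Z g) after homogenisation.

   It remains to see that such a Phi, which also fixes the origin O, is a
   homomorphism ([coll_PhC]). Fix a point Q. The two maps
     P |-> Phi (third point of the line P Q)
     P |-> third point of the line through Phi P and Phi Q
   pull omega back to - c omega, and they agree at P = O because Phi commutes
   with the inversion (X : Y : Z) |-> (Y : X : Z), for the same reason. Two maps
   that pull omega back to the same form and agree at one point are equal
   ([flow_unique]): in an affine chart their difference solves a linear
   differential equation with initial value 0, so all its derivatives vanish
   at the point, and a regular function with that property is 0
   ([flat_chart0]). So Phi preserves collinearity, hence the group law.

   To keep this algebraic, points are triples over any commutative ring with a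
   derivation; over the coordinate ring of a chart the generic point stands for
   all points of the chart at once. *)

(** * Collinearity and the invariant differential on the Fermat cubic *)

Definition vec (S : Type) : Type := (S * S * S)%type.

Section Cubic.
Variable S : comNzRingType.
Implicit Types (v w u : vec S) (k : S).

Definition cub v : S := v.1.1 ^+ 3 + v.1.2 ^+ 3 - v.2 ^+ 3.

(** Proportionality, as the vanishing of the cross product; over a ring with
   zero divisors this is weaker than being multiples of a common vector. *)
Definition par v w : Prop :=
  [/\ v.1.2 * w.2 = v.2 * w.1.2, v.2 * w.1.1 = v.1.1 * w.2
    & v.1.1 * w.1.2 = v.1.2 * w.1.1].

Definition scal k v : vec S := (k * v.1.1, k * v.1.2, k * v.2).

(** The inversion of the group law, [vO] being the origin. *)
Definition swap v : vec S := (v.1.2, v.1.1, v.2).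

(** Bihomogeneous formula for the third point of the line through v and w.
   It returns 0 for some pairs, but then [chord w v] does not, and the two
   results are proportional whenever both make sense ([chord_par],
   [chord_neq0]); this is why [coll] asks for both. *)
Definition chord v w : vec S :=
  let: (x, y, z) := v in let: (a, b, c) := w in
  (y ^+ 2 * a * b + c ^+ 2 * z * x,
   - (z ^+ 2 * c * b + a ^+ 2 * x * y),
   x ^+ 2 * a * c - b ^+ 2 * y * z).

Definition coll u v w : Prop := par w (chord u v) /\ par w (chord v u).

Definition vO : vec S := (1, - 1, 0).

Lemma par_sym v w : par v w -> par w v.
Proof.
case=> h1 h2 h3.
by split; [rewrite mulrC -h1|rewrite mulrC -h2|rewrite mulrC -h3]; rewrite mulrC.
Qed.

Lemma par_refl v : par v v.
Proof. by split; rewrite mulrC. Qed.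

Lemma par0 v : par v (0, 0, 0).
Proof. by split; rewrite /= !mulr0. Qed.

Lemma par_scal k v : par v (scal k v).
Proof. by split; rewrite /=; ring. Qed.

Lemma par_scalr k v w : par v w -> par v (scal k w).
Proof.
by case=> h1 h2 h3; split; rewrite /= !(mulrCA _ k) ?h1 ?h2 ?h3.
Qed.

Lemma par_swap v w : par v w -> par (swap v) (swap w).
Proof. by case=> h1 h2 h3; split. Qed.

Lemma swapK : involutive swap.
Proof. by case=> [[x y] z]. Qed.

Lemma cub_swap v : cub (swap v) = cub v.
Proof. by rewrite /cub /= (addrC (v.1.2 ^+ 3)). Qed.

Lemma cub_scal k v : cub (scal k v) = k ^+ 3 * cub v.
Proof. by rewrite /cub /=; ring. Qed.

Lemma cub0E v : cub v = 0 -> v.2 ^+ 3 = v.1.1 ^+ 3 + v.1.2 ^+ 3.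
Proof. by move/eqP; rewrite subr_eq0 => /eqP ->. Qed.

Lemma cub_chord v w : cub v = 0 -> cub w = 0 -> cub (chord v w) = 0.
Proof.
case: v w => [[x y] z] [[a b] c] /cub0E/= h1 /cub0E/= h2.
by rewrite /cub /=; ring: h1 h2.
Qed.

(** Both formulas describe the same point, so their cross product lies in the
   ideal generated by the equations of v and w. *)
Lemma chord_par v w :
  cub v = 0 -> cub w = 0 -> par (chord v w) (chord w v).
Proof.
case: v w => [[x y] z] [[a b] c] /cub0E/= h1 /cub0E/= h2.
by split; rewrite /=; ring: h1 h2.
Qed.

Lemma chord_swap v w :
  chord (swap v) (swap w) = scal (- 1) (swap (chord w v)).
Proof.
case: v w => [[x y] z] [[a b] c].
by rewrite /chord /swap /scal /=; congr (_, _, _); ring.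
Qed.

Lemma chord_scall k v w : chord (scal k v) w = scal (k ^+ 2) (chord v w).
Proof.
case: v w => [[x y] z] [[a b] c].
by rewrite /chord /scal /=; congr (_, _, _); ring.
Qed.

Lemma chord_scalr k v w : chord v (scal k w) = scal (k ^+ 2) (chord v w).
Proof.
case: v w => [[x y] z] [[a b] c].
by rewrite /chord /scal /=; congr (_, _, _); ring.
Qed.

(** The line through the origin and v meets the cubic again at the inverse. *)
Lemma chordO v : chord vO v = scal v.1.1 (swap v).
Proof.
case: v => [[x y] z].
by rewrite /chord /scal /vO /swap /=; congr (_, _, _); ring.
Qed.

Lemma chordrO v : chord v vO = scal (- v.1.2) (swap v).
Proof.
case: v => [[x y] z].
by rewrite /chord /scal /vO /swap /=; congr (_, _, _); ring.
Qed.

Section Flow.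
Variable D : S -> S.
Hypothesis DD : {morph D : a b / a + b}.
Hypothesis DM : forall a b, D (a * b) = D a * b + a * D b.

(** The cross product of v and D v is l times the gradient of the cubic (up to
   the factor 3). Both sides scale by the square of the factor when v is
   rescaled, so l depends on the projective point only: it is the value on D
   of the pullback of the invariant differential along v. *)
Definition flow l v : Prop :=
  [/\ v.1.2 * D v.2 - v.2 * D v.1.2 = l * v.1.1 ^+ 2,
      v.2 * D v.1.1 - v.1.1 * D v.2 = l * v.1.2 ^+ 2
    & v.1.1 * D v.1.2 - v.1.2 * D v.1.1 = - (l * v.2 ^+ 2)].

Definition constv v : Prop := [/\ D v.1.1 = 0, D v.1.2 = 0 & D v.2 = 0].

Lemma der0 : D 0 = 0.
Proof. by apply: (addrI (D 0)); rewrite -DD !addr0. Qed.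

Lemma derN a : D (- a) = - D a.
Proof. by apply/eqP; rewrite -addr_eq0 -DD addNr der0. Qed.

Lemma derB a b : D (a - b) = D a - D b.
Proof. by rewrite DD derN. Qed.

Lemma der1 : D 1 = 0.
Proof.
by apply: (addrI (D 1)); rewrite addr0 -{3}(mulr1 1) DM mulr1 mul1r.
Qed.

Lemma derX a n : D (a ^+ n) = (a ^+ n.-1 * D a) *+ n.
Proof.
elim: n => [|n IH]; first by rewrite expr0 der1 mulr0n.
rewrite exprS DM IH /= mulrS; case: n {IH} => [|n] /=.
  by rewrite !expr0 !mulr0n mulr0 mulr1 mul1r.
by rewrite mulrnAr mulrA -exprS (mulrC (D a)).
Qed.

(** The inversion reverses the sign of the invariant differential. *)
Lemma flow_swap l v : flow l v -> flow (- l) (swap v).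
Proof.
case=> h1 h2 h3; split; rewrite /=.
- by rewrite mulNr -h2 opprB.
- by rewrite mulNr -h1 opprB.
by rewrite mulNr opprK -[RHS]opprK -h3 opprB.
Qed.

(** For constant w the map v |-> chord v w is the inversion followed by a
   translation, so it reverses the sign of the invariant differential. In the
   proof, [E] expresses the cross product through l, and its coefficients
   k1, k2, k3 write each component as a combination of the three components
   of the cross product of v and D v. *)
Lemma flow_chordl l v w : cub v = 0 -> cub w = 0 -> constv w ->
  flow l v -> flow (- l) (chord v w).
Proof.
case: v w => [[x y] z] [[a b] c] /cub0E/= hv /cub0E/= hw [/= Da Db Dc].
move=> [/= h1 h2 h3].
have E k1 k2 k3 r : k1 * l * x ^+ 2 + k2 * l * y ^+ 2 - k3 * l * z ^+ 2 = - r ->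
   - (k1 * (y * D z - z * D y) + k2 * (z * D x - x * D z) + k3 * (x * D y - y * D x)) = r.
  by move=> h; rewrite h1 h2 h3; rewrite -[r]opprK -h; ring.
split; rewrite /= ?(DD, derB, derN, DM, derX, Da, Db, Dc) /=.
- rewrite -[RHS](E (z^+2*b^+3*c) (2*x*z*a*b*c^+2 +y^+2*a^+2*b^+2) (-(x^+2*a^+3*c))); ring: hv hw.
- rewrite -[RHS](E (-(y^+2*a*b^+3)) (x^+2*a*c^+3) (-(2*x*y*a^+2*b*c) -z^+2*b^+2*c^+2)); ring: hv hw.
- rewrite -[RHS](E (2*y*z*a*b^+2*c) (x*y*a^+2*c^+2 -z^+2*b*c^+3) (x*z*a^+2*c^+2 -y^+2*a^+3*b)); ring: hv hw.
Qed.

Lemma flow_chordr l v w : cub v = 0 -> cub w = 0 -> constv w ->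
  flow l v -> flow (- l) (chord w v).
Proof.
case: v w => [[x y] z] [[a b] c] /cub0E/= hv /cub0E/= hw [/= Da Db Dc].
move=> [/= h1 h2 h3].
have E k1 k2 k3 r : k1 * l * x ^+ 2 + k2 * l * y ^+ 2 - k3 * l * z ^+ 2 = - r ->
   - (k1 * (y * D z - z * D y) + k2 * (z * D x - x * D z) + k3 * (x * D y - y * D x)) = r.
  by move=> h; rewrite h1 h2 h3; rewrite -[r]opprK -h; ring.
split; rewrite /= ?(DD, derB, derN, DM, derX, Da, Db, Dc) /=.
- rewrite -[RHS](E (y^+2*b*c^+3) (-(x^+2*a^+3*b)) (-(2*x*y*a*b^+2*c) -z^+2*a^+2*c^+2)); ring: hv hw.
- rewrite -[RHS](E (2*y*z*a*b*c^+2) (-(x*y*a^+2*b^+2) +z^+2*a^+3*c) (-(x*z*a^+2*b^+2) -y^+2*b^+3*c)); ring: hv hw.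
- rewrite -[RHS](E (-(z^+2*a*c^+3)) (2*x*z*a^+2*b*c -y^+2*b^+2*c^+2) (-(x^+2*a*b^+3))); ring: hv hw.
Qed.

End Flow.
End Cubic.

(** * Uniqueness of a point with a given pullback of the differential *)

Section Jets.
Variables (S : comNzRingType) (C : fieldType) (e : {rmorphism S -> C}).
Variable D : S -> S.
Hypothesis DD : {morph D : a b / a + b}.
Hypothesis DM : forall a b, D (a * b) = D a * b + a * D b.

(** f vanishes to order n at the point e, the orders being counted with the
   derivation D. *)
Fixpoint flat n (f : S) : Prop :=
  if n is m.+1 then e f = 0 /\ flat m (D f) else True.

Lemma flatW n f : flat n.+1 f -> flat n f.
Proof. by elim: n f => [|n IH] f //= [-> /IH]. Qed.

Lemma flat0 n : flat n 0.
Proof. by elim: n => //= n IH; rewrite rmorph0 (der0 DD). Qed.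

Lemma flatD n f g : flat n f -> flat n g -> flat n (f + g).
Proof.
elim: n f g => //= n IH f g [f0 f1] [g0 g1].
by rewrite rmorphD f0 g0 addr0 DD; split => //; apply: IH.
Qed.

Lemma flatM n f g : flat n f -> flat n (g * f).
Proof.
elim: n f g => //= n IH f g [f0 f1]; rewrite rmorphM f0 mulr0 DM.
by split=> //; apply: flatD; apply: IH => //; apply: flatW.
Qed.

(** Leibniz rule: a factor that does not vanish at the point does not change
   the order of vanishing of the other. *)
Lemma flat_cancel n f g : e g != 0 -> flat n (g * f) -> flat n f.
Proof.
move=> g0; elim: n f => // n IH f gf.
have f_n : flat n f by apply/IH/flatW.
case: gf => /eqP; rewrite rmorphM mulf_eq0 (negPf g0) /= => /eqP f0 gf.
split=> //; apply: IH.
have -> : g * D f = D (g * f) + (- D g) * f by rewrite DM; ring.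
by apply: flatD => //; apply: flatM.
Qed.

(** Where the coordinates r and r' are nonzero, the differences of the affine
   coordinates of the two points satisfy a homogeneous linear differential
   system, so with zero initial values all derivatives vanish. The system is
   written without denominators, for r p' - p r' and r q' - q r'. *)
Lemma flow_unique_chart l k1 k2 p q r p' q' r' :
  r * D p - p * D r = l * k1 * q ^+ 2 ->
  r * D q - q * D r = l * k2 * p ^+ 2 ->
  r' * D p' - p' * D r' = l * k1 * q' ^+ 2 ->
  r' * D q' - q' * D r' = l * k2 * p' ^+ 2 ->
  e r != 0 -> e r' != 0 ->
  e (r * p' - p * r') = 0 -> e (r * q' - q * r') = 0 ->
  forall n, flat n (r * p' - p * r') /\ flat n (r * q' - q * r').
Proof.
move=> hp hq hp' hq' r0 r0' ep eq.
have rr0 : e (r * r') != 0 by rewrite rmorphM mulf_neq0.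
elim=> [|n [IHp IHq]] //; split; split=> //; apply: (flat_cancel rr0).
  have -> : r * r' * D (r * p' - p * r') =
      D (r * r') * (r * p' - p * r') + l * k1 * (r * q' + q * r') * (r * q' - q * r').
    rewrite (derB DD) !DM.
    transitivity ((D r * r' + r * D r') * (r * p' - p * r')
       + r ^+ 2 * (r' * D p' - p' * D r') - r' ^+ 2 * (r * D p - p * D r)); first by ring.
    by rewrite hp hp'; ring.
  by apply: flatD; apply: flatM.
have -> : r * r' * D (r * q' - q * r') =
    D (r * r') * (r * q' - q * r') + l * k2 * (r * p' + p * r') * (r * p' - p * r').
  rewrite (derB DD) !DM.
  transitivity ((D r * r' + r * D r') * (r * q' - q * r')
     + r ^+ 2 * (r' * D q' - q' * D r') - r' ^+ 2 * (r * D q - q * D r)); first by ring.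
  by rewrite hq hq'; ring.
by apply: flatD; apply: flatM.
Qed.

Definition mapv (T U : Type) (f : T -> U) (v : vec T) : vec U :=
  (f v.1.1, f v.1.2, f v.2).

Lemma mapv_cub v : cub (mapv e v) = e (cub v).
Proof. by rewrite /cub /= rmorphB rmorphD /= !rmorphXn. Qed.

Lemma mapv_par v w : par v w -> par (mapv e v) (mapv e w).
Proof. by case=> h1 h2 h3; split; rewrite /= -!rmorphM ?h1 ?h2 ?h3. Qed.

Lemma mapv_chord v w : mapv e (chord v w) = chord (mapv e v) (mapv e w).
Proof.
case: v w => [[x y] z] [[a b] c]; rewrite /mapv /chord /=.
by rewrite !(rmorphN, rmorphB, rmorphD, rmorphM, rmorphXn) /=.
Qed.

(** A point of the cubic is determined by its value at the base point and by
   the pullback l of the differential. The case distinction selects a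
   coordinate that does not vanish at the base point, Z or else X. *)
Lemma flow_unique l v w :
  (forall f, (forall n, flat n f) -> f = 0) ->
  cub (mapv e v) = 0 -> mapv e v <> (0, 0, 0) -> mapv e w <> (0, 0, 0) ->
  par (mapv e v) (mapv e w) ->
  flow D l v -> flow D l w -> par v w.
Proof.
move=> fl0; case: v w => [[x y] z] [[x' y'] z'] /cub0E/= hv v0 w0.
move=> [/= p1 p2 p3] [/= f1 f2 f3] [/= g1 g2 g3].
have [z0|z0] := eqVneq (e z) 0; last first.
  have z0' : e z' != 0.
    apply/eqP => h; case: w0; rewrite /mapv /= h.
    move: p1 p2; rewrite h !mulr0 => /esym/eqP; rewrite mulf_eq0 (negPf z0) /=.
    by move=> /eqP -> /eqP; rewrite mulf_eq0 (negPf z0) /= => /eqP ->.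
  have U : forall n, flat n (z * x' - x * z') /\ flat n (z * y' - y * z').
    apply: (@flow_unique_chart l 1 (-1)); rewrite ?mulr1 ?mulrN1 ?mulNr //.
    - by rewrite -f1 opprB.
    - by rewrite -g1 opprB.
    - by rewrite rmorphB !rmorphM p2 subrr.
    by rewrite rmorphB !rmorphM p1 subrr.
  have h1 : z * x' - x * z' = 0 by apply: fl0 => n; case: (U n).
  have h2 : z * y' - y * z' = 0 by apply: fl0 => n; case: (U n).
  split => /=; apply/eqP; rewrite -subr_eq0; apply/eqP.
  - by rewrite -opprB h2 oppr0.
  - by [].
  apply: fl0 => n; apply: (flat_cancel z0).
  have -> : z * (x * y' - y * x') = x * (z * y' - y * z') - y * (z * x' - x * z').
    by ring.
  by rewrite h1 h2 !mulr0 subr0; apply: flat0.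
have x0 : e x != 0.
  apply/eqP => h; case: v0; rewrite /mapv /= h z0.
  move: hv; rewrite z0 h !expr0n add0r => /esym/eqP; rewrite expf_eq0 /=.
  by move/eqP ->.
have x0' : e x' != 0.
  apply/eqP => h; case: w0; rewrite /mapv /= h.
  move: p2 p3; rewrite h !mulr0 => /esym/eqP; rewrite mulf_eq0 (negPf x0) /=.
  by move=> /eqP -> /eqP; rewrite mulf_eq0 (negPf x0) /= => /eqP ->.
have U : forall n, flat n (x * y' - y * x') /\ flat n (x * z' - z * x').
  apply: (@flow_unique_chart l (-1) (-1)); rewrite ?mulrN1 ?mulNr //.
  - by rewrite -f2 opprB.
  - by rewrite -g2 opprB.
  - by rewrite rmorphB !rmorphM p3 subrr.
  by rewrite rmorphB !rmorphM p2 subrr.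
have h1 : x * y' - y * x' = 0 by apply: fl0 => n; case: (U n).
have h2 : x * z' - z * x' = 0 by apply: fl0 => n; case: (U n).
split => /=; apply/eqP; rewrite -subr_eq0; apply/eqP.
- apply: fl0 => n; apply: (flat_cancel x0).
  have -> : x * (y * z' - z * y') = y * (x * z' - z * x') - z * (x * y' - y * x').
    by ring.
  by rewrite h1 h2 !mulr0 subr0; apply: flat0.
- by rewrite -opprB h2 oppr0.
by [].
Qed.

End Jets.

(** * The coordinate ring of the chart X = 1 *)

(** The ring C[t, v] / (v^3 - t^3 + 1) as a free module over C[t] with basis
   1, v, v^2: the functions on the affine part X = 1 of the cubic, where
   (X : Y : Z) = (1 : v : t). *)
Definition chartRing (C : numFieldType) : Type :=
  ({poly C} * {poly C} * {poly C})%type.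

Section ChartRing.
Variable C : numFieldType.
Local Notation A := (chartRing C).
Local Notation W := ('X ^+ 3 - 1 : {poly C}).
Implicit Types f g h : A.

HB.instance Definition _ := GRing.Zmodule.copy A ({poly C} * {poly C} * {poly C})%type.

Definition chart_one : A := (1, 0, 0).

Definition chart_mul f g : A :=
  (f.1.1 * g.1.1 + W * (f.1.2 * g.2 + f.2 * g.1.2),
   f.1.1 * g.1.2 + f.1.2 * g.1.1 + W * (f.2 * g.2),
   f.1.1 * g.2 + f.1.2 * g.1.2 + f.2 * g.1.1).

Lemma chart_mulA : associative chart_mul.
Proof.
case=> [[f0 f1] f2] [[g0 g1] g2] [[h0 h1] h2].
by rewrite /chart_mul /=; congr (_, _, _); ring.
Qed.

Lemma chart_mulC : commutative chart_mul.
Proof.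
case=> [[f0 f1] f2] [[g0 g1] g2].
by rewrite /chart_mul /=; congr (_, _, _); ring.
Qed.

Lemma chart_mul1 : left_id chart_one chart_mul.
Proof.
case=> [[f0 f1] f2].
by rewrite /chart_mul /=; congr (_, _, _); ring.
Qed.

Lemma chart_mulDl : left_distributive chart_mul +%R.
Proof.
case=> [[f0 f1] f2] [[g0 g1] g2] [[h0 h1] h2].
by rewrite /chart_mul /=; congr (_, _, _); rewrite /=; ring.
Qed.

Lemma chart_one_neq0 : chart_one != 0.
Proof. by apply/eqP => -[] /eqP; rewrite oner_eq0. Qed.

HB.instance Definition _ := GRing.Zmodule_isComNzRing.Build A
  chart_mulA chart_mulC chart_mul1 chart_mulDl chart_one_neq0.

Lemma chart_mulE f g : f * g = chart_mul f g. Proof. by []. Qed.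

Definition chart_poly (p : {poly C}) : A := (p, 0, 0).
Definition chart_v : A := (0, 1, 0).
Definition chart_t : A := chart_poly 'X.

Lemma chart_poly_additive : zmod_morphism chart_poly.
Proof. by move=> p q; rewrite /chart_poly; congr (_, _, _); rewrite /= subr0. Qed.

Lemma chart_poly_multiplicative : monoid_morphism chart_poly.
Proof.
split=> [|p q] //; rewrite chart_mulE /chart_mul /chart_poly /=.
by congr (_, _, _); ring.
Qed.

HB.instance Definition _ := GRing.isZmodMorphism.Build {poly C} A chart_poly
  chart_poly_additive.
HB.instance Definition _ := GRing.isMonoidMorphism.Build {poly C} A chart_poly
  chart_poly_multiplicative.

Definition chart_const : C -> A := chart_poly \o polyC.
HB.instance Definition _ := GRing.RMorphism.on chart_const.

Lemma chart_v3 : chart_v ^+ 3 = chart_t ^+ 3 - 1.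
Proof.
rewrite -!rmorphXn -(rmorph1 chart_poly) -rmorphB !exprS expr0 mulr1.
rewrite !chart_mulE /chart_mul /chart_poly /=; congr (_, _, _); ring.
Qed.

(** The derivation with D t = v^2 and D v = t^2, dual to the invariant
   differential. *)
Definition chart_D f : A :=
  (f.1.2^`() * W + 'X ^+ 2 * f.1.2,
   f.2^`() * W + 2%:R * 'X ^+ 2 * f.2, f.1.1^`()).

Lemma chart_DD : {morph chart_D : f g / f + g}.
Proof.
case=> [[f0 f1] f2] [[g0 g1] g2].
by rewrite /chart_D /=; congr (_, _, _); rewrite /= ?derivD; ring.
Qed.

Lemma derivW : W^`() = 3%:R * 'X ^+ 2.
Proof. by rewrite derivB derivXn derivC subr0 mulr_natl. Qed.

Lemma chart_DM f g : chart_D (f * g) = chart_D f * g + f * chart_D g.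
Proof.
case: f g => [[f0 f1] f2] [[g0 g1] g2]; rewrite !chart_mulE.
rewrite /chart_D /chart_mul /=; congr (_, _, _);
  by rewrite /= !(derivW, derivD, derivM); ring.
Qed.

Lemma chart_D_poly p : chart_D (chart_poly p) = chart_poly p^`() * chart_v ^+ 2.
Proof.
rewrite expr2 !chart_mulE /chart_D /chart_mul /chart_poly /=.
by congr (_, _, _); rewrite /= ?deriv0; ring.
Qed.

Lemma chart_D_t : chart_D chart_t = chart_v ^+ 2.
Proof. by rewrite chart_D_poly derivX rmorph1 mul1r. Qed.

Lemma chart_D_const c : chart_D (chart_const c) = 0.
Proof. by rewrite /chart_const /= chart_D_poly derivC rmorph0 mul0r. Qed.

Lemma chart_D_v : chart_D chart_v = chart_t ^+ 2.
Proof.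
rewrite -rmorphXn /chart_D /chart_poly /=.
by congr (_, _, _); rewrite /= ?deriv0 -?polyC1 ?derivC ?polyC1
  ?mul0r ?mulr0 ?addr0 ?add0r ?mulr1.
Qed.

Definition chart_gen : vec A := (1, chart_v, chart_t).

Lemma cub_chart_gen : cub chart_gen = 0.
Proof. by rewrite /cub /= chart_v3; ring. Qed.

(** The derivation is normalised so that the invariant differential takes the
   value - 1 at the generic point. *)
Lemma flow_chart_gen : flow chart_D (- 1) chart_gen.
Proof.
have h := chart_v3.
have D1 : chart_D 1 = 0 := chart_D_const 1.
by split; rewrite /= ?D1 ?chart_D_t ?chart_D_v; ring: h.
Qed.

(** Evaluation at the point (1 : v : t). The hypothesis that the point lies on
   the cubic is an argument so that the function can be declared a ring
   morphism. *)
Definition chart_eval (v t : C) (_ : v ^+ 3 = t ^+ 3 - 1) f : C :=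
  f.1.1.[t] + f.1.2.[t] * v + f.2.[t] * v ^+ 2.

Section Eval.
Variables (v t : C) (vt : v ^+ 3 = t ^+ 3 - 1).

Lemma chart_eval_additive : zmod_morphism (chart_eval vt).
Proof.
move=> [[f0 f1] f2] [[g0 g1] g2]; rewrite /chart_eval /=.
by rewrite !(hornerD, hornerN); ring.
Qed.

Lemma chart_eval_multiplicative : monoid_morphism (chart_eval vt).
Proof.
split=> [|f g]; rewrite /chart_eval ?chart_mulE /=.
  by rewrite -polyC1 hornerC horner0 !mul0r !addr0.
rewrite -polyC1 !(hornerXn, hornerX, hornerC, hornerD, hornerN, hornerM).
by ring: vt.
Qed.

HB.instance Definition _ := GRing.isZmodMorphism.Build A C (chart_eval vt)
  chart_eval_additive.
HB.instance Definition _ := GRing.isMonoidMorphism.Build A C (chart_eval vt)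
  chart_eval_multiplicative.

Lemma chart_eval_poly p : chart_eval vt (chart_poly p) = p.[t].
Proof. by rewrite /chart_eval /= horner0 !mul0r !addr0. Qed.

Lemma chart_eval_const c : chart_eval vt (chart_const c) = c.
Proof. by rewrite chart_eval_poly hornerC. Qed.

Lemma chart_eval_v : chart_eval vt chart_v = v.
Proof.
by rewrite /chart_eval /= -polyC1 hornerC horner0 mul1r mul0r add0r addr0.
Qed.

End Eval.

(** The determinant of the multiplication by f on the basis 1, v, v^2. *)
Definition chart_norm f : {poly C} :=
  f.1.1 ^+ 3 + W * f.1.2 ^+ 3 + W ^+ 2 * f.2 ^+ 3
  - 3%:R * W * (f.1.1 * f.1.2 * f.2).

Definition chart_adj f : A :=
  (f.1.1 ^+ 2 - W * (f.1.2 * f.2), W * f.2 ^+ 2 - f.1.1 * f.1.2,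
   f.1.2 ^+ 2 - f.1.1 * f.2).

Lemma chart_mul_adj f : chart_adj f * f = chart_poly (chart_norm f).
Proof.
case: f => [[f0 f1] f2]; rewrite chart_mulE /chart_mul /chart_poly /=.
by congr (_, _, _); rewrite /chart_norm /=; ring.
Qed.

(** The cubic is irreducible, so the norm of a nonzero function is nonzero. The
   proof is an infinite descent: 'X - 1 divides 'X ^+ 3 - 1 exactly once, so it
   divides f0, then f1, then f2, and can be divided out. *)
Lemma chart_norm_eq0 f : chart_norm f = 0 -> f = 0.
Proof.
pose u : {poly C} := 'X - 1%:P; pose w1 : {poly C} := 'X ^+ 2 + 'X + 1.
have WE : W = w1 * u by rewrite /w1 /u; ring.
have w11 : w1.[1] != 0.
  rewrite /w1 -polyC1 !(hornerXn, hornerD, hornerX, hornerC) expr1n.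
  by rewrite (_ : 1 + 1 + 1 = 3%:R) ?pnatr_eq0 //; ring.
have u0 : u != 0 by rewrite polyXsubC_eq0.
(* w does not vanish at 1, so p does *)
have rt (a : nat) (p q : {poly C}) (w : {poly C}) (w_1 : w.[1] != 0) :
    p ^+ 3 * w ^+ a + q * u = 0 ->
    exists g : {poly C}, p = g * u.
  move=> /(congr1 (fun r => r.[1])) /eqP.
    rewrite !(horner_exp, hornerX, hornerC, hornerD, hornerN, hornerM) subrr mulr0 addr0 ?horner0.
  rewrite mulf_eq0 !expf_eq0 (negPf w_1) andbF orbF /= => p1.
  by have /factor_theorem[g ->] : root p 1 by []; exists g.
have sz (p : {poly C}) m : (size (p * u)%R <= m.+1)%N -> (size p <= m)%N.
  have [->|p0] := eqVneq p 0; first by rewrite size_poly0.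
  by rewrite size_Mmonic ?monicXsubC // size_XsubC addn2.
case: f => [[f0 f1] f2].
have [m] := ubnP (maxn (size f0) (maxn (size f1) (size f2))).
elim: m f0 f1 f2 => // m IH f0 f1 f2.
rewrite ltnS !geq_max => /and3P[s0 s1 s2]; rewrite /chart_norm /= WE => h.
have [g0 E0] : exists g : {poly C}, f0 = g * u.
  apply: (rt 0%N _ (w1 * f1 ^+ 3 + u * w1 ^+ 2 * f2 ^+ 3 - 3%:R * w1 * (f0 * f1 * f2)) w1 w11).
  by rewrite -[RHS]h; ring.
have [g1 E1] : exists g : {poly C}, f1 = g * u.
  apply: (rt 1%N _ (u * g0 ^+ 3 + w1 ^+ 2 * f2 ^+ 3 - 3%:R * w1 * (g0 * f1 * f2)) w1 w11).
  by apply: (mulIf u0); rewrite mul0r -[RHS]h E0; ring.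
have [g2 E2] : exists g : {poly C}, f2 = g * u.
  apply: (rt 2%N _ (g0 ^+ 3 + u * w1 * g1 ^+ 3 - 3%:R * w1 * (g0 * g1 * f2)) w1 w11).
  by apply: (mulIf u0); apply: (mulIf u0); rewrite !mul0r -[RHS]h E0 E1; ring.
case: m IH s0 s1 s2 => [|m] IH s0 s1 s2.
  move: s0 s1 s2; rewrite !size_poly_leq0 => /eqP-> /eqP-> /eqP->; reflexivity.
suff [E3 E4 E5] : (g0, g1, g2) = 0 :> A by rewrite E0 E1 E2 E3 E4 E5 !mul0r.
apply: IH.
  rewrite ltnS !geq_max; apply/and3P; split.
  - by apply: sz; rewrite -E0.
  - by apply: sz; rewrite -E1.
  by apply: sz; rewrite -E2.
apply: (mulIf u0); apply: (mulIf u0); apply: (mulIf u0).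
by rewrite /chart_norm !mul0r -[RHS]h WE E0 E1 E2 /=; ring.
Qed.

Lemma base_vt : (- 1 : C) ^+ 3 = 0 ^+ 3 - 1.
Proof. by ring. Qed.

(** A function that vanishes to infinite order at O is 0. For a polynomial in t
   this follows by induction on the degree, because D p = p' v^2 and v is
   nonzero at O; the general case follows by taking norms. *)
Lemma flat_chart0 f :
  (forall n, flat (chart_eval base_vt) chart_D n f) -> f = 0.
Proof.
have flp (p : {poly C}) :
    (forall n, flat (chart_eval base_vt) chart_D n (chart_poly p)) -> p = 0.
  have [m] := ubnP (size p); elim: m p => // m IH p; rewrite ltnS => sp fl.
  apply/eqP; apply: contraT => p0.
  have dp0 : p^`() = 0.
    apply: IH; first exact: leq_trans (lt_size_deriv p0) sp.
    move=> n; have [_] := fl n.+1; rewrite chart_D_poly mulrC.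
    apply: (flat_cancel chart_DD chart_DM).
    by rewrite rmorphXn /= chart_eval_v sqrrN expr1n oner_eq0.
  have pC : p = (p`_0)%:P.
    apply/polyP => -[|i]; rewrite coefC //=.
    have /eqP := congr1 (fun q : {poly C} => q`_i) dp0.
    by rewrite coef_deriv coef0 mulrn_eq0 /= => /eqP.
  have [+ _] := fl 1%N; rewrite /= chart_eval_poly pC hornerC => c0.
  by case/eqP: p0; rewrite pC c0.
move=> fl; apply: chart_norm_eq0; apply: flp => n; rewrite -chart_mul_adj.
exact: flatM chart_DD chart_DM _ _ _ _.
Qed.

End ChartRing.

(** * Homogenisation and Wronskians *)

Lemma size_mul_leq (R : nzRingType) (p q : {poly R}) m n :
  (size p <= m.+1)%N -> (size q <= n.+1)%N -> (size (p * q)%R <= (m + n).+1)%N.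
Proof.
move=> sp sq; apply: leq_trans (size_polyMleq _ _) _.
by move: (leq_add sp sq); rewrite addSn addnS; case: (size p + size q)%N.
Qed.

Section Homogenization.
Variables (C : numFieldType) (S : comNzRingType) (i : {rmorphism C -> S}).
Implicit Types p q : {poly C}.

(** The homogenisation w^d p(s / w), with coefficients sent to S by i. *)
Definition hom d p (s w : S) : S := \sum_(k < d.+1) i p`_k * s ^+ k * w ^+ (d - k).

Section Point.
Variables s w : S.

Lemma homD d p q : hom d (p + q) s w = hom d p s w + hom d q s w.
Proof.
rewrite -big_split; apply: eq_bigr => k _.
by rewrite coefD rmorphD /= !mulrDl.
Qed.

Lemma homZ d c p : hom d (c *: p) s w = i c * hom d p s w.
Proof.
rewrite big_distrr; apply: eq_bigr => k _.
by rewrite coefZ rmorphM /= !mulrA.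
Qed.

Lemma homN d p : hom d (- p) s w = - hom d p s w.
Proof. by rewrite -scaleN1r homZ rmorphN1 mulN1r. Qed.

Lemma homB d p q : hom d (p - q) s w = hom d p s w - hom d q s w.
Proof. by rewrite homD homN. Qed.

Lemma homMn d p n : hom d (p *+ n) s w = hom d p s w *+ n.
Proof. by rewrite -scaler_nat homZ rmorph_nat mulr_natl. Qed.

Lemma homC d c : hom d c%:P s w = i c * w ^+ d.
Proof.
rewrite /hom big_ord_recl coefC /= mulr1 subn0 big1 ?addr0 // => k _.
by rewrite coefC /= rmorph0 !mul0r.
Qed.

Lemma homMX d p : hom d.+1 (p * 'X) s w = s * hom d p s w.
Proof.
rewrite /hom big_ord_recl coefMX /= rmorph0 !mul0r add0r big_distrr /=.
apply: eq_bigr => k _; rewrite coefMX /= subSS exprS.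
by rewrite -!mulrA mulrCA.
Qed.

Lemma hom_widen d p : (size p <= d.+1)%N -> hom d.+1 p s w = w * hom d p s w.
Proof.
move=> sp; rewrite /hom big_ord_recr /= nth_default // rmorph0 !mul0r addr0.
rewrite big_distrr; apply: eq_bigr => k _ /=.
by rewrite subSn -1?ltnS // exprS mulrCA.
Qed.

Lemma hom_widenn n d p :
  (size p <= d.+1)%N -> hom (n + d) p s w = w ^+ n * hom d p s w.
Proof.
move=> sp; elim: n => [|n IH]; first by rewrite mul1r.
rewrite addSn hom_widen ?IH ?exprS ?mulrA //.
by apply: leq_trans sp _; rewrite ltnS leq_addl.
Qed.

Lemma homM d e p q : (size p <= d.+1)%N -> (size q <= e.+1)%N ->
  hom (d + e) (p * q) s w = hom d p s w * hom e q s w.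
Proof.
move=> + sq; elim/poly_ind: p d => [|p c IH] d.
  by move=> _; rewrite mul0r -polyC0 !homC rmorph0 !mul0r.
rewrite size_MXaddC; have [-> /= | _] := eqVneq p 0 => [sp|].
  rewrite mul0r add0r homC mul_polyC homZ hom_widenn //.
  by rewrite mulrA.
rewrite ltnS; case: d => [|d] sp.
  move: sp; rewrite size_poly_leq0 => /eqP->.
  by rewrite mul0r add0r homC mul_polyC homZ add0n mulr1.
rewrite mulrDl homD mul_polyC homZ (hom_widenn d.+1 sq).
rewrite (mulrAC p) addSn homMX IH // homD homC homMX.
by rewrite mulrDl !mulrA.
Qed.

End Point.

Section Derivation.
Variable D : S -> S.
Hypothesis DD : {morph D : a b / a + b}.
Hypothesis DM : forall a b, D (a * b) = D a * b + a * D b.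
Hypothesis Di : forall c, D (i c) = 0.

Lemma der_sum (I : Type) (r : seq I) (F : I -> S) :
  D (\sum_(k <- r) F k) = \sum_(k <- r) D (F k).
Proof. exact: (big_morph D DD (der0 DD)). Qed.

(** The two coefficients are the partial derivatives of the homogenisation;
   by Euler the derivative with respect to w comes from (d + 1) p - 'X p'. *)
Lemma der_hom d p s w : D (hom d.+1 p s w) =
  hom d p^`() s w * D s + hom d (p *+ d.+1 - p^`() * 'X) s w * D w.
Proof.
rewrite /hom der_sum.
under eq_bigr => k _ do rewrite 2!DM Di mul0r add0r !(derX DM).
rewrite big_split /= big_ord_recl /= mulr0n !mulr0 !mul0r add0r; congr (_ + _).
  rewrite big_distrl; apply: eq_bigr => k _ /=.
  rewrite coef_deriv rmorphMn /= subSS !mulrnAr !mulrnAl; congr (_ *+ _).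
  ring.
rewrite big_ord_recr /= subnn mulr0n mulr0 addr0 big_distrl.
apply: eq_bigr => k _ /=; have kd : (k <= d)%N by rewrite -ltnS.
have -> : (p *+ d.+1 - p^`() * 'X)`_k = p`_k *+ (d.+1 - k).
  rewrite coefB coefMn coefMX coef_deriv.
  case: (k : nat) (leqW kd) => [|m] /= md; first by rewrite subr0 subn0.
  by rewrite -mulrnBr.
by rewrite rmorphMn /= subSn //= !mulrnAr !mulrnAl mulrA.
Qed.

Lemma char0_mulIn n (a b : S) : a *+ n.+1 = b *+ n.+1 -> a = b.
Proof.
move=> ab; have h : i n.+1%:R^-1 * n.+1%:R = 1.
  by rewrite -(rmorph_nat i) -rmorphM mulVf ?pnatr_eq0 // rmorph1.
by rewrite -[a]mul1r -[b]mul1r -h -!mulrA !mulr_natl ab.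
Qed.

Lemma size_homB d p : (size p <= d.+2)%N ->
  (size (p *+ d.+1 - p^`() * 'X)%R <= d.+1)%N.
Proof.
move=> sp; apply/leq_sizeP => j dj; rewrite coefB coefMn coefMX coef_deriv.
case: j dj => [|j] //= dj; move: dj; rewrite ltnS leq_eqVlt => /orP[/eqP<-|dj].
  by rewrite subrr.
by rewrite nth_default ?mul0rn ?subrr // (leq_trans sp).
Qed.

Lemma size_deriv_le d p : (size p <= d.+2)%N -> (size p^`() <= d.+1)%N.
Proof.
by move=> sp; have [->|p0] := eqVneq p 0; rewrite ?deriv0 ?size_poly0 // -ltnS;
  apply: leq_trans sp; apply: lt_size_deriv.
Qed.

Definition wronsk p q := p^`() * q - p * q^`().

(** This form shows that the two terms of top degree cancel. *)
Lemma wronskE d p q : wronsk p q *+ d =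
  p^`() * (q *+ d - q^`() * 'X) - (p *+ d - p^`() * 'X) * q^`().
Proof. by rewrite /wronsk; ring. Qed.

Lemma size_wronsk d p q : (size p <= d.+2)%N -> (size q <= d.+2)%N ->
  (size (wronsk p q) <= (d + d).+1)%N.
Proof.
move=> sp sq.
have -> : size (wronsk p q) = size (wronsk p q *+ d.+1).
  by rewrite -scaler_nat size_scale // pnatr_eq0.
rewrite wronskE; apply: (leq_trans (size_polyD _ _)).
rewrite size_polyN geq_max !size_mul_leq //; first exact: size_homB.
- exact: size_deriv_le.
- exact: size_deriv_le.
- exact: size_homB.
Qed.

(** Quotient rule for p(s / w) / q(s / w), with the denominators cleared. Euler's
   identity is applied to d.+1 times each side, and [char0_mulIn] removes the
   factor. *)
Lemma hom_wronsk d p q s w : (size p <= d.+1)%N -> (size q <= d.+1)%N ->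
  hom d q s w * D (hom d p s w) - hom d p s w * D (hom d q s w) =
  hom (d.-1 + d.-1) (wronsk p q) s w * (w * D s - s * D w).
Proof.
case: d => [|d] sp sq.
  rewrite (size1_polyC sp) (size1_polyC sq) /wronsk !derivC mul0r mulr0 subr0.
  rewrite -polyC0 !homC rmorph0 !DM !Di !expr0 !(der1 DM).
  by rewrite !(mul0r, mulr0, addr0, subr0).
have E (r : {poly C}) : (size r <= d.+2)%N ->
    hom d.+1 r s w *+ d.+1 = s * hom d r^`() s w + w * hom d (r *+ d.+1 - r^`() * 'X) s w.
  move=> sr; rewrite -homMX -hom_widen ?size_homB // -homD -homMn.
  by congr (hom _ _ _ _); ring.
apply: (@char0_mulIn d).
transitivity ((hom d.+1 q s w *+ d.+1) * D (hom d.+1 p s w)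
  - (hom d.+1 p s w *+ d.+1) * D (hom d.+1 q s w)); first by ring.
transitivity ((hom (d + d) (wronsk p q) s w *+ d.+1) * (w * D s - s * D w));
  last by ring.
rewrite -[hom (d + d) _ _ _ *+ _]homMn wronskE homB !homM ?size_homB ?size_deriv_le // !E // !der_hom.
by ring.
Qed.

Lemma homM_wronsk d (l p q : {poly C}) s w : (size l <= 3)%N ->
  (size p <= d.+1)%N -> (size q <= d.+1)%N ->
  hom 2 l s w * hom (d.-1 + d.-1) (wronsk p q) s w = hom (d + d) (l * wronsk p q) s w.
Proof.
case: d => [|d] sl sp sq.
  rewrite (size1_polyC sp) (size1_polyC sq) /wronsk !derivC mul0r mulr0 subr0.
  by rewrite mulr0 -polyC0 !homC rmorph0 !mul0r mulr0.
by rewrite (_ : d.+1 + d.+1 = 2 + (d + d))%N ?homM ?size_wronsk // addSn addnS.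
Qed.

(** Euler's identity: the logarithmic derivative of a form of degree 3 d in x, z is
   that of z^(3 d) plus a multiple of that of x / z. Used where the two
   polynomials to compare have different degrees. *)
Lemma der_hom_cube d p x z : (size p <= d.+1)%N ->
  x * z * D (hom d p (x ^+ 3) (z ^+ 3)) =
  3%:R * (z * D x - x * D z) * hom d (p^`() * 'X) (x ^+ 3) (z ^+ 3)
  + 3%:R * x * D z * (hom d p (x ^+ 3) (z ^+ 3) *+ d).
Proof.
case: d => [|d] sp.
  rewrite (size1_polyC sp) derivC mul0r -polyC0 !homC rmorph0 DM Di expr0.
  by rewrite (der1 DM) !(mul0r, mulr0, mulr0n, addr0).
rewrite der_hom homMX (derX DM) (derX DM) /=.
have -> : hom d.+1 p (x ^+ 3) (z ^+ 3) *+ d.+1 = x ^+ 3 * hom d p^`() (x ^+ 3) (z ^+ 3)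
    + z ^+ 3 * hom d (p *+ d.+1 - p^`() * 'X) (x ^+ 3) (z ^+ 3).
  by rewrite -homMX -hom_widen ?size_homB // -homD -homMn; congr (hom _ _ _ _); ring.
by ring.
Qed.

End Derivation.
End Homogenization.

(** * Maps of the cubic given by three polynomials *)

Section HomMore.
Variables (C : numFieldType) (S : comNzRingType) (i : {rmorphism C -> S}).
Implicit Types p q : {poly C}.

Lemma hom_morph (S' : comNzRingType) (i' : {rmorphism C -> S'})
    (f : {rmorphism S -> S'}) d p s w :
  (forall c, f (i c) = i' c) -> f (hom i d p s w) = hom i' d p (f s) (f w).
Proof.
move=> fi; rewrite rmorph_sum; apply: eq_bigr => k _.
by rewrite !rmorphM !rmorphXn fi.
Qed.

Lemma hom_scale d p k s w :
  hom i d p (k * s) (k * w) = k ^+ d * hom i d p s w.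
Proof.
rewrite big_distrr; apply: eq_bigr => j _ /=; rewrite !exprMn.
rewrite -[in k ^+ d](subnKC (_ : (j <= d)%N)) -1?ltnS // exprD.
by ring.
Qed.

Lemma size_exp_hom d n p : (size p <= d.+1)%N -> (size (p ^+ n)%R <= (n * d).+1)%N.
Proof.
move=> sp; elim: n => [|n IH]; first by rewrite expr0 size_poly1.
by rewrite exprS mulSn size_mul_leq.
Qed.

Lemma homX d n p s w : (size p <= d.+1)%N ->
  hom i (n * d) (p ^+ n) s w = hom i d p s w ^+ n.
Proof.
move=> sp; elim: n => [|n IH]; first by rewrite (homC i s w 0 1) rmorph1 mulr1.
by rewrite !exprS mulSn homM ?IH ?size_exp_hom.
Qed.

Lemma hom1X s w : hom i 1 'X s w = s.
Proof. by rewrite -['X]mul1r homMX (homC i s w 0 1) rmorph1 !mulr1. Qed.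

Lemma hom11 s w : hom i 1 1 s w = w.
Proof. by rewrite (homC i s w 1 1) rmorph1 mul1r. Qed.

Lemma hom1BX s w : hom i 1 (1 - 'X) s w = w - s.
Proof. by rewrite homB hom11 hom1X. Qed.

Lemma size1BX : size (1 - 'X : {poly C}) = 2.
Proof. by rewrite -size_polyN opprB size_XsubC. Qed.

Lemma sizeXBX : (size ('X * (1 - 'X) : {poly C})%R <= 3)%N.
Proof. by rewrite (@size_mul_leq _ _ _ 1 1) ?size_polyX ?size1BX. Qed.

Lemma hom2X s w : hom i 2 'X s w = s * w.
Proof. by rewrite -['X]mul1r homMX hom11. Qed.

Lemma hom2BX s w : hom i 2 (1 - 'X) s w = (w - s) * w.
Proof. by rewrite hom_widen ?size1BX // hom1BX mulrC. Qed.

Lemma hom2XBX s w : hom i 2 ('X * (1 - 'X)) s w = s * (w - s).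
Proof. by rewrite mulrC homMX hom1BX. Qed.

End HomMore.

Section Phi.
Variables (C : numFieldType) (S : comNzRingType) (i : {rmorphism C -> S}).
Variables (d : nat) (al be ga : {poly C}).
Implicit Types v : vec S.

(** The ratio of the first and third coordinates is x al / (z ga) for [phiA] and
   al / (x y z ga) for [phiB]: the shapes X mu(X^3) and eta(X^3) X^2 / Y, in
   homogeneous coordinates and with forms of degree 3 d + 1 and 3 d + 3. *)
Definition phiA v : vec S :=
  (v.1.1 * hom i d al (v.1.1 ^+ 3) (v.2 ^+ 3),
   v.1.2 * hom i d be (v.1.1 ^+ 3) (v.2 ^+ 3),
   v.2 * hom i d ga (v.1.1 ^+ 3) (v.2 ^+ 3)).

Definition phiB v : vec S :=
  (hom i d.+1 al (v.1.1 ^+ 3) (v.2 ^+ 3),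
   hom i d.+1 be (v.1.1 ^+ 3) (v.2 ^+ 3),
   v.1.1 * v.1.2 * v.2 * hom i d ga (v.1.1 ^+ 3) (v.2 ^+ 3)).

Lemma phiA_scal k v : phiA (scal k v) = scal (k ^+ (3 * d).+1) (phiA v).
Proof.
case: v => [[x y] z]; rewrite /phiA /scal /= !exprMn !hom_scale -!exprM (exprS k).
by congr (_, _, _); ring.
Qed.

Lemma phiB_scal k v : phiB (scal k v) = scal (k ^+ (3 * d.+1)) (phiB v).
Proof.
case: v => [[x y] z]; rewrite /phiB /scal /= !exprMn !hom_scale -!exprM mulnS (exprD k).
by congr (_, _, _); ring.
Qed.

End Phi.

Lemma phiA_map (C : numFieldType) (S S' : comNzRingType) (i : {rmorphism C -> S})
    (i' : {rmorphism C -> S'}) (f : {rmorphism S -> S'}) d al be ga v :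
  (forall c, f (i c) = i' c) ->
  mapv f (phiA i d al be ga v) = phiA i' d al be ga (mapv f v).
Proof.
move=> fi; rewrite /mapv /phiA /= !rmorphM /=.
by rewrite !(hom_morph _ _ _ _ fi) !rmorphXn.
Qed.

Lemma phiB_map (C : numFieldType) (S S' : comNzRingType) (i : {rmorphism C -> S})
    (i' : {rmorphism C -> S'}) (f : {rmorphism S -> S'}) d al be ga v :
  (forall c, f (i c) = i' c) ->
  mapv f (phiB i d al be ga v) = phiB i' d al be ga (mapv f v).
Proof.
move=> fi; rewrite /mapv /phiB /= !rmorphM /=.
by rewrite !(hom_morph _ _ _ _ fi) !rmorphXn.
Qed.

Section TypeA.
Variables (C : numFieldType) (d : nat) (al be ga : {poly C}) (c : C).
Hypotheses (sa : (size al <= d.+1)%N) (sb : (size be <= d.+1)%N)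
  (sg : (size ga <= d.+1)%N).
Hypothesis be0 : be != 0.
Hypothesis E : 'X * al ^+ 3 + (1 - 'X) * be ^+ 3 = ga ^+ 3.
Hypothesis I1 : al * ga + 'X * wronsk al ga *+ 3 = c *: be ^+ 2.

Lemma odeA_deriv : al ^+ 3 + 3%:R * 'X * al ^+ 2 * al^`() - be ^+ 3
   + 3%:R * (1 - 'X) * be ^+ 2 * be^`() = 3%:R * ga ^+ 2 * ga^`().
Proof.
have := congr1 (fun p => p^`()) E.
rewrite -polyC1 !(deriv_exp, derivX, derivC, derivD, derivN, derivM) polyC1 /=.
move/eqP; rewrite -subr_eq0 => /eqP h.
by apply/eqP; rewrite -subr_eq0; apply/eqP; rewrite -[RHS]h; ring.
Qed.

(** The condition on the pullback of the differential has three components, one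
   for each pair of coordinates. On the curve one of them implies the others:
   the multiple by be^2 of this one is a combination of the given one, of the
   equation of the curve and of its derivative. *)
Lemma odeA0 : be * ga - (1 - 'X) * wronsk be ga *+ 3 = c *: al ^+ 2.
Proof.
have b0 : be ^+ 2 != 0 by rewrite expf_neq0.
apply: (mulfI b0).
have -> : be ^+ 2 * (c *: al ^+ 2) = al ^+ 2 * (c *: be ^+ 2) by rewrite -!scalerAr mulrC.
rewrite -I1 /wronsk; have h := odeA_deriv.
transitivity (al ^+ 2 * (al * ga + 'X * (al^`() * ga - al * ga^`()) *+ 3)
  + 3%:R * ga^`() * ('X * al ^+ 3 + (1 - 'X) * be ^+ 3 - ga ^+ 3)
  - ga * ((al ^+ 3 + 3%:R * 'X * al ^+ 2 * al^`() - be ^+ 3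
   + 3%:R * (1 - 'X) * be ^+ 2 * be^`()) - 3%:R * ga ^+ 2 * ga^`())); first by ring.
by rewrite h E !subrr !mulr0 addr0 subr0.
Qed.

Lemma odeA2 : al * be + 'X * (1 - 'X) * wronsk al be *+ 3 = c *: ga ^+ 2.
Proof.
have b0 : be ^+ 2 != 0 by rewrite expf_neq0.
apply: (mulfI b0).
have -> : be ^+ 2 * (c *: ga ^+ 2) = ga ^+ 2 * (c *: be ^+ 2) by rewrite -!scalerAr mulrC.
rewrite -I1 /wronsk; have h := odeA_deriv.
transitivity (ga ^+ 2 * (al * ga + 'X * (al^`() * ga - al * ga^`()) *+ 3)
  + (3%:R * 'X * al^`() + al) * ('X * al ^+ 3 + (1 - 'X) * be ^+ 3 - ga ^+ 3)
  - 'X * al * ((al ^+ 3 + 3%:R * 'X * al ^+ 2 * al^`() - be ^+ 3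
   + 3%:R * (1 - 'X) * be ^+ 2 * be^`()) - 3%:R * ga ^+ 2 * ga^`())); first by ring.
by rewrite h E !subrr !mulr0 addr0 subr0.
Qed.

Section Ring.
Variables (S : comNzRingType) (i : {rmorphism C -> S}).
Implicit Types v : vec S.

Lemma cub_phiA v : cub v = 0 -> cub (phiA i d al be ga v) = 0.
Proof.
case: v => [[x y] z] /cub0E /= hv; rewrite /cub /phiA /= !exprMn.
have sX (p : {poly C}) : (size p <= d.+1)%N -> (size (p ^+ 3)%R <= (3 * d).+1)%N.
  exact: size_exp_hom.
have := congr1 (fun p => hom i (1 + 3 * d) p (x ^+ 3) (z ^+ 3)) E.
have M (p q : {poly C}) : (size p <= 2)%N -> (size q <= (3 * d).+1)%N ->
    hom i (1 + 3 * d) (p * q) (x ^+ 3) (z ^+ 3) =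
    hom i 1 p (x ^+ 3) (z ^+ 3) * hom i (3 * d) q (x ^+ 3) (z ^+ 3) by exact: homM.
rewrite -[ga ^+ 3]mul1r homD !M ?size_polyX ?size1BX ?size_poly1 ?sX //.
rewrite !homX // hom1X hom1BX hom11 => h.
by rewrite -h; ring: hv.
Qed.

Variable D : S -> S.
Hypothesis DD : {morph D : a b / a + b}.
Hypothesis DM : forall a b, D (a * b) = D a * b + a * D b.
Hypothesis Di : forall c, D (i c) = 0.

(** Each component of the cross product is a Wronskian term from [hom_wronsk]
   plus a term from differentiating x, y or z, and the differential equations
   for al, be, ga were arranged to match their sum. *)
Lemma flow_phiA l v : cub v = 0 -> flow D l v ->
  flow D (i c * l) (phiA i d al be ga v).
Proof.
case: v => [[x y] z] /cub0E /= hv [/= h0 h1 h2].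
have hw (p q : {poly C}) : (size p <= d.+1)%N -> (size q <= d.+1)%N ->
    hom i d q (x ^+ 3) (z ^+ 3) * D (hom i d p (x ^+ 3) (z ^+ 3))
    - hom i d p (x ^+ 3) (z ^+ 3) * D (hom i d q (x ^+ 3) (z ^+ 3)) =
    hom i (d.-1 + d.-1) (wronsk p q) (x ^+ 3) (z ^+ 3)
      * (3%:R * x ^+ 2 * z ^+ 2 * (l * y ^+ 2)).
  move=> sp sq; rewrite (hom_wronsk DD DM Di _ _ sp sq) -h1 !(derX DM) /=.
  by ring.
have mul2 (p q : {poly C}) : (size p <= d.+1)%N -> (size q <= d.+1)%N ->
    hom i (d + d) (p * q) (x ^+ 3) (z ^+ 3) =
    hom i d p (x ^+ 3) (z ^+ 3) * hom i d q (x ^+ 3) (z ^+ 3).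
  exact: homM.
have mulw (l' p q : {poly C}) : (size l' <= 3)%N -> (size p <= d.+1)%N -> (size q <= d.+1)%N ->
    hom i (d + d) (l' * wronsk p q) (x ^+ 3) (z ^+ 3) =
    hom i 2 l' (x ^+ 3) (z ^+ 3)
     * hom i (d.-1 + d.-1) (wronsk p q) (x ^+ 3) (z ^+ 3).
  by move=> *; rewrite homM_wronsk.
have F1 := congr1 (fun p => hom i (d + d) p (x ^+ 3) (z ^+ 3)) I1.
rewrite homD homMn homZ expr2 mulw ?size_polyX // !mul2 // hom2X in F1.
have F0 := congr1 (fun p => hom i (d + d) p (x ^+ 3) (z ^+ 3)) odeA0.
rewrite homB homMn homZ expr2 mulw ?size1BX // !mul2 // hom2BX in F0.
have F2 := congr1 (fun p => hom i (d + d) p (x ^+ 3) (z ^+ 3)) odeA2.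
rewrite homD homMn homZ expr2 mulw ?sizeXBX // !mul2 // hom2XBX in F2.
have W1 := hw _ _ sa sg; have W0 := hw _ _ sb sg; have W2 := hw _ _ sa sb.
have y3 : y ^+ 3 = z ^+ 3 - x ^+ 3 by rewrite hv addrC addKr.
rewrite -y3 in F0 F2.
set a := hom i d al _ _ in F1 F0 F2 W1 W0 W2.
set b := hom i d be _ _ in F1 F0 F2 W1 W0 W2.
set g := hom i d ga _ _ in F1 F0 F2 W1 W0 W2.
split; rewrite /= -/a -/b -/g !DM.
- transitivity (b * g * (y * D z - z * D y) - y * z * (g * D b - b * D g)); first by ring.
  rewrite W0 h0; transitivity (l * x ^+ 2 * (i c * a ^+ 2)); last by ring.
  by rewrite -F0; ring.
- transitivity (a * g * (z * D x - x * D z) + x * z * (g * D a - a * D g)); first by ring.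
  rewrite W1 h1; transitivity (l * y ^+ 2 * (i c * b ^+ 2)); last by ring.
  by rewrite -F1; ring.
transitivity (a * b * (x * D y - y * D x) - x * y * (b * D a - a * D b)); first by ring.
rewrite W2 h2; transitivity (- (l * z ^+ 2 * (i c * g ^+ 2))); last by ring.
by rewrite -F2; ring.
Qed.

End Ring.
End TypeA.

Section TypeB.
Variables (C : numFieldType) (d : nat) (al be ga : {poly C}) (c : C).
Hypotheses (sa : (size al <= d.+2)%N) (sb : (size be <= d.+2)%N)
  (sg : (size ga <= d.+1)%N).
Hypothesis be0 : be != 0.
Hypothesis E : al ^+ 3 + be ^+ 3 = 'X * (1 - 'X) * ga ^+ 3.
Hypothesis I1 : (2%:R * 'X - 1) * (al * ga) + 'X * (1 - 'X) * wronsk al ga *+ 3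
  = c *: be ^+ 2.

Lemma odeB_deriv : 3%:R * al ^+ 2 * al^`() + 3%:R * be ^+ 2 * be^`() =
  (1 - 2%:R * 'X) * ga ^+ 3 + 3%:R * 'X * (1 - 'X) * ga ^+ 2 * ga^`().
Proof.
have := congr1 (fun p => p^`()) E.
rewrite -polyC1 !(deriv_exp, derivX, derivC, derivD, derivN, derivM) polyC1 /=.
move/eqP; rewrite -subr_eq0 => /eqP h.
by apply/eqP; rewrite -subr_eq0; apply/eqP; rewrite -[RHS]h; ring.
Qed.

Lemma odeB0 : (2%:R * 'X - 1) * (be * ga) + 'X * (1 - 'X) * wronsk be ga *+ 3
  = - c *: al ^+ 2.
Proof.
have b0 : be ^+ 2 != 0 by rewrite expf_neq0.
apply: (mulfI b0).
have -> : be ^+ 2 * (- c *: al ^+ 2) = - (al ^+ 2 * (c *: be ^+ 2)).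
  by rewrite -!scalerAr mulrC scaleNr.
rewrite -I1 /wronsk; have h := odeB_deriv.
transitivity (- (al ^+ 2 * ((2%:R * 'X - 1) * (al * ga)
    + 'X * (1 - 'X) * (al^`() * ga - al * ga^`()) *+ 3))
  + ((2%:R * 'X - 1) * ga - 3%:R * 'X * (1 - 'X) * ga^`())
    * (al ^+ 3 + be ^+ 3 - 'X * (1 - 'X) * ga ^+ 3)
  + 'X * (1 - 'X) * ga * ((3%:R * al ^+ 2 * al^`() + 3%:R * be ^+ 2 * be^`()) -
  ((1 - 2%:R * 'X) * ga ^+ 3 + 3%:R * 'X * (1 - 'X) * ga ^+ 2 * ga^`()))).
  by ring.
by rewrite h E !subrr !mulr0 !addr0.
Qed.

Lemma odeB2 : wronsk al be *+ 3 = c *: ga ^+ 2.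
Proof.
have b0 : be ^+ 2 != 0 by rewrite expf_neq0.
apply: (mulfI b0).
have -> : be ^+ 2 * (c *: ga ^+ 2) = ga ^+ 2 * (c *: be ^+ 2).
  by rewrite -!scalerAr mulrC.
rewrite -I1 /wronsk; have h := odeB_deriv.
transitivity (ga ^+ 2 * ((2%:R * 'X - 1) * (al * ga)
    + 'X * (1 - 'X) * (al^`() * ga - al * ga^`()) *+ 3)
  + 3%:R * al^`() * (al ^+ 3 + be ^+ 3 - 'X * (1 - 'X) * ga ^+ 3)
  - al * ((3%:R * al ^+ 2 * al^`() + 3%:R * be ^+ 2 * be^`()) -
  ((1 - 2%:R * 'X) * ga ^+ 3 + 3%:R * 'X * (1 - 'X) * ga ^+ 2 * ga^`()))).
  by ring.
by rewrite h E !subrr !mulr0 !addr0 subr0.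
Qed.

Section Ring.
Variables (S : comNzRingType) (i : {rmorphism C -> S}).
Implicit Types v : vec S.

Lemma cub_phiB v : cub v = 0 -> cub (phiB i d al be ga v) = 0.
Proof.
case: v => [[x y] z] /cub0E /= hv; rewrite /cub /phiB /= !exprMn.
have := congr1 (fun p => hom i (3 * d.+1) p (x ^+ 3) (z ^+ 3)) E.
rewrite homD !homX // => ->; rewrite mulnS homM ?size_exp_hom ?(leq_trans (sizeXBX C)) //.
by rewrite hom_widen ?sizeXBX // hom2XBX homX //; ring: hv.
Qed.

Variable D : S -> S.
Hypothesis DD : {morph D : a b / a + b}.
Hypothesis DM : forall a b, D (a * b) = D a * b + a * D b.
Hypothesis Di : forall c, D (i c) = 0.

Lemma size_derivMX n (p : {poly C}) :
  (size p <= n.+1)%N -> (size (p^`() * 'X)%R <= n.+1)%N.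
Proof.
move=> sp; have [->|p0] := eqVneq p^`() 0; first by rewrite mul0r size_poly0.
rewrite size_mulX //; apply: leq_trans sp; apply: lt_size_deriv.
by apply: contraNneq p0 => ->; rewrite deriv0.
Qed.

(** Here the third coordinate has the factor x y z and one degree less in the
   homogenised polynomial, so the components with ga use [der_hom_cube]
   instead of [hom_wronsk]; [DT] collects the common computation. *)
Lemma flow_phiB l v : cub v = 0 -> flow D l v ->
  flow D (i c * l) (phiB i d al be ga v).
Proof.
case: v => [[x y] z] /cub0E /= hv [/= h0 h1 h2].
have y3 : y ^+ 3 = z ^+ 3 - x ^+ 3 by rewrite hv addrC addKr.
have F (p q : {poly C}) k : (size p <= d.+2)%N -> (size q <= d.+2)%N ->
   (2%:R * 'X - 1) * (p * ga) + 'X * (1 - 'X) * wronsk p ga *+ 3 = k *: q ^+ 2 ->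
   (x ^+ 3 - y ^+ 3) * (hom i d.+1 p (x ^+ 3) (z ^+ 3) * hom i d ga (x ^+ 3) (z ^+ 3))
   + y ^+ 3 * (hom i d ga (x ^+ 3) (z ^+ 3) * hom i d.+1 (p^`() * 'X) (x ^+ 3) (z ^+ 3)
   - hom i d.+1 p (x ^+ 3) (z ^+ 3) * hom i d (ga^`() * 'X) (x ^+ 3) (z ^+ 3)) *+ 3 =
   i k * hom i d.+1 q (x ^+ 3) (z ^+ 3) ^+ 2.
  move=> sp sq h; rewrite y3.
  transitivity (hom i (d.+1 + d.+1) (k *: q ^+ 2) (x ^+ 3) (z ^+ 3)); last first.
    by rewrite homZ expr2 homM.
  have -> : k *: q ^+ 2 = (2%:R * 'X - 1) * (p * ga)
      + (1 - 'X) * (p^`() * 'X * ga - p * (ga^`() * 'X)) *+ 3.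
    by rewrite -h /wronsk; ring.
  have -> : (d.+1 + d.+1 = 1 + (d.+1 + d))%N by rewrite addnS.
  have s2 : (size (2%:R * 'X - 1 : {poly C})%R <= 2)%N.
    apply: (leq_trans (size_polyD _ _)); rewrite size_polyN size_poly1 geq_max andbT.
    by rewrite mulr_natl -scaler_nat (leq_trans (size_scale_leq _ _)) ?size_polyX.
  have M (u t : {poly C}) : (size u <= 2)%N -> (size t <= (d.+1 + d).+1)%N ->
    hom i (1 + (d.+1 + d)) (u * t) (x ^+ 3) (z ^+ 3) =
    hom i 1 u (x ^+ 3) (z ^+ 3) * hom i (d.+1 + d) t (x ^+ 3) (z ^+ 3) by exact: homM.
  have M2 (u t : {poly C}) : (size u <= d.+2)%N -> (size t <= d.+1)%N ->
    hom i (d.+1 + d) (u * t) (x ^+ 3) (z ^+ 3) =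
    hom i d.+1 u (x ^+ 3) (z ^+ 3) * hom i d t (x ^+ 3) (z ^+ 3) by exact: homM.
  have sd1 := size_derivMX sp; have sd2 := size_derivMX sg.
  rewrite homD homMn !M ?size1BX ?size_mul_leq //; last first.
    apply: (leq_trans (size_polyD _ _)); rewrite size_polyN geq_max.
    by rewrite !size_mul_leq.
  rewrite !homB !M2 // hom11 mulr_natl homMn hom1X.
  by ring.
have F1 := F _ _ _ sa sb I1; have F0 := F _ _ _ sb sa odeB0.
have F2 : hom i (d + d) (wronsk al be) (x ^+ 3) (z ^+ 3) *+ 3 =
    i c * hom i d ga (x ^+ 3) (z ^+ 3) ^+ 2.
  by rewrite -homMn odeB2 homZ expr2 homM.
have W := hom_wronsk DD DM Di (x ^+ 3) (z ^+ 3) sa sb.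
have Ca := der_hom_cube DD DM Di x z sa.
have Cb := der_hom_cube DD DM Di x z sb.
have Cg := der_hom_cube DD DM Di x z sg.
rewrite rmorphN in F0.
set a := hom i d.+1 al _ _ in F1 F0 F2 W Ca Cb Cg.
set b := hom i d.+1 be _ _ in F1 F0 F2 W Ca Cb Cg.
set g := hom i d ga _ _ in F1 F0 F2 W Ca Cb Cg.
set ha := hom i d.+1 (al^`() * 'X) _ _ in F1 F0 F2 W Ca Cb Cg.
set hb := hom i d.+1 (be^`() * 'X) _ _ in F1 F0 F2 W Ca Cb Cg.
set hg := hom i d (ga^`() * 'X) _ _ in F1 F0 F2 W Ca Cb Cg.
have DT (u hu : S) : x * z * D u = 3%:R * (z * D x - x * D z) * hu
    + 3%:R * x * D z * (u *+ d.+1) ->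
    x * y * z * g * D u - u * D (x * y * z * g) =
    l * ((x ^+ 3 - y ^+ 3) * (u * g) + y ^+ 3 * (g * hu - u * hg) *+ 3).
  move=> Cu; rewrite !DM.
  transitivity (y * g * (x * z * D u) - y * u * (x * z * D g)
    - u * g * (y * z * D x + x * z * D y + x * y * D z)); first by ring.
  rewrite Cu Cg h1.
  transitivity (u * g * (x * (y * D z - z * D y) - y * (z * D x - x * D z))
    + 3%:R * y * (l * y ^+ 2) * (g * hu - u * hg)); first by ring.
  by rewrite h0 h1; ring.
split; rewrite /= -/a -/b -/g.
- rewrite -[LHS]opprB (DT _ _ Cb) F0; ring.
- rewrite (DT _ _ Ca) F1; ring.
rewrite -[LHS]opprB W !(derX DM) /=.
transitivity (- (hom i (d + d) (wronsk al be) (x ^+ 3) (z ^+ 3) *+ 3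
  * x ^+ 2 * z ^+ 2 * (z * D x - x * D z))); first by ring.
by rewrite F2 h1; ring.
Qed.

End Ring.
End TypeB.

(** * Lines and the cubic over a field *)

Section FieldCubic.
Variable C : numFieldType.
Implicit Types u v w : vec C.

Definition v0 : vec C := (0, 0, 0).

Definition addv (u v : vec C) : vec C := (u.1.1 + v.1.1, u.1.2 + v.1.2, u.2 + v.2).

Lemma cube_eq0 (a : C) : a ^+ 3 = 0 -> a = 0.
Proof. by move/eqP; rewrite expf_eq0 /= => /eqP. Qed.

Lemma mulfI0 (a b : C) : a != 0 -> a * b = 0 -> b = 0.
Proof. by move=> a0 /eqP; rewrite mulf_eq0 (negPf a0) /= => /eqP. Qed.

(** The polarisation of the cubic form [cub]. *)
Definition tri u v w : C :=
  u.1.1 * v.1.1 * w.1.1 + u.1.2 * v.1.2 * w.1.2 - u.2 * v.2 * w.2.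

Lemma par_coef v w : v <> v0 -> par v w -> exists k, w = scal k v.
Proof.
case: v w => [[x y] z] [[a b] c] vn [/= h1 h2 h3].
have [x0|x0] := eqVneq x 0; last first.
  exists (a / x); rewrite /scal /=; congr (_, _, _); apply: (mulfI x0).
  - by field.
  - by rewrite h3; field.
  - by rewrite -h2; field.
have [y0|y0] := eqVneq y 0; last first.
  exists (b / y); rewrite /scal /=; congr (_, _, _); apply: (mulfI y0).
  - by rewrite -h3 x0; ring.
  - by field.
  - by rewrite h1; field.
have [z0|z0] := eqVneq z 0; first by case: vn; rewrite x0 y0 z0.
exists (c / z); rewrite /scal /=; congr (_, _, _); apply: (mulfI z0).
- by rewrite h2 x0; ring.
- by rewrite -h1 y0; ring.
- by field.
Qed.

Lemma par_trans u v w : v <> v0 -> par u v -> par v w -> par u w.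
Proof.
move=> vn uv /(par_coef vn)[k ->]; exact: par_scalr.
Qed.

Lemma scal_eq0 k v : scal k v = v0 -> k = 0 \/ v = v0.
Proof.
case: v => [[x y] z] [/eqP + /eqP + /eqP]; rewrite !mulf_eq0 /=.
have [->|k0] /= := eqVneq k 0; first by left.
by move=> /eqP -> /eqP -> /eqP ->; right.
Qed.

Lemma cub_comb a b v w : cub (addv (scal a v) (scal b w)) =
  a ^+ 3 * cub v + 3%:R * a ^+ 2 * b * tri v v w
  + 3%:R * a * b ^+ 2 * tri v w w + b ^+ 3 * cub w.
Proof. by rewrite /cub /tri /=; ring. Qed.

Lemma indep v w a b : ~ par v w -> addv (scal a v) (scal b w) = v0 ->
  a = 0 /\ b = 0.
Proof.
case: v w => [[x y] z] [[x' y'] z'] np [/= h1 h2 h3].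
have [a0|a0] := eqVneq a 0.
  split=> //; have [//|b0] := eqVneq b 0; case: np.
  move: h1 h2 h3; rewrite a0 !mul0r !add0r => /eqP + /eqP + /eqP.
  rewrite !mulf_eq0 (negPf b0) /= => /eqP -> /eqP -> /eqP ->; exact: par0.
case: np; split=> /=; apply: (mulfI a0); apply/eqP; rewrite -subr_eq0; apply/eqP.
- transitivity ((a * y + b * y') * z' - (a * z + b * z') * y'); first by ring.
  by rewrite h2 h3 !mul0r subr0.
- transitivity ((a * z + b * z') * x' - (a * x + b * x') * z'); first by ring.
  by rewrite h1 h3 !mul0r subr0.
- transitivity ((a * x + b * x') * y' - (a * y + b * y') * x'); first by ring.
  by rewrite h1 h2 !mul0r subr0.
Qed.

(** The hypotheses say that the cubic form vanishes on the line through v and w.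
   The gradients at v and w and their polarisation (x a, y b, - z c) are then
   all orthogonal to v and w, hence proportional, and comparing their 2 by 2
   minors gives par v w ([key]). *)
Lemma line_not_in_cubic v w :
  cub v = 0 -> tri v v w = 0 -> tri v w w = 0 -> cub w = 0 -> par v w.
Proof.
case: v w => [[x y] z] [[a b] c]; rewrite /cub /tri /= => hv h1 h2 hw.
apply: contrapT => np.
pose l : vec C := (y * c - z * b, z * a - x * c, x * b - y * a).
have ln : l <> v0.
  move=> [l1 l2 l3]; apply: np; split; apply/eqP; rewrite -subr_eq0; apply/eqP=> //.
have parA f g h : f * x + g * y + h * z = 0 -> f * a + g * b + h * c = 0 ->
    par (f, g, h) l.
  move=> e1 e2; split; rewrite /l /=; apply/eqP; rewrite -subr_eq0; apply/eqP.
  - transitivity (x * (f * a + g * b + h * c) - a * (f * x + g * y + h * z)); first by ring.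
    by rewrite e1 e2 !mulr0 subr0.
  - transitivity (y * (f * a + g * b + h * c) - b * (f * x + g * y + h * z)); first by ring.
    by rewrite e1 e2 !mulr0 subr0.
  - transitivity (z * (f * a + g * b + h * c) - c * (f * x + g * y + h * z)); first by ring.
    by rewrite e1 e2 !mulr0 subr0.
have pA : par (x ^+ 2, y ^+ 2, - z ^+ 2) l.
  by apply: parA; [rewrite -[RHS]hv|rewrite -[RHS]h1]; ring.
have pB : par (x * a, y * b, - (z * c)) l.
  by apply: parA; [rewrite -[RHS]h1|rewrite -[RHS]h2]; ring.
have pG : par (a ^+ 2, b ^+ 2, - c ^+ 2) l.
  by apply: parA; [rewrite -[RHS]h2|rewrite -[RHS]hw]; ring.
have [/= A1 A2 A3] := par_trans ln pA (par_sym pB).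
have [/= B1 B2 B3] := par_trans ln pG (par_sym pB).
have [/= G1 G2 G3] := par_trans ln pA (par_sym pG).
have key (p q r s : C) : p * q * (p * s - q * r) = 0 -> r * s * (p * s - q * r) = 0 ->
   (p * s + q * r) * (p * s - q * r) = 0 -> p * s = q * r.
  move=> k1 k2 k3; apply/eqP; rewrite -subr_eq0; apply/negPn/negP => n0.
  move: k1 k2 k3 => /eqP + /eqP + /eqP; rewrite !mulf_eq0 (negPf n0) !orbF.
  have pq (e f g h : C) : e = 0 -> e * f + g * h == 0 -> e * f - g * h = 0.
    by move=> -> ; rewrite mul0r add0r sub0r => /eqP ->; rewrite oppr0.
  case/orP=> /eqP p0 _ h; case/eqP: n0; first exact: pq p0 h.
  by rewrite -opprB (pq _ _ _ _ p0) ?oppr0 // addrC.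
have El (e f g : C) : e = f -> g = e - f -> g = 0 by move=> ->; rewrite subrr.
have Er (e f g : C) : e = f -> g = f - e -> g = 0 by move=> ->; rewrite subrr.
apply: np; split=> /=; apply: key.
- by apply: (Er _ _ _ A1); ring.
- by apply: (El _ _ _ B1); ring.
- by apply: (Er _ _ _ G1); ring.
- by apply: (Er _ _ _ A2); ring.
- by apply: (El _ _ _ B2); ring.
- by apply: (Er _ _ _ G2); ring.
- by apply: (El _ _ _ A3); ring.
- by apply: (Er _ _ _ B3); ring.
- by apply: (El _ _ _ G3); ring.
Qed.

(** The third point of a secant, found from the restriction of the cubic form to
   the line, is the difference of the two chord formulas. *)
Lemma chord_sub v w : addv (scal (tri v w w) v) (scal (- tri v v w) w) =
  addv (chord w v) (scal (- 1) (chord v w)).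
Proof.
case: v w => [[x y] z] [[a b] c]; rewrite /addv /scal /chord /tri /=.
by congr (_, _, _); ring.
Qed.

(** If x and y are nonzero, the components give y^3 = - z^3 and x^3 = - z^3, which
   with the equation of the cubic add up to 3 z^3 = 0. *)
Lemma chord_vv_neq0 v : v <> v0 -> cub v = 0 -> chord v v <> v0.
Proof.
case: v => [[x y] z] vn /cub0E/= hv [/= h1 h2 h3].
have {}h1 : x * (z ^+ 3 + y ^+ 3) = 0 by rewrite -[RHS]h1; ring.
have {}h2 : y * (z ^+ 3 + x ^+ 3) = 0 by apply: oppr_inj; rewrite oppr0 -[RHS]h2; ring.
have {}h3 : z * (x ^+ 3 - y ^+ 3) = 0 by rewrite -[RHS]h3; ring.
have [x0|x0] := eqVneq x 0.
  have z3y3 : z ^+ 3 = y ^+ 3 by rewrite hv x0; ring.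
  have y0 : y = 0.
    by apply/cube_eq0/cube_eq0; rewrite -[RHS](mulr0 (y ^+ 5)) -h2 x0 z3y3; ring.
  by apply: vn; rewrite x0 y0 (@cube_eq0 z) // z3y3 y0; ring.
have zy : z ^+ 3 = - y ^+ 3.
  by move/eqP: h1; rewrite mulf_eq0 (negPf x0) /= addr_eq0 => /eqP.
have y0 : y != 0.
  by apply/eqP=> y0; case/eqP: x0; apply/cube_eq0; move: hv; rewrite zy y0 expr0n oppr0 addr0.
have zx : z ^+ 3 = - x ^+ 3.
  by move/eqP: h2; rewrite mulf_eq0 (negPf y0) /= addr_eq0 => /eqP.
have : 3%:R * z ^+ 3 = 0.
  transitivity ((z ^+ 3 + x ^+ 3) + (z ^+ 3 + y ^+ 3)); first by ring: hv.
  by rewrite {1}zx zy !addNr addr0.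
move/eqP; rewrite mulf_eq0 pnatr_eq0 /= => /eqP/cube_eq0 z0.
by case/eqP: x0; apply/cube_eq0; apply: oppr_inj; rewrite -zx z0 expr0n oppr0.
Qed.

(** The residual point of the tangent at v, in the direction w, is given by the
   doubling formula [chord v v]. The explicit cofactors write the difference as
   a combination of the equation of v and the tangency condition. *)
Lemma tangent_par v w : cub v = 0 -> tri v v w = 0 ->
  par (addv (scal (3%:R * tri v w w) w) (scal (- cub w) v)) (chord v v).
Proof.
case: v w => [[x y] z] [[a b] c] /cub0E/= hv; rewrite /tri /cub /= => h.
have comb (q1 q2 e f : C) : e - f = q1 * (z ^+ 2 * c - x ^+ 2 * a - y ^+ 2 * b)
    + q2 * (z ^+ 3 - (x ^+ 3 + y ^+ 3)) -> e = f.
  have -> : z ^+ 2 * c - x ^+ 2 * a - y ^+ 2 * b = 0.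
    by apply: oppr_inj; rewrite oppr0 -[RHS]h; ring.
  by rewrite hv subrr !mulr0 addr0 => /eqP; rewrite subr_eq0 => /eqP.
split; rewrite /=.
- apply: (comb (3%:R * (y ^+ 2 * z * b ^+ 2 + x * y * z * a ^+ 2 - y * z ^+ 2 * c ^+ 2
      - x ^+ 3 * b * c - x ^+ 2 * y * a * c - x ^+ 2 * z * a * b))
    (3%:R * x ^+ 2 * a * b * c - y * z * (a ^+ 3 + b ^+ 3 - c ^+ 3))); ring.
- apply: (comb (3%:R * (x ^+ 2 * z * a ^+ 2 + x * y * z * b ^+ 2 - x * z ^+ 2 * c ^+ 2
      - x * y ^+ 2 * b * c - y ^+ 3 * a * c - y ^+ 2 * z * a * b))
    (3%:R * y ^+ 2 * a * b * c - x * z * (a ^+ 3 + b ^+ 3 - c ^+ 3))); ring.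
- apply: (comb (3%:R * (x ^+ 3 * a * b + x ^+ 2 * y * a ^+ 2 + x * y ^+ 2 * b ^+ 2
      - x * y * z * c ^+ 2 + x * z ^+ 2 * b * c + y ^+ 3 * a * b + y * z ^+ 2 * a * c))
    (- (3%:R * x ^+ 2 * a ^+ 2 * b + 3%:R * y ^+ 2 * a * b ^+ 2
       + x * y * (a ^+ 3 + b ^+ 3 - c ^+ 3)))); ring.
Qed.

(** The content of [line_cuts] for vectors: the line is spanned by a and b, and
   points on it are given by their coordinates in this basis. *)
Definition cuts P Q T : Prop := exists (a b : vec C) (p0 p1 q0 q1 t0 t1 k : C),
  [/\ ~ par a b, k != 0,
      [/\ P = addv (scal p0 a) (scal p1 b), Q = addv (scal q0 a) (scal q1 b)
        & T = addv (scal t0 a) (scal t1 b)]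
    & forall x y, cub (addv (scal x a) (scal y b)) =
       k * (x * p1 - y * p0) * (x * q1 - y * q0) * (x * t1 - y * t0)].

End FieldCubic.

(** * The intersection cycle of a line and the third point *)

Section LineCuts.
Variable R : realType.
Local Notation C := (Cplx R).
Implicit Types P Q T : E3 R.

Definition tov (r : 'rV[C]_3) : vec C := (r 0 iX, r 0 iY, r 0 iZ).

Definition rowv (v : vec C) : 'rV[C]_3 :=
  \row_j (if j == iX then v.1.1 else if j == iY then v.1.2 else v.2).

Lemma I3_cases (j : 'I_3) : [\/ j = iX, j = iY | j = iZ].
Proof.
case: j => -[|[|[|//]]] h; [apply: Or31|apply: Or32|apply: Or33];
  by apply: val_inj; rewrite /= inordK.
Qed.

Lemma i3_neq : [/\ (iY == iX) = false, (iZ == iX) = false & (iZ == iY) = false].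
Proof. by split; rewrite -val_eqE /= !inordK. Qed.

Lemma rowvK v : tov (rowv v) = v.
Proof.
case: i3_neq => h1 h2 h3.
by case: v => [[x y] z]; rewrite /tov !mxE eqxx h1 h2 h3 eqxx.
Qed.

Lemma tov_inj : injective tov.
Proof.
move=> r s [h1 h2 h3]; apply/matrixP => i j; rewrite (ord1 i).
by case: (I3_cases j) => ->.
Qed.

Definition vecE P : vec C := tov (val P).

Lemma E3_cub P : cub (vecE P) = 0.
Proof. by have /andP[/eqP] := valP P. Qed.

Lemma E3_neq0 P : vecE P <> v0 C.
Proof.
have /andP[_ h] := valP P; case=> h1 h2 h3; move: h; rewrite /normalized.
by rewrite h1 h3 ![0 == 1]eq_sym oner_eq0 andbF.
Qed.

Lemma E3_par_eq P Q : par (vecE P) (vecE Q) -> P = Q.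
Proof.
move=> pq; apply: val_inj; apply: tov_inj; rewrite -/(vecE P) -/(vecE Q).
have [k kE] := par_coef (E3_neq0 (P := P)) pq; rewrite kE.
suff -> : k = 1 by case: (vecE P) => [[x y] z]; rewrite /scal /= !mul1r.
case: kE; rewrite /= => e1 e2 e3.
have /andP[_] := valP P; have /andP[_] := valP Q.
rewrite /normalized e1 e3 => + /orP[/eqP z1|/andP[/eqP z0 /eqP x1]].
  rewrite z1 !mulr1 => /orP[/eqP // | /andP[/eqP k0]].
  by rewrite k0 mul0r eq_sym oner_eq0.
by rewrite z0 x1 !mulr0 mulr1 eq_sym oner_eq0 eqxx /= => /eqP.
Qed.

Lemma tov_mul (w : 'rV[C]_2) (M : 'M[C]_(2, 3)) : tov (w *m M) =
  addv (scal (w 0 0) (tov (row 0 M))) (scal (w 0 1) (tov (row 1 M))).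
Proof.
rewrite /tov /addv /scal /= !mxE !big_ord_recl !big_ord0 !addr0.
by rewrite (_ : lift ord0 ord0 = 1) //; apply: val_inj.
Qed.

Lemma det_col2 (w p : 'rV[C]_2) :
  \det (col_mx w p : 'M[C]_2) = w 0 0 * p 0 1 - w 0 1 * p 0 0.
Proof.
have D2 (M : 'M[C]_2) : (forall j, M 0 j = w 0 j) ->
    (forall j, M 1 j = p 0 j) -> \det M = w 0 0 * p 0 1 - w 0 1 * p 0 0.
  move=> M0 M1; rewrite (expand_det_row _ 0) !big_ord_recl big_ord0 addr0.
  rewrite /cofactor !det_mx11 !mxE !M0 (_ : lift ord0 ord0 = 1); last exact: val_inj.
  rewrite !M1 (_ : lift 1 0 = 0); last exact: val_inj.
  by rewrite /= expr0 expr1; ring.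
apply: D2 => j.
  rewrite -[RHS](col_mxEu w p 0 j); congr (fun_of_matrix _ _ j).
  exact: val_inj.
rewrite -[RHS](col_mxEd w p 0 j); congr (fun_of_matrix _ _ j).
exact: val_inj.
Qed.

Lemma line_cutsE P Q T :
  line_cuts P Q T <-> cuts (vecE P) (vecE Q) (vecE T).
Proof.
split=> [[M [p [q [t [k [rf k0 [eP eQ eT] F]]]]]]|].
  exists (tov (row 0 M)), (tov (row 1 M)), (p 0 0), (p 0 1), (q 0 0), (q 0 1),
    (t 0 0), (t 0 1), k; split=> //; last 1 first.
  - move=> x y; pose w : 'rV[C]_2 := \row_j (if j == 0 then x else y).
    by have := F w; rewrite !det_col2 /fermat -/(cub (tov (w *m M))) tov_mul !mxE.
  - move=> pa; have [an|bn] : tov (row 0 M) <> v0 C \/ tov (row 0 M) = v0 C.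
    + by case: (pselect (tov (row 0 M) = v0 C)); [right|left].
    + have [c cE] := par_coef an pa.
      pose w : 'rV[C]_2 := \row_j (if j == 0 then - c else 1).
      have w0 : w *m M = 0 *m M.
        apply: tov_inj; rewrite tov_mul cE !mxE /= mul0mx /tov /addv /scal /= !mxE.
        by congr (_, _, _); ring.
      have /(congr1 (fun r : 'rV_2 => r 0 1)) := row_free_inj rf w0.
      by rewrite !mxE /= => /eqP; rewrite oner_eq0.
    pose w : 'rV[C]_2 := \row_j (if j == 0 then 1 else 0).
    have w0 : w *m M = 0 *m M.
      apply: tov_inj; rewrite tov_mul bn !mxE /= mul0mx /tov /addv /scal /= !mxE.
      by congr (_, _, _); ring.
    have /(congr1 (fun r : 'rV_2 => r 0 0)) := row_free_inj rf w0.
    by rewrite !mxE /= => /eqP; rewrite oner_eq0.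
  by rewrite /vecE eP eQ eT !tov_mul.
case=> a [b [p0 [p1 [q0 [q1 [t0 [t1 [k [np k0 [eP eQ eT] F]]]]]]]]].
pose M : 'M[C]_(2, 3) := \matrix_(i, j) (if i == 0 then rowv a 0 j else rowv b 0 j).
pose r2 (x y : C) : 'rV[C]_2 := \row_j (if j == 0 then x else y).
have M0 : tov (row 0 M) = a by rewrite -[RHS]rowvK /tov !mxE.
have M1 : tov (row 1 M) = b by rewrite -[RHS]rowvK /tov !mxE.
have r2M x y : tov (r2 x y *m M) = addv (scal x a) (scal y b).
  by rewrite tov_mul M0 M1 !mxE.
exists M, (r2 p0 p1), (r2 q0 q1), (r2 t0 t1), k; split=> //.
- apply: inj_row_free => v vM; have := tov_mul v M.
  rewrite vM M0 M1 /tov !mxE => /esym/(indep np)[v0 v1].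
  apply/rowP => j; rewrite mxE; case: (unliftP 0 j) => [j' ->|->//].
  by rewrite (ord1 j') -[RHS]v1; congr (v 0 _); apply: val_inj.
- by split; apply: tov_inj; rewrite r2M.
move=> w; rewrite !det_col2 /fermat -/(cub (tov (w *m M))) tov_mul M0 M1 F !mxE /=.
by [].
Qed.

End LineCuts.

Section Collinear.
Variable C : numFieldType.
Implicit Types u v w : vec C.
Local Notation v0 := (v0 C).

Lemma par_addv u v w : par u w -> par v w -> par (addv u v) w.
Proof.
case=> a1 a2 a3 [b1 b2 b3]; split; rewrite /= !(mulrDl, mulrDr).
- by rewrite a1 b1.
- by rewrite a2 b2.
by rewrite a3 b3.
Qed.

(** The root of the cubic form on the line through v and w other than v and w:
   on that line the form is 3 a b (a tri v v w + b tri v w w). *)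
Definition third v w := addv (scal (tri v w w) v) (scal (- tri v v w) w).

Lemma third_par v w : cub v = 0 -> cub w = 0 ->
  par (third v w) (chord v w) /\ par (third v w) (chord w v).
Proof.
move=> hv hw; rewrite /third chord_sub; split; apply: par_addv.
- exact: chord_par.
- exact/par_sym/par_scal.
- exact: par_refl.
- exact/par_sym/par_scalr/chord_par.
Qed.

Lemma third_neq0 v w : cub v = 0 -> cub w = 0 -> ~ par v w -> third v w <> v0.
Proof.
move=> hv hw np /(indep np)[h1 /eqP]; rewrite oppr_eq0 => /eqP h2.
exact/np/line_not_in_cubic.
Qed.

Lemma chord_neq0 v w : v <> v0 -> w <> v0 -> cub v = 0 -> cub w = 0 ->
  chord v w <> v0 \/ chord w v <> v0.
Proof.
move=> vn wn hv hw; have [vw|nvw] := pselect (par v w).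
  left; have [k kE] := par_coef vn vw; rewrite kE chord_scalr => /scal_eq0[/eqP|].
    rewrite expf_eq0 /= => /eqP k0; apply: wn; rewrite kE k0 /scal !mul0r //.
  exact: chord_vv_neq0.
apply: contrapT => /not_orP[/contrapT h1 /contrapT h2].
apply: (third_neq0 hv hw nvw); rewrite /third chord_sub h1 h2.
by rewrite /addv /scal /= !mulr0 !addr0.
Qed.

(** The same for a tangent, where the form is b^2 (3 a tri v w w + b cub w). *)
Definition tangent_third v w := addv (scal (3%:R * tri v w w) w) (scal (- cub w) v).

(** The tangent line is spanned by v and any vector orthogonal to the gradient
   (x^2, y^2, - z^2); one of (z^2, 0, x^2) and (0, z^2, y^2) is not a multiple
   of v. *)
Lemma tangent_dir v : v <> v0 -> cub v = 0 ->
  exists w, tri v v w = 0 /\ ~ par v w.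
Proof.
case: v => [[x y] z] vn /cub0E/= hv.
have [np|/contrapT[/= h1 h2 h3]] := pselect (~ par (x, y, z) (z ^+ 2, 0, x ^+ 2)).
  by exists (z ^+ 2, 0, x ^+ 2); split=> //; rewrite /tri /=; ring.
have [y0|y0] := eqVneq y 0.
  exists (0, z ^+ 2, y ^+ 2); split=> [|[/= _ _]]; first by rewrite /tri /=; ring.
  rewrite mulr0 => /eqP; rewrite mulf_eq0 expf_eq0 /= => /orP[] /eqP t0.
    have z0 : z = 0 by apply/cube_eq0; rewrite hv t0 y0; ring.
    by apply: vn; rewrite t0 y0 z0.
  have x0 : x = 0 by apply/cube_eq0; transitivity (z ^+ 3); [rewrite hv y0; ring|rewrite t0; ring].
  by apply: vn; rewrite t0 y0 x0.
have z0 : z = 0.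
  by move/esym/eqP: h3; rewrite mulr0 mulf_eq0 (negPf y0) /= expf_eq0 /= => /eqP.
have x0 : x = 0.
  by apply/cube_eq0; transitivity (x * x ^+ 2); [ring|rewrite -h2 z0; ring].
by case/eqP: y0; apply/cube_eq0; transitivity (z ^+ 3); [rewrite hv x0; ring|rewrite z0; ring].
Qed.

Lemma tangent_third_neq0 v w : cub v = 0 -> tri v v w = 0 -> ~ par v w ->
  tangent_third v w <> v0.
Proof.
move=> hv h np; rewrite /tangent_third.
have -> : addv (scal (3%:R * tri v w w) w) (scal (- cub w) v) =
   addv (scal (- cub w) v) (scal (3%:R * tri v w w) w).
  by rewrite /addv; congr (_, _, _); rewrite addrC.
move=> /(indep np)[/eqP + /eqP]; rewrite oppr_eq0 mulf_eq0 pnatr_eq0 /=.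
by move=> /eqP h1 /eqP h2; apply/np/line_not_in_cubic.
Qed.

Lemma comb_comb a b (x y p0 p1 q0 q1 : C) :
  addv (scal x (addv (scal p0 a) (scal p1 b))) (scal y (addv (scal q0 a) (scal q1 b)))
  = addv (scal (x * p0 + y * q0) a) (scal (x * p1 + y * q1) b).
Proof. by rewrite /addv /scal /=; congr (_, _, _); ring. Qed.

(** If P and Q differ, they can replace a and b as a basis of the line, and the
   factorisation of the cubic form identifies T with [third P Q]. If P = Q, the
   form has a double root at P, so the line is tangent, and completing P to a
   basis of the line identifies T with [tangent_third]. *)
Lemma cuts_coll P Q T : P <> v0 -> Q <> v0 -> T <> v0 ->
  cub P = 0 -> cub Q = 0 -> (par P Q -> P = Q) ->
  cuts P Q T -> par T (chord P Q) /\ par T (chord Q P).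
Proof.
move=> Pn Qn Tn hP hQ PQ [a [b [p0 [p1 [q0 [q1 [t0 [t1 [k [np k0 [eP eQ eT] F]]]]]]]]]].
have two0 : 2%:R != 0 :> C by rewrite pnatr_eq0.
have three0 : 3%:R != 0 :> C by rewrite pnatr_eq0.
pose D := p0 * q1 - p1 * q0.
have [D0|D0] := eqVneq D 0; last first.
  have F' x y := F (x * p0 + y * q0) (x * p1 + y * q1).
  (* the sum and the difference of the values at (1, 1) and (1, - 1) isolate the
     two mixed coefficients of the form *)
  have t1E : tri P P Q = - (k * D ^+ 2 * (p0 * t1 - p1 * t0)) / 3%:R.
    apply: (mulfI three0); apply: (mulfI two0).
    have := F' 1 1; have := F' 1 (- 1); rewrite -!comb_comb -eP -eQ !cub_comb hP hQ.
    set u := tri P P Q; set v := tri P Q Q => e1 e2.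
    transitivity ((1 ^+ 3 * 0 + 3%:R * 1 ^+ 2 * 1 * u + 3%:R * 1 * 1 ^+ 2 * v + 1 ^+ 3 * 0)
     - (1 ^+ 3 * 0 + 3%:R * 1 ^+ 2 * -1 * u + 3%:R * 1 * (-1) ^+ 2 * v + (-1) ^+ 3 * 0)).
      by ring.
    by rewrite e1 e2 /D; field.
  have t2E : tri P Q Q = - (k * D ^+ 2 * (q0 * t1 - q1 * t0)) / 3%:R.
    apply: (mulfI three0); apply: (mulfI two0).
    have := F' 1 1; have := F' 1 (- 1); rewrite -!comb_comb -eP -eQ !cub_comb hP hQ.
    set u := tri P P Q; set v := tri P Q Q => e1 e2.
    transitivity ((1 ^+ 3 * 0 + 3%:R * 1 ^+ 2 * 1 * u + 3%:R * 1 * 1 ^+ 2 * v + 1 ^+ 3 * 0)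
     + (1 ^+ 3 * 0 + 3%:R * 1 ^+ 2 * -1 * u + 3%:R * 1 * (-1) ^+ 2 * v + (-1) ^+ 3 * 0)).
      by ring.
    by rewrite e1 e2 /D; field.
  have E : third P Q = scal (k * D ^+ 3 / 3%:R) T.
    rewrite /third t1E t2E eP eQ eT comb_comb /addv /scal /D /=.
    by congr (_, _, _); field.
  have En : third P Q <> v0.
    rewrite E => /scal_eq0[|//]; apply/eqP.
    by rewrite mulf_neq0 ?invr_eq0 // mulf_neq0 // expf_neq0.
  have TE : par T (third P Q) by rewrite E; apply: par_scal.
  by have [e1 e2] := third_par hP hQ; split; apply: par_trans TE _.
have {}PQ : P = Q.
  apply: PQ; rewrite eP eQ; split; rewrite /=; apply/eqP; rewrite -subr_eq0; apply/eqP.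
  - by transitivity (D * (a.1.2 * b.2 - a.2 * b.1.2)); [rewrite /D; ring|rewrite D0 mul0r].
  - by transitivity (D * (a.2 * b.1.1 - a.1.1 * b.2)); [rewrite /D; ring|rewrite D0 mul0r].
  - by transitivity (D * (a.1.1 * b.1.2 - a.1.2 * b.1.1)); [rewrite /D; ring|rewrite D0 mul0r].
have [/eqP q0E /eqP q1E] : p0 - q0 = 0 /\ p1 - q1 = 0.
  apply: (indep np); apply: (@etrans _ _ (addv P (scal (- 1) Q))).
    by rewrite eP eQ /addv /scal /=; congr (_, _, _); ring.
  by rewrite PQ /addv /scal /=; congr (_, _, _); ring.
move: q0E q1E; rewrite !subr_eq0 => /eqP q0E /eqP q1E.
(* U completes P to a basis of the line *)
have [r0 [r1 de0]] : exists r0 r1, p0 * r1 - p1 * r0 != 0.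
  have [p00|p00] := eqVneq p0 0; last by exists 0, 1; rewrite mulr1 mulr0 subr0.
  exists (- 1), 0; rewrite mulr0 sub0r mulrN1 opprK; apply/eqP => p10.
  by apply: Pn; rewrite eP p00 p10 /addv /scal /= !mul0r addr0.
pose de := p0 * r1 - p1 * r0; rewrite -/de in de0.
have [U UE] : exists U, U = addv (scal r0 a) (scal r1 b) by eexists.
have F' x y := F (x * p0 + y * r0) (x * p1 + y * r1).
have c0 : cub U = k * de ^+ 2 * (r0 * t1 - r1 * t0).
  by rewrite UE F -q0E -q1E /de; ring.
have e1 := F' 1 1; have e2 := F' 1 (- 1).
rewrite -!comb_comb -eP -UE !cub_comb hP c0 -q0E -q1E in e1 e2.
have t1E : tri P P U = 0.
  apply: (mulfI three0); apply: (mulfI two0); rewrite !mulr0.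
  set u := tri P P U in e1 e2 *; set v := tri P U U in e1 e2.
  transitivity ((1 ^+ 3 * 0 + 3%:R * 1 ^+ 2 * 1 * u + 3%:R * 1 * 1 ^+ 2 * v
     + 1 ^+ 3 * (k * de ^+ 2 * (r0 * t1 - r1 * t0)))
   - (1 ^+ 3 * 0 + 3%:R * 1 ^+ 2 * -1 * u + 3%:R * 1 * (-1) ^+ 2 * v
     + (-1) ^+ 3 * (k * de ^+ 2 * (r0 * t1 - r1 * t0)))
   - 2%:R * (k * de ^+ 2 * (r0 * t1 - r1 * t0))); first by ring.
  by rewrite e1 e2 /de; ring.
have t2E : tri P U U = k * de ^+ 2 * (p0 * t1 - p1 * t0) / 3%:R.
  apply: (mulfI three0); rewrite t1E in e1.
  set v := tri P U U in e1 *.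
  transitivity ((1 ^+ 3 * 0 + 3%:R * 1 ^+ 2 * 1 * 0 + 3%:R * 1 * 1 ^+ 2 * v
     + 1 ^+ 3 * (k * de ^+ 2 * (r0 * t1 - r1 * t0)))
   - (k * de ^+ 2 * (r0 * t1 - r1 * t0))); first by ring.
  by rewrite e1 /de; field.
have E : tangent_third P U = scal (k * de ^+ 3) T.
  rewrite /tangent_third c0 t2E UE eP eT comb_comb /addv /scal /de /=.
  by congr (_, _, _); field.
have En : tangent_third P U <> v0.
  rewrite E => /scal_eq0[|//]; apply/eqP.
  by rewrite mulf_neq0 // expf_neq0.
have TE : par T (tangent_third P U) by rewrite E; apply: par_scal.
rewrite -PQ; have h := par_trans En TE (tangent_par hP t1E).
by split.
Qed.

(** The line is the secant or the tangent, with the restrictions of the cubic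
   form given at [third] and [tangent_third]. *)
Lemma coll_cuts P Q T : P <> v0 -> Q <> v0 -> T <> v0 ->
  cub P = 0 -> cub Q = 0 -> (par P Q -> P = Q) ->
  par T (chord P Q) -> par T (chord Q P) -> cuts P Q T.
Proof.
move=> Pn Qn Tn hP hQ PQ T1 T2.
have three0 : 3%:R != 0 :> C by rewrite pnatr_eq0.
have tau0 (X : vec C) : X <> v0 -> par X T -> exists2 tau, tau != 0 & T = scal tau X.
  move=> Xn /(par_coef Xn)[tau TE]; exists tau => //; apply/eqP => t0; apply: Tn.
  by rewrite TE t0 /scal !mul0r.
have [/PQ {}PQ|np] := pselect (par P Q); last first.
  have [tau tn TE] : exists2 tau, tau != 0 & T = scal tau (third P Q).
    apply: tau0; first exact: third_neq0.
    have [e1 e2] := third_par hP hQ.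
    have [h|h] := chord_neq0 Pn Qn hP hQ; first exact: par_trans h e1 (par_sym T1).
    exact: par_trans h e2 (par_sym T2).
  exists P, Q, 1, 0, 0, 1, (tau * tri P Q Q), (- (tau * tri P P Q)), (3%:R / tau).
  split=> //; first by rewrite mulf_neq0 ?invr_eq0.
  - split; rewrite ?TE; case: (P) (Q) => [[x y] z] [[x' y'] z'];
      by rewrite /third /addv /scal /=; congr (_, _, _); ring.
  by move=> x y; rewrite cub_comb hP hQ; field.
have [U [hU nU]] := tangent_dir Pn hP.
have [tau tn TE] : exists2 tau, tau != 0 & T = scal tau (tangent_third P U).
  apply: tau0; first exact: tangent_third_neq0.
  rewrite -PQ in T1; apply: par_trans (chord_vv_neq0 Pn hP) _ (par_sym T1).
  exact: tangent_par.
exists P, U, 1, 0, 1, 0, (- (tau * cub U)), (tau * (3%:R * tri P U U)), (tau^-1).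
split=> //; first by rewrite invr_eq0.
- split; rewrite -?PQ ?TE; case: (P) (U) => [[x y] z] [[x' y'] z'];
    by rewrite /tangent_third /addv /scal /=; congr (_, _, _); ring.
by move=> x y; rewrite cub_comb hP hU; field.
Qed.

End Collinear.

Section CollE3.
Variable R : realType.
Implicit Types P Q T : E3 R.

Lemma line_cuts_coll P Q T :
  line_cuts P Q T <-> coll (vecE P) (vecE Q) (vecE T).
Proof.
have E (X : E3 R) := E3_neq0 (P := X); have c (X : E3 R) := E3_cub X.
have PQ : par (vecE P) (vecE Q) -> vecE P = vecE Q by move=> /E3_par_eq ->.
split=> [/line_cutsE|[h1 h2]]; first exact: cuts_coll (E P) (E Q) (E T) (c P) (c Q) PQ.
by apply/line_cutsE; apply: coll_cuts (E P) (E Q) (E T) (c P) (c Q) PQ h1 h2.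
Qed.

End CollE3.

(** * A map compatible with the differential preserves collinearity *)

Section CollMap.
Variable C : numFieldType.
Local Notation A := (chartRing C).
Local Notation v0 := (v0 C).
Local Notation e0 := (chart_eval (base_vt C)).

Lemma chart_cancel (k f : A) : e0 k != 0 -> k * f = 0 -> f = 0.
Proof.
move=> k0 kf; apply: flat_chart0 => n.
apply: (flat_cancel (@chart_DD C) (@chart_DM C) k0).
by rewrite kf; apply: flat0 (@chart_DD C) _.
Qed.

Lemma unit_coord (w : vec C) : w <> v0 -> [\/ w.1.1 != 0, w.1.2 != 0 | w.2 != 0].
Proof.
case: w => [[x y] z] /= wn; have [x0|] := eqVneq x 0; last by constructor 1.
have [y0|] := eqVneq y 0; last by constructor 2.
by have [z0|] := eqVneq z 0; [case: wn; rewrite x0 y0 z0|constructor 3].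
Qed.

(** The chart is integral, so a function nonzero at O can be cancelled. *)
Lemma par_cancel k (u v : vec A) : e0 k != 0 -> par u (scal k v) -> par u v.
Proof.
move=> k0 [/= h1 h2 h3]; split; apply/eqP; rewrite -subr_eq0; apply/eqP;
  apply: (chart_cancel k0); rewrite mulrBr !(mulrCA k) ?h1 ?h2 ?h3 subrr //.
Qed.

(** The chart is an integral domain; the coordinate of v that is nonzero at O is
   the one to cancel. *)
Lemma chart_par_trans (u v w : vec A) : mapv e0 v <> v0 ->
  par u v -> par v w -> par u w.
Proof.
case: u v w => [[x y] z] [[a b] c] [[x' y'] z'] vn [/= p1 p2 p3] [/= q1 q2 q3].
have z_r (k1 e f g h e' f' : A) : e0 k1 != 0 -> k1 * e = e' -> k1 * g = f' ->
    e' * f = f' * h -> e * f = g * h.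
  move=> k0 he hg hef; apply/eqP; rewrite -subr_eq0; apply/eqP.
  apply: (chart_cancel k0); rewrite mulrBr !mulrA he hg hef subrr //.
have [a0|b0|c0] := unit_coord vn; split; rewrite /=.
- by apply: (z_r _ _ _ _ _ (x * b) (x * c) a0);
    [by rewrite mulrC -p3|by rewrite mulrC p2|rewrite -!mulrA q1].
- by apply: (z_r _ _ _ _ _ (x * c) (x * a) a0);
    [by rewrite mulrC p2|exact: mulrC|rewrite -!mulrA q2].
- by apply: (z_r _ _ _ _ _ (x * a) (x * b) a0);
    [exact: mulrC|by rewrite mulrC -p3|rewrite -!mulrA q3].
- by apply: (z_r _ _ _ _ _ (y * b) (y * c) b0);
    [exact: mulrC|by rewrite mulrC -p1|rewrite -!mulrA q1].
- by apply: (z_r _ _ _ _ _ (y * c) (y * a) b0);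
    [by rewrite mulrC -p1|by rewrite mulrC p3|rewrite -!mulrA q2].
- by apply: (z_r _ _ _ _ _ (y * a) (y * b) b0);
    [by rewrite mulrC p3|exact: mulrC|rewrite -!mulrA q3].
- by apply: (z_r _ _ _ _ _ (z * b) (z * c) c0);
    [by rewrite mulrC p1|exact: mulrC|rewrite -!mulrA q1].
- by apply: (z_r _ _ _ _ _ (z * c) (z * a) c0);
    [exact: mulrC|by rewrite mulrC -p2|rewrite -!mulrA q2].
- by apply: (z_r _ _ _ _ _ (z * a) (z * b) c0);
    [by rewrite mulrC -p2|by rewrite mulrC p1|rewrite -!mulrA q3].
Qed.

(** Which of the two chord formulas is nonzero depends on the points, so the
   lemmas are stated for both at once. *)
Definition chordb (S : comNzRingType) (b : bool) (v w : vec S) :=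
  if b then chord v w else chord w v.

Lemma par_chordb (S : comNzRingType) b b' (v w : vec S) :
  cub v = 0 -> cub w = 0 -> par (chordb b v w) (chordb b' v w).
Proof.
by move=> hv hw; case: b b' => -[]; rewrite /chordb;
  [exact: par_refl|exact: chord_par|exact: chord_par|exact: par_refl].
Qed.

Lemma cub_chordb (S : comNzRingType) b (v w : vec S) :
  cub v = 0 -> cub w = 0 -> cub (chordb b v w) = 0.
Proof. by case: b => hv hw; apply: cub_chord. Qed.

Lemma flow_chordb (S : comNzRingType) (D : S -> S) b l (v w : vec S) :
  {morph D : a b / a + b} -> (forall a b, D (a * b) = D a * b + a * D b) ->
  cub v = 0 -> cub w = 0 -> constv D w -> flow D l v ->
  flow D (- l) (chordb b v w).
Proof. by case: b => *; [apply: flow_chordl|apply: flow_chordr]. Qed.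

Lemma mapv_chordb (S : comNzRingType) (e : {rmorphism S -> C}) b (v w : vec S) :
  mapv e (chordb b v w) = chordb b (mapv e v) (mapv e w).
Proof. by case: b; apply: mapv_chord. Qed.

Lemma chordb_scall (S : comNzRingType) k b (v w : vec S) :
  chordb b (scal k v) w = scal (k ^+ 2) (chordb b v w).
Proof. by case: b; [apply: chord_scall|apply: chord_scalr]. Qed.

Lemma cub_coordY (v : vec C) : v <> v0 -> cub v = 0 -> v.1.1 = 0 -> v.1.2 != 0.
Proof.
case: v => [[x y] z] /= vn /cub0E/= hv x0; apply/eqP => y0.
apply: vn; rewrite x0 y0; congr (_, _, _).
by move/eqP: hv; rewrite x0 y0 !expr0n addr0 expf_eq0 /= => /eqP.
Qed.

Lemma chordbO (w : vec C) : w <> v0 -> cub w = 0 ->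
  exists b k, k != 0 /\ chordb b (vO C) w = scal k (swap w).
Proof.
move=> wn hw; have [x0|x0] := eqVneq w.1.1 0.
  have y0 := cub_coordY wn hw x0.
  by exists false, (- w.1.2); split; [rewrite oppr_eq0|rewrite /chordb chordrO].
by exists true, w.1.1; split=> //; rewrite /chordb chordO.
Qed.

Lemma scal_neq0 k (v : vec C) : k != 0 -> v <> v0 -> scal k v <> v0.
Proof. by move=> k0 vn /scal_eq0[/eqP|//]; rewrite (negPf k0). Qed.

Lemma swap_neq0 (v : vec C) : v <> v0 -> swap v <> v0.
Proof. by case: v => [[x y] z] vn [h1 h2 h3]; apply: vn; rewrite h1 h2 h3. Qed.

Lemma mapv_gen (v t : C) (vt : v ^+ 3 = t ^+ 3 - 1) :
  mapv (chart_eval vt) (chart_gen C) = (1, v, t).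
Proof. by rewrite /mapv /= rmorph1 chart_eval_v chart_eval_poly hornerX. Qed.

Definition constA (w : vec C) : vec A := mapv (@chart_const C) w.

Lemma mapv_constA (v t : C) (vt : v ^+ 3 = t ^+ 3 - 1) w :
  mapv (chart_eval vt) (constA w) = w.
Proof. by case: w => [[x y] z]; rewrite /mapv /= !chart_eval_const. Qed.

Lemma cub_constA w : cub w = 0 -> cub (constA w) = 0.
Proof.
move=> hw; transitivity (@chart_const C (cub w)); last by rewrite hw rmorph0.
by rewrite /cub rmorphB rmorphD /= !rmorphXn.
Qed.

Lemma constv_constA w : constv (@chart_D C) (constA w).
Proof. by split; rewrite /= chart_D_const. Qed.

Section Map.
Variables (PhC : vec C -> vec C) (PhA : vec A -> vec A) (c : C) (n : nat).
Hypothesis PhE : forall (v t : C) (vt : v ^+ 3 = t ^+ 3 - 1) w,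
  mapv (chart_eval vt) (PhA w) = PhC (mapv (chart_eval vt) w).
Hypothesis PhC_scal : forall k v, PhC (scal k v) = scal (k ^+ n) (PhC v).
Hypothesis PhA_scal : forall k v, PhA (scal k v) = scal (k ^+ n) (PhA v).
Hypothesis PhC_cub : forall v, cub v = 0 -> cub (PhC v) = 0.
Hypothesis PhA_cub : forall v, cub v = 0 -> cub (PhA v) = 0.
Hypothesis PhC_neq0 : forall v, v <> v0 -> cub v = 0 -> PhC v <> v0.
Hypothesis PhA_flow : forall l v, cub v = 0 -> flow (@chart_D C) l v ->
  flow (@chart_D C) (chart_const c * l) (PhA v).
Hypothesis PhC_O : par (vO C) (PhC (vO C)).

Local Notation gen := (chart_gen C).

Lemma chart_point (P : vec C) : P.1.1 != 0 -> cub P = 0 ->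
  exists v t (vt : v ^+ 3 = t ^+ 3 - 1), P = scal P.1.1 (1, v, t).
Proof.
case: P => [[x y] z] /= x0 /cub0E/= hP.
have vt : (y / x) ^+ 3 = (z / x) ^+ 3 - 1 by rewrite !expr_div_n hP; field.
by exists (y / x), (z / x), vt; rewrite /scal /=; congr (_, _, _); field.
Qed.

Lemma O_neq0 : vO C <> v0.
Proof. by case=> /eqP; rewrite oner_eq0. Qed.

Lemma cub_O : cub (vO C) = 0.
Proof. by rewrite /cub /=; ring. Qed.

Lemma gen0 : mapv e0 gen = vO C.
Proof. exact: mapv_gen. Qed.

Lemma flow_unique_chart0 l (v w : vec A) :
  cub v = 0 -> mapv e0 v <> v0 -> mapv e0 w <> v0 ->
  par (mapv e0 v) (mapv e0 w) ->
  flow (@chart_D C) l v -> flow (@chart_D C) l w -> par v w.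
Proof.
move=> hv; apply: (flow_unique (@chart_DD C) (@chart_DM C) (@flat_chart0 C)).
by rewrite mapv_cub hv rmorph0.
Qed.

Lemma par_scal2 k l (v w : vec C) : par v w -> par (scal k v) (scal l w).
Proof. by move=> h; apply/par_scalr/par_sym/par_scalr/par_sym. Qed.

(** PhC preserves inversion: PhA (swap gen) and swap (PhA gen) pull the
   differential back to the same form and agree at O, so they are equal at the
   generic point; then specialise. *)
Lemma PhC_swap_chart P : P.1.1 != 0 -> cub P = 0 ->
  par (PhC (swap P)) (swap (PhC P)).
Proof.
have h : par (PhA (swap gen)) (swap (PhA gen)).
  have fg := flow_chart_gen C; have cg := cub_chart_gen C.
  have f1 := PhA_flow (etrans (cub_swap _) cg) (flow_swap fg).
  have := flow_swap (PhA_flow cg fg).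
  rewrite -mulrN; apply: flow_unique_chart0 f1.
  - by apply: PhA_cub; rewrite cub_swap.
  - rewrite PhE -[mapv _ (swap gen)]/(swap (mapv e0 gen)) gen0.
    by apply: PhC_neq0; [apply/swap_neq0/O_neq0|rewrite cub_swap cub_O].
  - rewrite -[mapv _ (swap _)]/(swap (mapv e0 (PhA gen))) PhE gen0.
    by apply/swap_neq0/PhC_neq0; [apply: O_neq0|apply: cub_O].
  rewrite -[mapv _ (swap (PhA _))]/(swap (mapv e0 (PhA gen))) !PhE.
  rewrite -[mapv _ (swap gen)]/(swap (mapv e0 gen)) gen0.
  have [k ->] := par_coef O_neq0 PhC_O.
  have -> : swap (vO C) = scal (- 1) (vO C).
    by rewrite /swap /scal /=; congr (_, _, _); ring.
  rewrite PhC_scal; have [k' ->] := par_coef O_neq0 PhC_O.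
  rewrite -[swap _]/(scal k (swap (vO C))).
  have -> : swap (vO C) = scal (- 1) (vO C).
    by rewrite /swap /scal /=; congr (_, _, _); ring.
  by apply/par_scal2/par_scal2/par_refl.
move=> x0 hP; have [v [t [vt PE]]] := chart_point x0 hP.
have := mapv_par (chart_eval vt) h.
rewrite -[mapv _ (swap (PhA _))]/(swap (mapv (chart_eval vt) (PhA gen))) !PhE.
rewrite -[mapv _ (swap gen)]/(swap (mapv (chart_eval vt) gen)) mapv_gen => h'.
rewrite PE -[swap (scal _ _)]/(scal P.1.1 (swap (1, v, t))) !PhC_scal.
exact: (par_scal2 (P.1.1 ^+ n) (P.1.1 ^+ n) h').
Qed.

(** Points outside of the chart X = 1 have X = 0, and their inverses lie in the
   chart. *)
Lemma PhC_swap P : P <> v0 -> cub P = 0 -> par (PhC (swap P)) (swap (PhC P)).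
Proof.
move=> Pn hP; have [x0|] := eqVneq P.1.1 0; last by move/PhC_swap_chart; apply.
have y0 : (swap P).1.1 != 0 := cub_coordY Pn hP x0.
have := PhC_swap_chart y0 (etrans (cub_swap _) hP).
by rewrite swapK => /par_swap/par_sym; rewrite swapK.
Qed.

(** The argument of [PhC_swap_chart] with the generic point P and the constant
   point Q. At P = O the two points are PhC of the inverse of Q and the inverse
   of PhC Q, which [PhC_swap] compares. The formulas [b1] and [b2] nonzero at O
   are used for the comparison, and then replaced by the given ones. *)
Lemma PhC_chord_chart b b' P Q : P.1.1 != 0 -> cub P = 0 -> Q <> v0 -> cub Q = 0 ->
  par (PhC (chordb b P Q)) (chordb b' (PhC P) (PhC Q)).
Proof.
move=> x0 hP Qn hQ.
have fg := flow_chart_gen C; have cg := cub_chart_gen C.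
have Q'n := PhC_neq0 Qn hQ; have hQ' := PhC_cub hQ.
have [b1 [k1 [k10 E1]]] := chordbO Qn hQ.
have [b2 [k2 [k20 E2]]] := chordbO Q'n hQ'.
pose u b := chordb b gen (constA Q); pose W b := chordb b (PhA gen) (constA (PhC Q)).
have cu b3 : cub (u b3) = 0 by apply: cub_chordb (cub_constA hQ).
have eu : mapv e0 (u b1) = scal k1 (swap Q) by rewrite mapv_chordb mapv_constA gen0.
have [m mE] := par_coef O_neq0 PhC_O.
have m0 : m != 0.
  apply/eqP => m0; apply: (PhC_neq0 O_neq0 cub_O).
  by rewrite mE m0 /scal !mul0r.
have eW : mapv e0 (W b2) = scal (m ^+ 2) (scal k2 (swap (PhC Q))).
  by rewrite mapv_chordb mapv_constA PhE gen0 mE chordb_scall E2.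
have eV : mapv e0 (PhA (u b1)) = scal (k1 ^+ n) (PhC (swap Q)).
  by rewrite PhE eu PhC_scal.
have swQn := swap_neq0 Qn; have hsQ : cub (swap Q) = 0 by rewrite cub_swap.
have un : mapv e0 (u b1) <> v0 by rewrite eu; apply: scal_neq0.
have Vn : mapv e0 (PhA (u b1)) <> v0.
  by rewrite eV; apply: scal_neq0; [rewrite expf_neq0|apply: PhC_neq0].
have Wn : mapv e0 (W b2) <> v0.
  by rewrite eW; do 2?apply: scal_neq0; rewrite ?expf_neq0 //; apply: swap_neq0.
have VW : par (PhA (u b1)) (W b2).
  have f1 := PhA_flow (cu b1) (flow_chordb b1 (@chart_DD C) (@chart_DM C) cg
    (cub_constA hQ) (constv_constA Q) fg).
  have f2 := flow_chordb b2 (@chart_DD C) (@chart_DM C) (PhA_cub cg)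
    (cub_constA hQ') (constv_constA (PhC Q)) (PhA_flow cg fg).
  rewrite -mulrN in f2; apply: flow_unique_chart0 f1 f2 => //; first exact: PhA_cub.
  by rewrite eV eW; apply/par_scal2/par_scalr/PhC_swap.
have VV b3 : par (PhA (u b3)) (PhA (u b1)).
  have [p1 p2 p3] : par (u b3) (u b1) := par_chordb _ _ cg (cub_constA hQ).
  have fin k k' : e0 k != 0 -> scal k (u b3) = scal k' (u b1) ->
      par (PhA (u b3)) (PhA (u b1)).
    move=> k0 kk; apply: par_sym; apply: (@par_cancel (k ^+ n)).
      by rewrite rmorphXn expf_neq0.
    by rewrite -PhA_scal kk PhA_scal; apply/par_scal.
  have [h|h|h] := unit_coord un; move: h; rewrite /mapv /= => h; apply: (fin _ _ h).
  - instantiate (1 := (u b3).1.1); rewrite /scal; congr (_, _, _); first exact: mulrC.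
      by rewrite p3 mulrC.
    by rewrite mulrC -p2 mulrC.
  - instantiate (1 := (u b3).1.2); rewrite /scal; congr (_, _, _); last 1 first.
    + by rewrite p1 mulrC.
    + by rewrite mulrC p3 mulrC.
    exact: mulrC.
  instantiate (1 := (u b3).2); rewrite /scal; congr (_, _, _); last exact: mulrC.
    by rewrite p2 mulrC.
  by rewrite mulrC p1 mulrC.
have WW b3 : par (W b2) (W b3).
  exact: par_chordb (PhA_cub cg) (cub_constA hQ').
have h : par (PhA (u b)) (W b').
  exact: chart_par_trans Vn (VV b) (chart_par_trans Wn VW (WW b')).
have [v [t [vt PE]]] := chart_point x0 hP.
have := mapv_par (chart_eval vt) h.
rewrite PhE !mapv_chordb !mapv_constA PhE mapv_gen => h'.
rewrite PE PhC_scal !chordb_scall PhC_scal; exact: par_scal2.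
Qed.

Lemma coll_swap (P Q T : vec C) : coll P Q T -> coll (swap P) (swap Q) (swap T).
Proof.
by case=> h1 h2; split; rewrite chord_swap; apply/par_scalr/par_swap.
Qed.

Lemma coll_scal k l m (P Q T : vec C) : coll P Q T ->
  coll (scal k P) (scal l Q) (scal m T).
Proof.
by case=> h1 h2; split; rewrite chord_scall chord_scalr; apply/par_scal2/par_scalr.
Qed.

(** The third point of P and Q in the chart is covered by [PhC_chord_chart]; if P
   has X = 0, apply the inversion to all three points. *)
Lemma coll_PhC P Q T : P <> v0 -> Q <> v0 -> T <> v0 ->
  cub P = 0 -> cub Q = 0 -> cub T = 0 ->
  coll P Q T -> coll (PhC P) (PhC Q) (PhC T).
Proof.
have chart X Y Z : X.1.1 != 0 -> X <> v0 -> Y <> v0 -> cub X = 0 -> cub Y = 0 ->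
    coll X Y Z -> coll (PhC X) (PhC Y) (PhC Z).
  move=> x0 Xn Yn hX hY [h1 h2].
  have [b [bn bZ]] : exists b, chordb b X Y <> v0 /\ par Z (chordb b X Y).
    by have [?|?] := chord_neq0 Xn Yn hX hY; [exists true|exists false].
  have [k ->] := par_coef bn (par_sym bZ); rewrite PhC_scal.
  have p b' := PhC_chord_chart b b' x0 hX Yn hY.
  by split; apply/par_sym/par_scalr/par_sym; [apply: (p true)|apply: (p false)].
move=> Pn Qn Tn hP hQ hT PQT; have [x0|x0] := eqVneq P.1.1 0; last exact: chart.
have y0 : (swap P).1.1 != 0 := cub_coordY Pn hP x0.
have := coll_swap PQT.
move=> /(chart _ _ _ y0 (swap_neq0 Pn) (swap_neq0 Qn)).
rewrite !cub_swap => /(_ hP hQ)/coll_swap.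
have sw X : X <> v0 -> cub X = 0 -> exists k, PhC X = scal k (swap (PhC (swap X))).
  move=> Xn hX; apply: par_coef; last first.
    by rewrite -[PhC X]swapK; apply/par_swap/PhC_swap.
  by apply/swap_neq0/PhC_neq0; [apply: swap_neq0|rewrite cub_swap].
have [k ->] := sw P Pn hP; have [l ->] := sw Q Qn hQ; have [m ->] := sw T Tn hT.
exact: coll_scal.
Qed.

End Map.
End CollMap.

(** * Isogenies from ternary forms *)

Section Forms.
Variable C : numFieldType.
Local Notation S := (mpoly 3 C).
Local Notation homog d p := (p \is ishomog1 d mdeg).

Definition mvar (j : 'I_3) : S := mpolyX C (mnm1 j).

Definition mgen : vec S := (mvar iX, mvar iY, mvar iZ).

Definition vcoord (T : Type) (v : vec T) (j : 'I_3) : T :=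
  if j == iX then v.1.1 else if j == iY then v.1.2 else v.2.

Lemma homog_var j : homog 1 (mvar j).
Proof. by rewrite dhomogX /= mdeg1. Qed.

Lemma homog_var3 j : homog 3 (mvar j ^+ 3).
Proof. exact: (dhomogMn 3 (homog_var j)). Qed.

Lemma homog_hom d p (a b : S) :
  homog 3 a -> homog 3 b -> homog (3 * d) (hom (@mpolyC 3 C) d p a b).
Proof.
move=> ha hb; apply: rpred_sum => k _.
have kd : (k <= d)%N by rewrite -ltnS.
rewrite (_ : (3 * d = (0 + 3 * k) + 3 * (d - k))%N); last by rewrite add0n -mulnDr subnKC.
apply: dhomogM; last exact: dhomogMn.
apply: dhomogM; last exact: dhomogMn.
by rewrite /= -alg_mpolyC; apply: dhomogZ; apply: dhomog1.
Qed.

Lemma homog_phiA d al be ga j :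
  homog (1 + 3 * d) (vcoord (phiA (@mpolyC 3 C) d al be ga mgen) j).
Proof.
by rewrite /vcoord /phiA; case: ifP => _; [|case: ifP => _]; apply: dhomogM;
  rewrite ?homog_var ?homog_hom ?homog_var3.
Qed.

Lemma homog_phiB d al be ga j :
  homog (3 * d.+1) (vcoord (phiB (@mpolyC 3 C) d al be ga mgen) j).
Proof.
rewrite /vcoord /phiB; case: ifP => _; [|case: ifP => _]; rewrite ?homog_hom ?homog_var3 //.
rewrite mulnS; apply: dhomogM; last by rewrite homog_hom ?homog_var3.
apply: (@dhomogM _ _ _ 2 _ 1); last exact: homog_var.
by apply: (@dhomogM _ _ _ 1 _ 1); apply: homog_var.
Qed.

Lemma vcoord_map (T U : Type) (f : T -> U) v j : f (vcoord v j) = vcoord (mapv f v) j.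
Proof. by rewrite /vcoord /mapv; case: ifP => _; [|case: ifP => _]. Qed.

Lemma mapv_mgen (u : 'I_3 -> C) : mapv (meval u) mgen = (u iX, u iY, u iZ).
Proof. by rewrite /mapv /mgen /= !mevalXU. Qed.

Lemma meval_phiA d al be ga (u : 'I_3 -> C) j :
  meval u (vcoord (phiA (@mpolyC 3 C) d al be ga mgen) j) =
  vcoord (phiA (@idfun C) d al be ga (u iX, u iY, u iZ)) j.
Proof.
rewrite (vcoord_map (meval u)) -mapv_mgen.
have E : mapv (meval u) (phiA (@mpolyC 3 C) d al be ga mgen) =
  phiA (@idfun C) d al be ga (mapv (meval u) mgen).
  by apply: phiA_map => c; rewrite /= mevalC.
by have := congr1 (fun w => vcoord w j) E.
Qed.

Lemma meval_phiB d al be ga (u : 'I_3 -> C) j :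
  meval u (vcoord (phiB (@mpolyC 3 C) d al be ga mgen) j) =
  vcoord (phiB (@idfun C) d al be ga (u iX, u iY, u iZ)) j.
Proof.
rewrite (vcoord_map (meval u)) -mapv_mgen.
have E : mapv (meval u) (phiB (@mpolyC 3 C) d al be ga mgen) =
  phiB (@idfun C) d al be ga (mapv (meval u) mgen).
  by apply: phiB_map => c; rewrite /= mevalC.
by have := congr1 (fun w => vcoord w j) E.
Qed.

Lemma hom_at0 d p (s : C) : hom (@idfun C) d p s 0 = p`_d * s ^+ d.
Proof.
rewrite /hom big_ord_recr /= subnn mulr1 big1 ?add0r // => k _.
by rewrite expr0n subn_eq0 leqNgt ltn_ord mulr0.
Qed.

Lemma hom_horner d (p : {poly C}) (s w : C) : w != 0 -> (size p <= d.+1)%N ->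
  hom (@idfun C) d p s w = w ^+ d * p.[s / w].
Proof.
move=> w0 sp; rewrite (horner_coef_wide _ sp) big_distrr; apply: eq_bigr => k _ /=.
have kd : (k <= d)%N by rewrite -ltnS.
have -> : w ^+ d = w ^+ (d - k) * w ^+ k by rewrite -exprD subnK.
rewrite expr_div_n.
by field; rewrite expf_neq0.
Qed.

Lemma cub_infinity (v : vec C) : v <> v0 C -> cub v = 0 -> v.2 = 0 -> v.1.1 != 0.
Proof.
move=> vn hv z0; apply/eqP => x0; have := cub_coordY vn hv x0.
apply/negP; rewrite negbK.
by move/cub0E/eqP: hv; rewrite x0 z0 !expr0n add0r eq_sym expf_eq0.
Qed.

(** A common zero over s = X^3 / Z^3 is a common root of al and ga, excluded, or
   has X = 0 and ga(0) = 0. Then be(0) = 0 by the equation E, and comparing orders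
   at 0 in E gives al(0) = 0. *)
Lemma phiA_neq0 d (al be ga : {poly C}) (v : vec C) :
  (size al <= d.+1)%N -> (size be <= d.+1)%N -> (size ga <= d.+1)%N ->
  'X * al ^+ 3 + (1 - 'X) * be ^+ 3 = ga ^+ 3 ->
  (forall s, al.[s] = 0 -> ga.[s] = 0 -> False) -> al`_d != 0 ->
  v <> v0 C -> cub v = 0 -> phiA (@idfun C) d al be ga v <> v0 C.
Proof.
move=> sa sb sg E cop ad vn hv; rewrite /phiA.
have [z0|z0] := eqVneq v.2 0.
  have x0 := cub_infinity vn hv z0.
  rewrite z0 expr0n /= !hom_at0; case=> /eqP + _ _; apply/negP.
  by rewrite !mulf_neq0 // !expf_neq0.
have z30 : v.2 ^+ 3 != 0 by rewrite expf_neq0.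
rewrite !hom_horner //; set s := v.1.1 ^+ 3 / v.2 ^+ 3.
case=> /eqP + _ /eqP; rewrite !mulf_eq0 !expf_eq0 /= (negPf z0) !andbF /=.
move=> + /eqP gs; have [x0 _|x0 /= /eqP as0] := eqVneq v.1.1 0; last exact: cop gs.
have s0 : s = 0 by rewrite /s x0 expr0n mul0r.
rewrite s0 in gs.
have bs : be.[0] = 0.
  have := congr1 (fun p => p.[0]) E.
  rewrite -polyC1 !(horner_exp, hornerX, hornerC, hornerD, hornerN, hornerM) gs.
  by rewrite mul0r add0r subr0 mul1r [in RHS]expr0n => /eqP; rewrite expf_eq0 => /eqP.
apply: (cop 0) => //.
have /factor_theorem[g gE] : root ga 0 by apply/eqP.
have /factor_theorem[b bE] : root be 0 by apply/eqP.
rewrite subr0 in gE bE.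
have X0 : ('X : {poly C}) != 0 by rewrite -size_poly_eq0 size_polyX.
have aE : al ^+ 3 = 'X * ('X * (g ^+ 3 - (1 - 'X) * b ^+ 3)).
  apply: (mulfI X0); apply/eqP; rewrite -subr_eq0; apply/eqP.
  transitivity ('X * al ^+ 3 + (1 - 'X) * be ^+ 3 - ga ^+ 3); last by rewrite E subrr.
  by rewrite gE bE; ring.
have := congr1 (fun p => p.[0]) aE.
by rewrite horner_exp hornerM hornerX mul0r => /eqP; rewrite expf_eq0 /= => /eqP.
Qed.

(** A common root s of al and be is a root of ga as well: if s is not 0 or 1 by the
   equation E, and if it is, because the left side of E vanishes there to order 3
   while 'X * (1 - 'X) has a simple zero. *)
Lemma phiB_neq0 d (al be ga : {poly C}) (v : vec C) :
  (size al <= d.+2)%N -> (size be <= d.+2)%N -> (size ga <= d.+1)%N ->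
  al ^+ 3 + be ^+ 3 = 'X * (1 - 'X) * ga ^+ 3 ->
  (forall s, al.[s] = 0 -> ga.[s] = 0 -> False) -> al`_d.+1 != 0 ->
  v <> v0 C -> cub v = 0 -> phiB (@idfun C) d al be ga v <> v0 C.
Proof.
move=> sa sb sg E cop ad vn hv; rewrite /phiB.
have [z0|z0] := eqVneq v.2 0.
  have x0 := cub_infinity vn hv z0.
  rewrite z0 expr0n /= !hom_at0; case=> /eqP + _ _; apply/negP.
  by rewrite !mulf_neq0 // !expf_neq0.
have z30 : v.2 ^+ 3 != 0 by rewrite expf_neq0.
rewrite !hom_horner //; set s := v.1.1 ^+ 3 / v.2 ^+ 3.
have zn : (v.2 ^+ 3) ^+ d.+1 != 0 by rewrite expf_neq0.
case=> /(mulfI0 zn) as0 /(mulfI0 zn) bs0 _.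
have /factor_theorem[a aE] : root al s by apply/eqP.
have /factor_theorem[b bE] : root be s by apply/eqP.
have u0 : 'X - s%:P != 0 by rewrite polyXsubC_eq0.
have sing (l : {poly C}) : 'X * (1 - 'X) = ('X - s%:P) * l -> l.[s] != 0 -> False.
  move=> lE ls; apply: (cop s) => //.
  have : l * ga ^+ 3 = ('X - s%:P) * ('X - s%:P) * (a ^+ 3 + b ^+ 3).
    apply: (mulfI u0); rewrite mulrA -lE -E aE bE; ring.
  move/(congr1 (fun p => p.[s])); rewrite -[in RHS]mulrA hornerM horner_exp.
  rewrite [in RHS]hornerM hornerXsubC subrr mul0r => /(mulfI0 ls)/eqP.
  by rewrite expf_eq0 /= => /eqP.
have [s0|s0] := eqVneq s 0.
  apply: (sing (1 - 'X)); first by rewrite s0 subr0.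
  by rewrite s0 -polyC1 hornerD hornerN hornerX hornerC subr0 oner_eq0.
have [s1|s1] := eqVneq s 1.
  apply: (sing (- 'X)); first by rewrite s1; ring.
  by rewrite s1 hornerN hornerX oppr_eq0 oner_eq0.
apply: (cop s) => //; have := congr1 (fun p => p.[s]) E.
rewrite -polyC1 !(horner_exp, hornerX, hornerC, hornerD, hornerN, hornerM) as0 bs0.
rewrite expr0n addr0 => /esym/mulfI0 h; apply/cube_eq0/h.
by rewrite mulf_neq0 // subr_eq0 eq_sym.
Qed.

Lemma phiA_O d (al be ga : {poly C}) : be`_d = al`_d ->
  par (vO C) (phiA (@idfun C) d al be ga (vO C)).
Proof.
move=> e; rewrite /phiA /vO /= expr0n /= !hom_at0 e !mul1r mul0r.
by split=> /=; ring.
Qed.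

Lemma phiB_O d (al be ga : {poly C}) : be`_d.+1 = - al`_d.+1 ->
  par (vO C) (phiB (@idfun C) d al be ga (vO C)).
Proof.
move=> e; rewrite /phiB /vO /= expr0n /= !hom_at0 e !mulr0 mul0r.
by split=> /=; ring.
Qed.

End Forms.

Section Isogeny.
Variable R : realType.
Local Notation C := (Cplx R).
Local Notation A := (chartRing C).
Implicit Types P Q T : E3 R.

Lemma E3_normalize (w : vec C) : cub w = 0 -> w <> v0 C ->
  exists P : E3 R, exists2 k, k != 0 & vecE P = scal k w.
Proof.
move=> hw wn; have [k [k0 kn]] : exists k : C, k != 0 /\
    ((k * w.2 == 1) || (k * w.2 == 0) && (k * w.1.1 == 1)).
  have [z0|z0] := eqVneq w.2 0; last first.
    by exists w.2^-1; rewrite invr_eq0 mulVf // eqxx.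
  have x0 := cub_infinity wn hw z0.
  by exists w.1.1^-1; rewrite invr_eq0 mulVf // z0 mulr0 !eqxx orbT.
have hr : (fermat (rowv (scal k w)) == 0) && normalized (rowv (scal k w)).
  apply/andP; split.
    by rewrite /fermat -[_ - _]/(cub (tov _)) rowvK cub_scal hw mulr0.
  have := rowvK (scal k w); rewrite /tov /normalized; case=> -> _ ->.
  exact: kn.
by exists (Sub (rowv (scal k w)) hr), k; rewrite // /vecE SubK rowvK.
Qed.

Lemma vecE_O : vecE (O_E3 R) = vO C.
Proof.
case: i3_neq => h1 h2 h3.
by rewrite /vecE SubK /tov /O_vec !mxE eqxx h1 h2 h3 eqxx.
Qed.

Lemma coordE P j : Defs.coord P j = vcoord (vecE P) j.
Proof.
case: i3_neq => h1 h2 h3; rewrite /Defs.coord /vcoord /vecE /tov /=.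
by case: (I3_cases j) => ->; rewrite ?eqxx ?h1 ?h2 ?h3.
Qed.

Section FromForms.
Variables (PhC : vec C -> vec C) (PhA : vec A -> vec A) (c : C) (n : nat).
Variable F : 'I_3 -> mpoly 3 C.
Hypothesis PhE : forall (v t : C) (vt : v ^+ 3 = t ^+ 3 - 1) w,
  mapv (chart_eval vt) (PhA w) = PhC (mapv (chart_eval vt) w).
Hypothesis PhC_scal : forall k v, PhC (scal k v) = scal (k ^+ n) (PhC v).
Hypothesis PhA_scal : forall k v, PhA (scal k v) = scal (k ^+ n) (PhA v).
Hypothesis PhC_cub : forall v, cub v = 0 -> cub (PhC v) = 0.
Hypothesis PhA_cub : forall v, cub v = 0 -> cub (PhA v) = 0.
Hypothesis PhC_neq0 : forall v, v <> v0 C -> cub v = 0 -> PhC v <> v0 C.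
Hypothesis PhA_flow : forall l v, cub v = 0 -> flow (@chart_D C) l v ->
  flow (@chart_D C) (chart_const c * l) (PhA v).
Hypothesis PhC_O : par (vO C) (PhC (vO C)).
Hypothesis F_homog : forall j, F j \is ishomog1 n mdeg.
Hypothesis F_eval : forall (u : 'I_3 -> C) j,
  meval u (F j) = vcoord (PhC (u iX, u iY, u iZ)) j.

(** The same triple of forms is used near every point, because [PhC_neq0] excludes
   common zeros; additivity follows from [coll_PhC] and the fact that O is
   fixed. *)
Lemma isogeny_of_forms : exists phi : E3 R -> E3 R, isogeny phi /\
  forall P, exists2 k, k != 0 & vecE (phi P) = scal k (PhC (vecE P)).
Proof.
have /choice[phi phiE] : forall P, exists Q, exists2 k, k != 0 &
    vecE Q = scal k (PhC (vecE P)).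
  move=> P; apply: E3_normalize; first exact/PhC_cub/E3_cub.
  by apply: PhC_neq0; [apply: E3_neq0|apply: E3_cub].
exists phi; split=> //.
have lc P Q T : line_cuts P Q T -> line_cuts (phi P) (phi Q) (phi T).
  move/line_cuts_coll => h; apply/line_cuts_coll.
  have [k _ ->] := phiE P; have [l _ ->] := phiE Q; have [m _ ->] := phiE T.
  apply: coll_scal; move: h.
  apply: (coll_PhC PhE PhC_scal PhA_scal PhC_cub PhA_cub PhC_neq0 PhA_flow PhC_O);
    by [apply: E3_neq0|apply: E3_cub].
have phiO : phi (O_E3 R) = O_E3 R.
  apply/esym/E3_par_eq; have [k _ ->] := phiE (O_E3 R).
  by apply: par_scalr; rewrite vecE_O.
split; last first.
  by move=> P Q S [T /lc PQT /lc]; rewrite phiO => OTS; exists (phi T).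
have cE Q : (Defs.coord Q iX, Defs.coord Q iY, Defs.coord Q iZ) = vecE Q by [].
move=> P; exists n, F; split=> // [|Q].
- have nz : PhC (vecE P) <> v0 C by apply: PhC_neq0; [apply: E3_neq0|apply: E3_cub].
  case: i3_neq => h1 h2 h3.
  have [h|h|h] := unit_coord nz; [exists iX|exists iY|exists iZ];
    by rewrite F_eval cE /vcoord ?eqxx ?h1 ?h2 ?h3.
have [k k0 E] := phiE Q; exists k^-1 => j; rewrite F_eval cE coordE E.
by rewrite /vcoord /scal /=; case: ifP => _; [|case: ifP => _]; rewrite mulrA mulVf // mul1r.
Qed.

End FromForms.

Section TypeA.
Variables (d : nat) (al be ga : {poly C}) (c : C).
Hypotheses (sa : (size al <= d.+1)%N) (sb : (size be <= d.+1)%N)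
  (sg : (size ga <= d.+1)%N).
Hypothesis E : 'X * al ^+ 3 + (1 - 'X) * be ^+ 3 = ga ^+ 3.
Hypothesis I1 : al * ga + 'X * wronsk al ga *+ 3 = c *: be ^+ 2.
Hypothesis cop : forall s, al.[s] = 0 -> ga.[s] = 0 -> False.
Hypothesis ad : al`_d != 0.
Hypothesis bd : be`_d = al`_d.

Lemma isogenyA : exists phi : E3 R -> E3 R, isogeny phi /\
  forall P, exists2 k, k != 0 &
    vecE (phi P) = scal k (phiA (@idfun C) d al be ga (vecE P)).
Proof.
have be0 : be != 0 by apply: contraNneq ad => b0; rewrite -bd b0 coef0.
apply: (@isogeny_of_forms _ (phiA (@chart_const C) d al be ga) c (1 + 3 * d)
  (vcoord (phiA (@mpolyC 3 C) d al be ga (mgen C)))).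
- by move=> v t vt w; apply: phiA_map => x; apply: chart_eval_const.
- exact: phiA_scal.
- exact: phiA_scal.
- exact: cub_phiA.
- exact: cub_phiA.
- by move=> v; apply: phiA_neq0.
- exact: flow_phiA (@chart_DD C) (@chart_DM C) (@chart_D_const C).
- exact: phiA_O.
- exact: homog_phiA.
- exact: meval_phiA.
Qed.
End TypeA.

Section TypeB.
Variables (d : nat) (al be ga : {poly C}) (c : C).
Hypotheses (sa : (size al <= d.+2)%N) (sb : (size be <= d.+2)%N)
  (sg : (size ga <= d.+1)%N).
Hypothesis E : al ^+ 3 + be ^+ 3 = 'X * (1 - 'X) * ga ^+ 3.
Hypothesis I1 : (2%:R * 'X - 1) * (al * ga) + 'X * (1 - 'X) * wronsk al ga *+ 3
  = c *: be ^+ 2.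
Hypothesis cop : forall s, al.[s] = 0 -> ga.[s] = 0 -> False.
Hypothesis ad : al`_d.+1 != 0.
Hypothesis bd : be`_d.+1 = - al`_d.+1.

Lemma isogenyB : exists phi : E3 R -> E3 R, isogeny phi /\
  forall P, exists2 k, k != 0 &
    vecE (phi P) = scal k (phiB (@idfun C) d al be ga (vecE P)).
Proof.
have be0 : be != 0.
  by apply: contraNneq ad => b0; rewrite -[al`__]opprK -bd b0 coef0 oppr0.
apply: (@isogeny_of_forms _ (phiB (@chart_const C) d al be ga) c (3 * d.+1)
  (vcoord (phiB (@mpolyC 3 C) d al be ga (mgen C)))).
- by move=> v t vt w; apply: phiB_map => x; apply: chart_eval_const.
- exact: phiB_scal.
- exact: phiB_scal.
- exact: cub_phiB.
- exact: cub_phiB.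
- by move=> v; apply: phiB_neq0.
- exact: flow_phiB (@chart_DD C) (@chart_DM C) (@chart_D_const C).
- exact: phiB_O.
- exact: homog_phiB.
- exact: meval_phiB.
Qed.
End TypeB.

End Isogeny.

(** * From the polynomial differential equation to the isogeny *)

Section SquareCube.
Variable C : numFieldType.
Implicit Types a b g p q u : {poly C}.

(** A square that is a^2 times a cube: a g divides u because its square divides
   u^2, and the quotient b satisfies g = b^2. *)
Lemma sq_cube a u g : a != 0 -> u != 0 -> u ^+ 2 = a ^+ 2 * g ^+ 3 ->
  exists b, g = b ^+ 2 /\ u = a * b ^+ 3.
Proof.
move=> a0 u0 e.
have g0 : g != 0.
  by apply: contraNneq u0 => g0; move/eqP: e; rewrite g0 expr0n mulr0 expf_eq0.
have /dvdpP[b bE] : dvdp (a * g) u.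
  by rewrite -(@dvdp_pexp2r _ _ _ 2) // e; apply/dvdpP; exists g; ring.
have gE : g = b ^+ 2.
  have n0 : a ^+ 2 * g ^+ 2 != 0 by rewrite mulf_neq0 ?expf_neq0.
  apply: (mulfI n0); transitivity (u ^+ 2); last by rewrite bE; ring.
  by rewrite e; ring.
exists b; split=> //; rewrite bE {1}gE; ring.
Qed.

Lemma size_cube_le p (n : nat) : (size (p ^+ 3)%R <= (3 * n).+1)%N -> (size p <= n.+1)%N.
Proof.
have := size_exp p 3; case: (size p) => // s /=.
case: (size (p ^+ 3)) => [|m] /= e; rewrite ?ltnS; first by move: e; case: s.
by rewrite e mulnC leq_pmul2l.
Qed.

Lemma wronskMr p q g : wronsk (p * g) (q * g) = g ^+ 2 * wronsk p q.
Proof. by rewrite /wronsk !derivM; ring. Qed.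

Lemma gcd_reduce p q : q != 0 -> exists g p0 q0,
  [/\ p = p0 * g, q = q0 * g, g != 0 &
     forall s, p0.[s] = 0 -> q0.[s] = 0 -> False].
Proof.
move=> q0; have g0 : gcdp p q != 0 by rewrite gcdp_eq0 negb_and q0 orbT.
exists (gcdp p q), (p %/ gcdp p q), (q %/ gcdp p q).
split; rewrite ?divpK ?dvdp_gcdl ?dvdp_gcdr // => s ps qs.
have cop : coprimep (p %/ gcdp p q) (q %/ gcdp p q).
  by rewrite coprimep_div_gcd // q0 orbT.
by have := coprimep_root cop (introT eqP ps); rewrite qs eqxx.
Qed.

End SquareCube.

Section OdeToIsogeny.
Variable R : realType.
Local Notation C := (Cplx R).
Implicit Types p q : {poly C}.

Lemma E3_affine (x y : C) : x ^+ 3 + y ^+ 3 = 1 -> exists P : E3 R, vecE P = (x, y, 1).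
Proof.
move=> h; have hc : cub ((x, y, 1) : vec C) = 0 by rewrite /cub /= h expr1n subrr.
have [|P [k k0 PE]] := E3_normalize hc; first by case=> _ _ /eqP; rewrite oner_eq0.
exists P; have /andP[_] := valP P; move: (PE); case=> _ _; rewrite mulr1 => kz.
rewrite /normalized kz (negPf k0) orbF => /eqP k1.
by rewrite PE k1 /scal /= !mul1r.
Qed.

Lemma coord_normalized (P : E3 R) k (x y z : C) : k != 0 -> z != 0 ->
  vecE P = scal k (x, y, z) -> Defs.coord P iZ = 1 /\ Defs.coord P iX = x / z.
Proof.
move=> k0 z0; case=> e1 _ e3; rewrite /Defs.coord e1 e3 /=.
have /andP[_] := valP P; rewrite /normalized e3 /= mulf_eq0 (negPf k0) (negPf z0) /= orbF.
move/eqP => kz; split=> //; apply: (mulIf z0).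
by rewrite mulrAC kz mul1r divfK.
Qed.

Lemma nonzero_of_affine (phi : E3 R -> E3 R) P :
  Defs.coord (phi P) iZ = 1 -> nonzero_map phi.
Proof.
move=> h; exists P => e; move: h; rewrite e coordE vecE_O /vcoord.
by case: i3_neq => _ -> -> /= /eqP; rewrite eq_sym oner_eq0.
Qed.

(** Since O is at infinity, an affine point where the formula of the conclusion
   holds shows that the isogeny is nonzero. *)
Lemma affine_point (r : {poly C}) : r != 0 -> exists P : E3 R,
  [/\ Defs.coord P iZ = 1, r.[Defs.coord P iX ^+ 3] != 0 & Defs.coord P iY != 0].
Proof.
move=> r0; have : r * ('X - 1%:P) != 0 by rewrite mulf_neq0 // polyXsubC_eq0.
case/closed_nonrootP => s; rewrite /root hornerM hornerXsubC mulf_eq0 negb_or.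
case/andP=> rs s1.
have c3 (t : C) : (3.-root t) ^+ 3 = t by rewrite rootCK.
have [P PE] : exists P : E3 R, vecE P = (3.-root s, 3.-root (1 - s), 1).
  by apply: E3_affine; rewrite !c3 addrC subrK.
exists P; case: i3_neq => h1 h2 h3; rewrite !coordE PE /vcoord eqxx h1 h2 h3 eqxx /= c3.
by split=> //; rewrite rootC_eq0 // subr_eq0 eq_sym -subr_eq0.
Qed.

(** Used to determine the top coefficient of b, known through its square and its
   cube, without an ambiguity of root of unity. *)
Lemma sqr_cube_eq (a b : C) : a != 0 -> a ^+ 2 = b ^+ 2 -> a ^+ 3 = b ^+ 3 -> b = a.
Proof.
move=> a0 h2 h3; have n0 : a ^+ 2 != 0 by rewrite expf_neq0.
by apply: (mulIf n0); rewrite {1}h2 -!exprS.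
Qed.

(** Common factors of p and q cancel, since both sides of the equation are
   homogeneous in (p, q). For the coprime pair, [sq_cube] gives the middle
   coordinate b. The top coefficients, from the limit at infinity, make O a fixed
   point. *)
Lemma isogeny_of_odeA p q (mu0 : C) : q != 0 -> size p = size q -> mu0 != 0 ->
  lead_coef p = mu0 * lead_coef q ->
  ('X * p ^+ 3 - q ^+ 3) ^+ 2 =
    (mu0 ^+ 3)%:P * ('X - 1) ^+ 2 * (p * q + 'X * wronsk p q *+ 3) ^+ 3 ->
  exists phi : E3 R -> E3 R, [/\ isogeny phi, nonzero_map phi
    & transforms_coord phi iX (fun x _ => q.[x ^+ 3] != 0)
        (fun x _ => x * ratfun p q (x ^+ 3))].
Proof.
move=> qn0 spq m0 lpq ode.
have [g [p0 [q0 [pE qE gn0 cop]]]] := gcd_reduce p qn0.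
have q0n : q0 != 0 by apply: contraNneq qn0 => h; rewrite qE h mul0r.
have pn0 : p != 0 by rewrite -size_poly_eq0 spq size_poly_eq0.
have p0n : p0 != 0 by apply: contraNneq pn0 => h; rewrite pE h mul0r.
have sg0 : (0 < size g)%N by rewrite size_poly_gt0.
have spq0 : size p0 = size q0.
  have := spq; rewrite pE qE !size_mul // => /(congr1 S).
  rewrite !prednK; last 2 first.
  - by rewrite addn_gt0 sg0 orbT.
  - by rewrite addn_gt0 sg0 orbT.
  by move/addIn.
have lpq0 : lead_coef p0 = mu0 * lead_coef q0.
  have := lpq; rewrite pE qE !lead_coefM mulrA => /mulIf; apply.
  by rewrite lead_coef_eq0.
have sq0 : (0 < size q0)%N by rewrite size_poly_gt0.
pose d := (size q0).-1; have sqd : size q0 = d.+1 by rewrite /d prednK.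
have sqd' : (size q0 <= d.+1)%N by rewrite sqd.
have spd' : (size p0 <= d.+1)%N by rewrite spq0 sqd.
have topq : lead_coef q0 = q0`_d by [].
have topp : lead_coef p0 = p0`_d by rewrite /lead_coef spq0.
have qd0 : q0`_d != 0 by rewrite -topq lead_coef_eq0.
have pd0 : p0`_d != 0 by rewrite -topp lead_coef_eq0.
pose G := p0 * q0 + 'X * wronsk p0 q0 *+ 3.
have ode0 : (q0 ^+ 3 - 'X * p0 ^+ 3) ^+ 2 = (1 - 'X) ^+ 2 * (mu0%:P * G) ^+ 3.
  have n0 : g ^+ 6 != 0 by rewrite expf_neq0.
  apply: (mulfI n0); transitivity (('X * p ^+ 3 - q ^+ 3) ^+ 2).
    by rewrite pE qE; ring.
  rewrite ode pE qE wronskMr polyC_exp /G; ring.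
have [b [GE UE]] : exists b, mu0%:P * G = b ^+ 2 /\ q0 ^+ 3 - 'X * p0 ^+ 3 = (1 - 'X) * b ^+ 3.
  apply: sq_cube ode0; first by rewrite -size_poly_eq0 size1BX.
  rewrite subr_eq0; apply/eqP => /(congr1 (fun r : {poly C} => size r)).
  have := size_exp q0 3; have := size_exp p0 3.
  rewrite mulrC size_mulX ?expf_neq0 // spq0 => e1 e2 e3; move: e2; rewrite e3 /=.
  have : (0 < size (p0 ^+ 3))%N by rewrite size_poly_gt0 expf_neq0.
  case: (size (p0 ^+ 3)) e1 => // m /= -> _ /eqP.
  by rewrite -[X in _ == X]addn0 -addn1 eqn_add2l.
have bd : (size b <= d.+1)%N.
  apply: size_cube_le; have [->|b0] := eqVneq b 0; first by rewrite expr0n size_poly0.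
  have b30 : b ^+ 3 != 0 by rewrite expf_neq0.
  have : (size ((1 - 'X) * b ^+ 3)%R <= (1 + 3 * d).+1)%N.
    rewrite -UE; apply: (leq_trans (size_polyD _ _)); rewrite size_polyN geq_max.
    apply/andP; split; last by rewrite size_mul_leq ?size_polyX ?size_exp_hom.
    by apply: (leq_trans (size_exp_hom 3 sqd')); rewrite ltnS leq_addl.
  by rewrite size_mul ?size1BX // -size_poly_eq0 size1BX.
have E : 'X * p0 ^+ 3 + (1 - 'X) * b ^+ 3 = q0 ^+ 3 by rewrite -UE addrC subrK.
have I1 : p0 * q0 + 'X * wronsk p0 q0 *+ 3 = mu0^-1 *: b ^+ 2.
  by rewrite -GE mul_polyC scalerA mulVf // scale1r.
have top3 (r : {poly C}) : (size r <= d.+1)%N ->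
    hom (@idfun C) (3 * d) (r ^+ 3) 1 0 = r`_d ^+ 3.
  by move=> sr; rewrite homX // hom_at0 expr1n mulr1.
(* compare the coefficients of top degree in I1 and in E; evaluating a
   homogenisation at (1, 0) reads them off *)
have bdE : b`_d = p0`_d.
  apply: sqr_cube_eq => //.
    have := congr1 (fun r => hom (@idfun C) (d + d) r 1 0) I1.
    rewrite homD homMn homZ expr2 homM // -homM_wronsk ?size_polyX // hom2X mulr0 mul0r.
    rewrite mul0rn addr0 homM // !hom_at0 !expr1n !mulr1 /= -expr2 => h.
    apply: (mulfI (invr_neq0 m0)); rewrite -h -topq -topp lpq0.
    by field.
  have := congr1 (fun r => hom (@idfun C) (1 + 3 * d) r 1 0) E.
  rewrite -[q0 ^+ 3]mul1r homD !(@homM _ _ _ _ _ 1) ?size_exp_hom ?size_polyX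
    ?size1BX ?size_poly1 // hom1X hom1BX hom11 !top3 // mul0r mul1r sub0r mulN1r.
  by move/eqP; rewrite subr_eq0 => /eqP.
have [phi [phi_isog phiE]] := isogenyA spd' bd sqd' E I1 cop pd0 bdE.
have tr : transforms_coord phi iX (fun x _ => q.[x ^+ 3] != 0)
    (fun x _ => x * ratfun p q (x ^+ 3)).
  move=> P Pz /=; rewrite qE hornerM mulf_eq0 negb_or => /andP[qs gs].
  have [k k0 e] := phiE P.
  have vP : vecE P = (Defs.coord P iX, Defs.coord P iY, 1) by rewrite -Pz.
  rewrite vP /phiA /= expr1n !hom_horner ?oner_eq0 // expr1n !mul1r !divr1 in e.
  have [-> ->] := coord_normalized k0 qs e; split=> //.
  by rewrite /ratfun pE !hornerM; field; rewrite gs qs.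
exists phi; split=> //.
have [P [Pz Pq _]] := affine_point qn0.
by have [h _] := tr P Pz Pq; apply: nonzero_of_affine h.
Qed.

(** As for [isogeny_of_odeA]. The right side of the equation is divisible by 'X,
   which forces the denominator to be q0 = ga * 'X; after division by 'X ^+ 4 the
   equation is a square equal to a cube. *)
Lemma isogeny_of_odeB p q (eta0 : C) : q != 0 -> size p = size q -> eta0 != 0 ->
  lead_coef p = eta0 * lead_coef q ->
  ('X ^+ 2 * p ^+ 3 - (1 - 'X) * q ^+ 3) ^+ 2 = ((- eta0) ^+ 3)%:P * 'X *
    ((2%:R - 'X) * (p * q) + 'X * (1 - 'X) * wronsk p q *+ 3) ^+ 3 ->
  exists phi : E3 R -> E3 R, [/\ isogeny phi, nonzero_map phi
    & transforms_coord phi iX (fun x y => q.[x ^+ 3] != 0 /\ y != 0)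
        (fun x y => ratfun p q (x ^+ 3) * x ^+ 2 / y)].
Proof.
move=> qn0 spq m0 lpq ode.
have [g [p0 [q0 [pE qE gn0 cop]]]] := gcd_reduce p qn0.
have q0n : q0 != 0 by apply: contraNneq qn0 => h; rewrite qE h mul0r.
have pn0 : p != 0 by rewrite -size_poly_eq0 spq size_poly_eq0.
have p0n : p0 != 0 by apply: contraNneq pn0 => h; rewrite pE h mul0r.
have sg0 : (0 < size g)%N by rewrite size_poly_gt0.
have spq0 : size p0 = size q0.
  have := spq; rewrite pE qE !size_mul // => /(congr1 S).
  rewrite !prednK; last 2 first.
  - by rewrite addn_gt0 sg0 orbT.
  - by rewrite addn_gt0 sg0 orbT.
  by move/addIn.
have lpq0 : lead_coef p0 = eta0 * lead_coef q0.
  have := lpq; rewrite pE qE !lead_coefM mulrA => /mulIf; apply.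
  by rewrite lead_coef_eq0.
have ode0 : ('X ^+ 2 * p0 ^+ 3 - (1 - 'X) * q0 ^+ 3) ^+ 2 = ((- eta0) ^+ 3)%:P * 'X *
    ((2%:R - 'X) * (p0 * q0) + 'X * (1 - 'X) * wronsk p0 q0 *+ 3) ^+ 3.
  have n0 : g ^+ 6 != 0 by rewrite expf_neq0.
  apply: (mulfI n0).
  transitivity (('X ^+ 2 * p ^+ 3 - (1 - 'X) * q ^+ 3) ^+ 2).
    by rewrite pE qE; ring.
  by rewrite ode pE qE wronskMr; ring.
have [ga q0E] : exists ga : {poly C}, q0 = ga * 'X.
  have /factor_theorem[ga ->] : root q0 0; last by exists ga; rewrite subr0.
  have ode1 : ('X ^+ 2 * p0 ^+ 3 - (1 - 'X) * q0 ^+ 3) ^+ 2 = 'X * (((- eta0) ^+ 3)%:P *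
      ((2%:R - 'X) * (p0 * q0) + 'X * (1 - 'X) * wronsk p0 q0 *+ 3) ^+ 3).
    by rewrite ode0; ring.
  apply/eqP; have := congr1 (fun r : {poly C} => r.[0]) ode1.
  rewrite horner_exp [in RHS]hornerM hornerX mul0r => /eqP.
  rewrite expf_eq0 /= -polyC1 !(horner_exp, hornerX, hornerC, hornerD, hornerN, hornerM).
  by rewrite expr0n mul0r sub0r subr0 mul1r oppr_eq0 expf_eq0 /= => /eqP.
have gan : ga != 0 by apply: contraNneq q0n => h; rewrite q0E h mul0r.
have sga0 : (0 < size ga)%N by rewrite size_poly_gt0.
pose d := (size ga).-1; have sgd : size ga = d.+1 by rewrite /d prednK.
have sgd' : (size ga <= d.+1)%N by rewrite sgd.
have sqd : size q0 = d.+2 by rewrite q0E size_mulX // sgd.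
have spd' : (size p0 <= d.+2)%N by rewrite spq0 sqd.
have lpg : p0`_d.+1 = eta0 * ga`_d.
  by have := lpq0; rewrite /lead_coef spq0 sqd /= q0E coefMX.
have gd0 : ga`_d != 0 by rewrite -[ga`_d]/(lead_coef ga) lead_coef_eq0.
have pd0 : p0`_d.+1 != 0 by rewrite lpg mulf_neq0.
pose G := (2%:R * 'X - 1) * (p0 * ga) + 'X * (1 - 'X) * wronsk p0 ga *+ 3.
have X0 : ('X : {poly C}) != 0 by rewrite -size_poly_eq0 size_polyX.
have odeU : ('X * (1 - 'X) * ga ^+ 3 - p0 ^+ 3) ^+ 2 = 1 ^+ 2 * ((- eta0)%:P * G) ^+ 3.
  have n0 : ('X : {poly C}) ^+ 4 != 0 by rewrite expf_neq0.
  apply: (mulfI n0).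
  transitivity (('X ^+ 2 * p0 ^+ 3 - (1 - 'X) * q0 ^+ 3) ^+ 2).
    by rewrite q0E; ring.
  by rewrite ode0 q0E /G /wronsk derivM derivX polyC_exp; ring.
have top0 : hom (@idfun C) (3 * d.+1) ('X * (1 - 'X) * ga ^+ 3) 1 0 = 0.
  rewrite mulnS homM ?size_exp_hom ?(leq_trans (sizeXBX C)) //.
  by rewrite hom_widen ?sizeXBX // !mul0r.
have top3 (r : {poly C}) : (size r <= d.+2)%N ->
    hom (@idfun C) (3 * d.+1) (r ^+ 3) 1 0 = r`_d.+1 ^+ 3.
  by move=> sr; rewrite homX // hom_at0 expr1n mulr1.
have [b [GE UE]] : exists b, (- eta0)%:P * G = b ^+ 2 /\
    'X * (1 - 'X) * ga ^+ 3 - p0 ^+ 3 = 1 * b ^+ 3.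
  apply: sq_cube odeU; first by rewrite oner_eq0.
  apply/eqP => /(congr1 (fun r => hom (@idfun C) (3 * d.+1) r 1 0)).
  rewrite homB top0 top3 // -polyC0 homC mul0r sub0r => /eqP.
  by rewrite oppr_eq0 expf_eq0 (negPf pd0).
rewrite mul1r in UE.
have bd : (size b <= d.+2)%N.
  apply: size_cube_le; rewrite -UE; apply: (leq_trans (size_polyD _ _)).
  rewrite size_polyN geq_max; apply/andP; split; last exact: size_exp_hom.
  rewrite mulnS; apply: size_mul_leq; last exact: size_exp_hom.
  exact: leq_trans (sizeXBX C) _.
have E : p0 ^+ 3 + b ^+ 3 = 'X * (1 - 'X) * ga ^+ 3 by rewrite -UE addrC subrK.
have I1 : G = (- eta0)^-1 *: b ^+ 2.
  by rewrite -GE mul_polyC scalerA mulVf ?oppr_eq0 // scale1r.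
have bdE : b`_d.+1 = - p0`_d.+1.
  apply: sqr_cube_eq; rewrite ?oppr_eq0 //.
    have := congr1 (fun r => hom (@idfun C) (d.+1 + d.+1) r 1 0) I1.
    (* with 'X absorbed in the derivatives, every term visibly has degree at most
       2 d + 2 *)
    have -> : G = (2%:R * 'X - 1) * (p0 * ga)
      + (1 - 'X) * (p0^`() * 'X * ga - p0 * (ga^`() * 'X)) *+ 3.
      by rewrite /G /wronsk; ring.
    have s2 : (size (2%:R * 'X - 1 : {poly C})%R <= 2)%N.
      apply: (leq_trans (size_polyD _ _)); rewrite size_polyN size_poly1 geq_max andbT.
      by rewrite mulr_natl -scaler_nat (leq_trans (size_scale_leq _ _)) ?size_polyX.
    have sd1 := size_derivMX spd'; have sd2 := size_derivMX sgd'.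
    rewrite homZ expr2 homM // (_ : d.+1 + d.+1 = 1 + (d.+1 + d))%N; last by rewrite addnS.
    have M (u t : {poly C}) : (size u <= 2)%N -> (size t <= (d.+1 + d).+1)%N ->
      hom (@idfun C) (1 + (d.+1 + d)) (u * t) 1 0 =
      hom (@idfun C) 1 u 1 0 * hom (@idfun C) (d.+1 + d) t 1 0 by exact: homM.
    have M2 (u t : {poly C}) : (size u <= d.+2)%N -> (size t <= d.+1)%N ->
      hom (@idfun C) (d.+1 + d) (u * t) 1 0 =
      hom (@idfun C) d.+1 u 1 0 * hom (@idfun C) d t 1 0 by exact: homM.
    rewrite homD homMn !M ?size1BX ?size_mul_leq //; last first.
      apply: (leq_trans (size_polyD _ _)); rewrite size_polyN geq_max.
      by rewrite !size_mul_leq.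
    rewrite !homB !M2 // hom11 mulr_natl homMn hom1X !hom_at0 !expr1n !mulr1 /=.
    rewrite !coefMX /= !coef_deriv => h.
    have {}h : - (p0`_d.+1 * ga`_d) = (- eta0)^-1 * (b`_d.+1 * b`_d.+1).
      rewrite -h; case: (d) => [|m] /=; rewrite ?coef_deriv; ring.
    apply: (mulfI (invr_neq0 (_ : - eta0 != 0))); first by rewrite oppr_eq0.
    by rewrite (expr2 b`_d.+1) -h lpg; field.
  have := congr1 (fun r => hom (@idfun C) (3 * d.+1) r 1 0) E.
  rewrite homD top0 !top3 // => /eqP; rewrite addrC addr_eq0 => /eqP ->.
  by ring.
have [phi [phi_isog phiE]] := isogenyB spd' bd sgd' E I1
  (fun s ps gs => cop s ps (etrans (congr1 (fun r => r.[s]) q0E)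
     (etrans (hornerM _ _ _) (etrans (congr1 (fun u => u * _) gs) (mul0r _))))) pd0 bdE.
have tr : transforms_coord phi iX (fun x y => q.[x ^+ 3] != 0 /\ y != 0)
    (fun x y => ratfun p q (x ^+ 3) * x ^+ 2 / y).
  move=> P Pz /= []; rewrite qE q0E !hornerM hornerX mulf_eq0 negb_or mulf_eq0 negb_or.
  case/andP=> /andP[gas x30] gs y0.
  have x0 : Defs.coord P iX != 0 by move: x30; rewrite expf_eq0.
  have [k k0 e] := phiE P.
  have vP : vecE P = (Defs.coord P iX, Defs.coord P iY, 1) by rewrite -Pz.
  rewrite vP /phiB /= expr1n !hom_horner ?oner_eq0 // !expr1n !mul1r !divr1 mulr1 in e.
  have n0 : Defs.coord P iX * Defs.coord P iY * ga.[Defs.coord P iX ^+ 3] != 0.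
    by rewrite !mulf_neq0.
  have [-> ->] := coord_normalized k0 n0 e; split=> //.
  rewrite /ratfun pE !hornerM hornerX; field.
  by rewrite x0 gs gas y0.
exists phi; split=> //.
have [P [Pz Pq Py]] := affine_point qn0.
by have [h _] := tr P Pz (conj Pq Py); apply: nonzero_of_affine h.
Qed.
End OdeToIsogeny.

(** * The differential equation modulo powers of the variable *)

Section Formal.
Variable C : numFieldType.
Implicit Types f g p q M : {poly C}.

Definition dvdX N f : Prop := exists r, f = r * 'X^N.

Lemma dvdXD N f g : dvdX N f -> dvdX N g -> dvdX N (f + g).
Proof. by move=> [r ->] [s ->]; exists (r + s); rewrite mulrDl. Qed.

Lemma dvdXM N f g : dvdX N f -> dvdX N (g * f).
Proof. by move=> [r ->]; exists (g * r); rewrite mulrA. Qed.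

Lemma dvdXN N f : dvdX N f -> dvdX N (- f).
Proof. by move=> [r ->]; exists (- r); rewrite mulNr. Qed.

Lemma dvdXB N f g : dvdX N f -> dvdX N g -> dvdX N (f - g).
Proof. by move=> hf hg; apply: dvdXD => //; apply: dvdXN. Qed.

Lemma dvdX_le N K f : (N <= K)%N -> dvdX K f -> dvdX N f.
Proof.
by move=> NK [r ->]; exists (r * 'X^(K - N)); rewrite -mulrA -exprD subnK.
Qed.

Lemma dvdX_deriv N f : dvdX N.+1 f -> dvdX N f^`().
Proof.
move=> [r ->]; exists (r^`() * 'X + r *+ N.+1).
by rewrite derivM derivXn /= exprS; ring.
Qed.

Lemma dvdX_comp N f h : dvdX N f -> dvdX N (f \Po ('X * h)).
Proof.
move=> [r ->]; exists ((r \Po ('X * h)) * h ^+ N).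
by rewrite comp_polyM rmorphXn /= comp_polyX exprMn; ring.
Qed.

Lemma dvdX_coef N f : (forall k, (k < N)%N -> f`_k = 0) -> dvdX N f.
Proof.
move=> h; exists (drop_poly N f); rewrite -[LHS](poly_take_drop N f).
suff -> : take_poly N f = 0 by rewrite add0r.
apply/polyP => k; rewrite coef_take_poly coef0; case: ifP => // /h //.
Qed.

Lemma dvdX_all f : (forall N, dvdX N f) -> f = 0.
Proof.
move=> h; apply/eqP; apply: contraT => f0.
have [r fE] := h (size f); have r0 : r != 0.
  by apply: contraNneq f0 => r0; rewrite fE r0 mul0r.
have := congr1 (fun p : {poly C} => size p) fE; rewrite size_mulXn // => /eqP.
by rewrite -[X in X == _]addn0 eqn_add2l eq_sym size_poly_eq0 (negPf r0).
Qed.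

Section Series.
Variable a : nat -> C.
Hypothesis a0 : a 0%N = 1.
Hypothesis aS : forall n, a n.+1 * (n.+1%:R * (3%:R * n%:R + 4%:R)) =
   a n * ((3%:R * n%:R + 1) * (n%:R + 2%:R / 3%:R)).

Definition trunc N : {poly C} := \poly_(n < N) a n.

(** The derivative of z^(1/3) F is z^(-2/3) / 3 times this. *)
Definition theta f : {poly C} := f + 'X * f^`() *+ 3.

(** The differential equation of (1 - z)^(-2/3), for F + 3 z F'. *)
Lemma trunc_ode N : dvdX N ((1 - 'X) * (theta (trunc N.+1))^`() - (2%:R / 3%:R) *: theta (trunc N.+1)).
Proof.
apply: dvdX_coef => k kN; rewrite coefB mulrBl mul1r coefB coefXM coefZ.
have coefT j : (j <= N)%N -> (theta (trunc N.+1))`_j = a j * (3%:R * j%:R + 1).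
  move=> jN; rewrite coefD coefMn coefXM coef_deriv coef_poly ltnS jN.
  case: j jN => [|j] jN /=; first by rewrite mul0rn; ring.
  by rewrite coef_poly ltnS jN; ring.
rewrite !coef_deriv coefT //; case: k kN => [|k] kN /=.
  rewrite coefT // subr0.
  have := aS 0; rewrite a0 => h.
  by transitivity (a 1%N * (1%:R * (3%:R * 0%:R + 4%:R)) - 2%:R / 3%:R); [ring|rewrite h; field].
rewrite coefT ?coef_deriv ?coefT ?(ltnW kN) //.
have h := aS k.+1.
transitivity (a k.+2 * (k.+2%:R * (3%:R * k.+1%:R + 4%:R)) -
   a k.+1 * ((3%:R * k.+1%:R + 1) * (k.+1%:R + 2%:R / 3%:R))); last by rewrite h subrr.
by field.
Qed.

(** Modulo 'X^N the derivative of the left side vanishes by [trunc_ode], and so does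
   its constant term. This is where the elliptic integral becomes algebraic. *)
Lemma theta_cube N : dvdX N.+1 (theta (trunc N.+1) ^+ 3 * (1 - 'X) ^+ 2 - 1).
Proof.
have tA := trunc_ode N; have A0 : (theta (trunc N.+1)).[0] = 1.
  rewrite hornerD hornerMn hornerM hornerX mul0r mul0rn addr0 horner_coef0.
  by rewrite coef_poly.
move: (theta _) tA A0 => A tA A0.
have df : dvdX N (A ^+ 3 * (1 - 'X) ^+ 2 - 1)^`().
  have -> : (A ^+ 3 * (1 - 'X) ^+ 2 - 1)^`() =
      A ^+ 2 * (1 - 'X) *+ 3 * ((1 - 'X) * A^`() - (2%:R / 3%:R) *: A).
    have c3 : (2%:R / 3%:R) *: A *+ 3 = A *+ 2.
      by rewrite -[LHS]scaler_nat -[RHS]scaler_nat scalerA; congr (_ *: _); field.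
    transitivity (A ^+ 2 * (1 - 'X) * ((1 - 'X) * A^`() *+ 3 - (2%:R / 3%:R) *: A *+ 3));
      last by ring.
    rewrite c3 -polyC1 !(deriv_exp, derivC, derivX, derivB, derivM) polyC1 /=.
    by ring.
  exact/dvdXM/tA.
have f0 : (A ^+ 3 * (1 - 'X) ^+ 2 - 1)`_0 = 0.
  rewrite -horner_coef0 -polyC1.
  rewrite !(horner_exp, hornerC, hornerX, hornerD, hornerN, hornerM) A0.
  by rewrite subr0 !expr1n mulr1 subrr.
move: (_ - 1) df f0 => f [r fE] f0; apply: dvdX_coef => -[|k] kN //.
have := congr1 (fun p : {poly C} => p`_k) fE; rewrite coef_deriv coefMXn -ltnS kN.
by move/eqP; rewrite mulrn_eq0 /= => /eqP.
Qed.

(** Differentiate z^(1/3) F(z) = k (z M^3)^(1/3) F(z M^3) and cube, eliminating F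
   with [theta_cube] at z and at h = z M^3. *)
Lemma formal_ode N (k : C) (M : {poly C}) :
  dvdX N.+1 (trunc N.+1 - k *: (M * (trunc N.+1 \Po ('X * M ^+ 3)))) ->
  dvdX N ((1 - 'X * M ^+ 3) ^+ 2 - k ^+ 3 *: ((M + 'X * M^`() *+ 3) ^+ 3 * (1 - 'X) ^+ 2)).
Proof.
move=> hM; have hA := theta_cube N; have hAh := dvdX_comp (M ^+ 3) hA.
have h1 := dvdX_deriv hM; have h0 := dvdX_le (leqnSn N) hM.
have {}hA := dvdX_le (leqnSn N) hA; have {}hAh := dvdX_le (leqnSn N) hAh.
move: (trunc _) hM h0 h1 hA hAh => f hM h0 h1 hA hAh.
set h := 'X * M ^+ 3 in hM h0 h1 hAh *.
pose B := theta f \Po h; pose T := M + 'X * M^`() *+ 3.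
have e1 : dvdX N (theta f - k *: (T * B)).
  have -> : theta f - k *: (T * B) = (f - k *: (M * (f \Po h)))
      + ('X *+ 3) * (f - k *: (M * (f \Po h)))^`().
    rewrite derivB derivZ derivM deriv_comp /B /theta.
    rewrite comp_polyD raddfMn /= comp_polyM comp_polyX.
    rewrite /T /h derivM derivX deriv_exp /= -!mul_polyC; ring.
  exact/dvdXD/dvdXM.
have hB : dvdX N (B ^+ 3 * (1 - h) ^+ 2 - 1).
  by move: hAh; rewrite comp_polyB comp_polyM !rmorphXn /= comp_polyB comp_polyX comp_polyC.
have -> : (1 - h) ^+ 2 - k ^+ 3 *: (T ^+ 3 * (1 - 'X) ^+ 2) =
   - (1 - h) ^+ 2 * (theta f ^+ 3 * (1 - 'X) ^+ 2 - 1)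
   + k ^+ 3 *: (T ^+ 3 * (1 - 'X) ^+ 2) * (B ^+ 3 * (1 - h) ^+ 2 - 1)
   + (1 - 'X) ^+ 2 * (1 - h) ^+ 2 * (theta f ^+ 2 + theta f * (k *: (T * B))
      + (k *: (T * B)) ^+ 2) * (theta f - k *: (T * B)).
  by rewrite -!mul_polyC polyC_exp; ring.
by apply: dvdXD; [apply: dvdXD|]; apply: dvdXM.
Qed.

(** With z M^3 = e Q^3 / P^3, the equation of [formal_ode] becomes polynomial in
   P, Q and e. It holds modulo every power of 'X, hence exactly. The polynomial
   M depends on N, since it approximates a function that need not be rational. *)
Lemma ode_of_series (k : C) (P Q e : {poly C}) : Q != 0 ->
  (forall N, exists M, dvdX N (trunc N - k *: (M * (trunc N \Po ('X * M ^+ 3)))) /\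
     dvdX N (P ^+ 3 * ('X * M ^+ 3) - e * Q ^+ 3)) ->
  (P ^+ 3 - e * Q ^+ 3) ^+ 2 * e ^+ 2 = k ^+ 3 *: ((1 - 'X) ^+ 2 * 'X ^+ 2 *
     (e^`() * P * Q + e * (P * Q^`() - P^`() * Q) *+ 3) ^+ 3).
Proof.
move=> Q0 hM; have Q60 : Q ^+ 6 != 0 by rewrite expf_neq0.
apply: (mulfI Q60); apply/eqP; rewrite -subr_eq0; apply/eqP; apply: dvdX_all => N.
have [M [/formal_ode h1 h2]] := hM N.+1; have h3 := dvdX_deriv h2.
have {}h2 := dvdX_le (leqnSn N) h2.
pose h := 'X * M ^+ 3; pose T := M + 'X * M^`() *+ 3.
pose K := e^`() * P * Q + e * (P * Q^`() - P^`() * Q) *+ 3.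
have hT : h^`() = T * M ^+ 2.
  by rewrite /h derivM derivX deriv_exp /= /T; ring.
have e2 : dvdX N (P ^+ 3 * h - e * Q ^+ 3) := h2.
(* the derivative of e2, freed of its terms divisible by e2 *)
have e3 : dvdX N (P ^+ 4 * (T * M ^+ 2) - Q ^+ 2 * K).
  have -> : P ^+ 4 * (T * M ^+ 2) - Q ^+ 2 * K = P * (P ^+ 3 * h - e * Q ^+ 3)^`()
     - (P^`() *+ 3) * (P ^+ 3 * h - e * Q ^+ 3).
    rewrite derivB (derivM (P ^+ 3)) (derivM e) !deriv_exp /= hT /K; ring.
  by apply: dvdXB; apply: dvdXM.
have e1 : dvdX N ((1 - h) ^+ 2 - k ^+ 3 *: (T ^+ 3 * (1 - 'X) ^+ 2)) := h1.
pose u := P ^+ 3 * h; pose w := e * Q ^+ 3; pose t := P ^+ 4 * (T * M ^+ 2).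
have -> : Q ^+ 6 * ((P ^+ 3 - e * Q ^+ 3) ^+ 2 * e ^+ 2)
    - Q ^+ 6 * (k ^+ 3 *: ((1 - 'X) ^+ 2 * 'X ^+ 2 * K ^+ 3)) =
  P ^+ 12 * h ^+ 2 * ((1 - h) ^+ 2 - k ^+ 3 *: (T ^+ 3 * (1 - 'X) ^+ 2))
  + (- ((P ^+ 3 - w) * w + (P ^+ 3 - u) * u) * (P ^+ 3 - u - w)) * (u - w)
  + k ^+ 3 *: ((1 - 'X) ^+ 2 * 'X ^+ 2 * (t ^+ 2 + t * (Q ^+ 2 * K) + (Q ^+ 2 * K) ^+ 2))
    * (t - Q ^+ 2 * K).
  by rewrite /u /w /t /h -!mul_polyC; ring.
by apply: dvdXD; [apply: dvdXD|]; apply: dvdXM.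
Qed.

End Series.
End Formal.

(** * Convergence of the Gauss series *)

Section Convergence.
Variable R : realType.
Local Notation C := (Cplx R).

Lemma real_cauchy_geometric (x : nat -> R) (r : R) : 0 <= r -> r < 1 ->
  (forall n m, (n <= m)%N -> `|x m - x n| <= 2%:R * r ^+ n) ->
  exists l, forall n, `|l - x n| <= 2%:R * r ^+ n.
Proof.
move=> r0 r1 hx.
have b0 : geometric (2%:R : R) r @ \oo --> (0 : R) by apply: cvg_geometric; rewrite ger0_norm.
have cx : cvg (x @ \oo).
  apply/cauchy_cvgP; apply: cauchy_exP => eps eps0.
  have [n _ hn] := cvgr_dist_lt _ _ b0 eps eps0.
  exists (x n); exists n => // m /= nm; rewrite /ball /= distrC.
  apply: le_lt_trans (hx _ _ nm) _.
  have := hn n (leqnn n); rewrite sub0r normrN ger0_norm //.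
  by rewrite /geometric /= mulr_ge0 ?exprn_ge0.
exists (lim (x @ \oo)) => n.
have h : (fun m => `|x m - x n|) @ \oo --> `|lim (x @ \oo) - x n|.
  by apply: cvg_norm; apply: cvgB => //; apply: cvg_cst.
rewrite -(cvg_lim _ h) //; apply: limr_le; first by apply/cvg_ex; eexists; exact: h.
by exists n => // m /= nm; apply: hx.
Qed.

Lemma normc_of_real (x : R) : `|x%:C%C : R[i]| = `|x|%:C%C.
Proof. by rewrite normc_def /= expr0n addr0 sqrtr_sqr. Qed.

(** Real and imaginary parts are treated separately, which doubles the constant. *)
Lemma complex_cauchy_geometric (S : nat -> R[i]) (z : R[i]) : `|z| < 1 ->
  (forall n m, (n <= m)%N -> `|S m - S n| <= 2%:R * `|z| ^+ n) ->
  exists L, forall n, `|L - S n| <= 4%:R * `|z| ^+ n.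
Proof.
have ni : `|'i%C : R[i]| = 1.
  by rewrite normc_def /= expr0n add0r expr1n sqrtr1.
set r := complex.Re `|z|; have zr : `|z| = r%:C%C by rewrite RRe_real ?normr_real.
have r0 : 0 <= r by rewrite -ler0c -zr.
have nC (k n : nat) : k%:R * `|z| ^+ n = (k%:R * r ^+ n)%:C%C.
  by rewrite zr rmorphM rmorphXn rmorph_nat.
move=> z1 hS; have r1 : r < 1 by rewrite -ltcR -zr.
have [l1 h1] : exists l, forall n, `|l - complex.Re (S n)| <= 2%:R * r ^+ n.
  apply: (real_cauchy_geometric r0 r1) => n m nm.
  rewrite -lecR -nC; apply: le_trans (hS _ _ nm).
  by apply: le_trans (normc_ge_Re _); rewrite raddfB.
have [l2 h2] : exists l, forall n, `|l - complex.Im (S n)| <= 2%:R * r ^+ n.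
  apply: (real_cauchy_geometric r0 r1) => n m nm.
  rewrite -lecR -nC; apply: le_trans (hS _ _ nm).
  have -> : complex.Im (S m) - complex.Im (S n) = - complex.Re ((S m - S n) * 'i%C).
    by rewrite ReiNIm opprK raddfB.
  rewrite normrN; apply: le_trans (normc_ge_Re _) _.
  by rewrite normrM ni mulr1.
exists (l1 +i* l2)%C => n.
have -> : (l1 +i* l2)%C - S n = (l1 - complex.Re (S n))%:C%C + 'i%C * (l2 - complex.Im (S n))%:C%C.
  by rewrite [LHS]complexE; case: (S n).
apply: le_trans (ler_normD _ _) _.
have -> : 4%:R * `|z| ^+ n = 2%:R * `|z| ^+ n + 2%:R * `|z| ^+ n by rewrite -mulrDl -natrD.
apply: lerD; first by rewrite normc_of_real nC lecR.
by rewrite normrM ni mul1r normc_of_real nC lecR.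
Qed.

End Convergence.

Section HypTail.
Variable R : realType.
Local Notation C := (Cplx R).

Definition hyp_coef (n : nat) : C :=
  pochhammer (1 / 3) n * pochhammer (2 / 3) n / (pochhammer (4 / 3) n * n`!%:R).

Lemma pochhammerS (a : C) n : pochhammer a n.+1 = pochhammer a n * (a + n%:R).
Proof. by rewrite /pochhammer big_ord_recr. Qed.

Lemma pochhammer_gt0 (a : C) n : 0 < a -> 0 < pochhammer a n.
Proof. by move=> a0; apply: prodr_gt0 => i _; rewrite ltr_wpDr. Qed.

Lemma third_gt0 (k : nat) : (0 < k)%N -> 0 < (k%:R / 3 : C).
Proof. by move=> k0; rewrite divr_gt0 ?ltr0n. Qed.

Lemma hyp_coef0 : hyp_coef 0 = 1.
Proof. by rewrite /hyp_coef /pochhammer !big_ord0 fact0 !mul1r invr1. Qed.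

Lemma hyp_coefS n : hyp_coef n.+1 * (n.+1%:R * (3%:R * n%:R + 4%:R)) =
   hyp_coef n * ((3%:R * n%:R + 1) * (n%:R + 2%:R / 3%:R)).
Proof.
have p0 : pochhammer (4 / 3 : C) n != 0.
  by apply/lt0r_neq0/pochhammer_gt0; exact: (@third_gt0 4).
have f0 : n`!%:R != 0 :> C by rewrite pnatr_eq0 -lt0n fact_gt0.
have n0 : n.+1%:R != 0 :> C by rewrite pnatr_eq0.
have q1 : 3 * n%:R + 4 != 0 :> C by apply: lt0r_neq0; rewrite ltr_wpDl // mulr_ge0.
rewrite /hyp_coef !pochhammerS factS natrM.
have -> : 4 / 3 + n%:R = (3 * n%:R + 4) / 3 :> C by field.
by field; rewrite p0 f0 q1 nat1r n0.
Qed.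

Lemma hyp_coef_ge0 n : 0 <= hyp_coef n.
Proof.
by apply: divr_ge0; apply: mulr_ge0; rewrite ?ler0n // ltW // pochhammer_gt0.
Qed.

Lemma hyp_coef_le1 n : hyp_coef n <= 1.
Proof.
elim: n => [|n IH]; first by rewrite hyp_coef0.
have q0 : 0 < n.+1%:R * (3%:R * n%:R + 4%:R) :> C.
  by rewrite mulr_gt0 ?ltr0n // ltr_wpDl // mulr_ge0.
rewrite -(ler_pM2r q0) hyp_coefS mul1r.
have n0 : 0 <= n%:R :> C by [].
have h0 : 0 <= (3%:R * n%:R + 1) * (n%:R + 2%:R / 3%:R) :> C.
  by rewrite mulr_ge0 // addr_ge0 ?mulr_ge0 ?invr_ge0.
apply: (le_trans (ler_piMl h0 IH)).
rewrite -subr_ge0.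
have -> : n.+1%:R * (3%:R * n%:R + 4%:R) - (3%:R * n%:R + 1) * (n%:R + 2%:R / 3%:R)
   = 4 * n%:R + 10 / 3 :> C by rewrite -natr1; field.
by rewrite addr_ge0 ?mulr_ge0 ?invr_ge0.
Qed.

(** The coefficients lie between 0 and 1, so the series is dominated by the
   geometric one, whose remainder is at most 2 |z|^N; the factor 4 comes from
   [complex_cauchy_geometric]. *)
Lemma hyp_tail (z : C) N : `|z| <= 1 / 2 ->
  `|hyp2F1 (1 / 3) (2 / 3) (4 / 3) z - (trunc hyp_coef N).[z]| <= 4 * `|z| ^+ N.
Proof.
move=> hz; pose S n := (trunc hyp_coef n).[z].
have z1 : `|z| < 1.
  by apply: le_lt_trans hz _; rewrite ltr_pdivrMr ?ltr0n // mul1r ltr1n.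
have SS n : S n.+1 = S n + hyp_coef n * z ^+ n.
  by rewrite /S /trunc !horner_poly big_ord_recr.
(* |z| <= 1 / 2 bounds the n-th term by 2 |z|^n - 2 |z|^(n + 1); telescope *)
have hS n m : (n <= m)%N -> `|S m - S n| <= 2 * `|z| ^+ n - 2 * `|z| ^+ m.
  move=> /subnK <-; elim: (m - n)%N => [|k IH]; first by rewrite add0n !subrr normr0.
  rewrite addSn SS addrAC; apply: (le_trans (ler_normD _ _)).
  rewrite normrM normrX (ger0_norm (hyp_coef_ge0 _)).
  apply: (le_trans (lerD IH (ler_wpM2r (exprn_ge0 _ (normr_ge0 z)) (hyp_coef_le1 _)))).
  rewrite exprS mul1r -subr_ge0.
  have -> : 2 * `|z| ^+ n - 2 * (`|z| * `|z| ^+ (k + n)) -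
     (2 * `|z| ^+ n - 2 * `|z| ^+ (k + n) + `|z| ^+ (k + n)) =
     2 * ((1 / 2 - `|z|) * `|z| ^+ (k + n)) by field.
  by rewrite !mulr_ge0 ?exprn_ge0 // subr_ge0.
have hS' n m : (n <= m)%N -> `|S m - S n| <= 2 * `|z| ^+ n.
  move=> nm; apply: (le_trans (hS n m nm)).
  by rewrite lerBlDr lerDl mulr_ge0 ?exprn_ge0.
have [L hL] := @complex_cauchy_geometric R S z z1 hS'.
suff -> : hyp2F1 (1 / 3) (2 / 3) (4 / 3) z = L by exact: hL.
rewrite /hyp2F1.
have -> : [series pochhammer (1 / 3) n * pochhammer (2 / 3) n /
    (pochhammer (4 / 3) n * n`!%:R) * z ^+ n]_n = S.
  apply/funext => n; rewrite /series /= big_mkord /S /trunc horner_poly.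
  by apply: eq_bigr.
apply: (cvg_lim (@norm_hausdorff _ _)).
apply/cvgrPdist_le => eps eps0; pose r := complex.Re (`|z| : R[i]).
have zr : `|z| = r%:C%C :> R[i] by rewrite RRe_real ?normr_real.
have r0 : 0 <= r by rewrite -ler0c -zr.
have r1 : r < 1 by rewrite -ltcR -zr.
have epsE : eps = (complex.Re eps)%:C%C by rewrite RRe_real ?gtr0_real.
have e0 : 0 < complex.Re eps by rewrite -ltcR -epsE.
have b0 : geometric (4%:R : R) r @ \oo --> (0 : R) by apply: cvg_geometric; rewrite ger0_norm.
have [n _ hn] := cvgr_dist_lt _ _ b0 (complex.Re eps) e0.
exists n => // m /= nm; apply: le_trans (hL m) _.
have -> : 4%:R * `|z| ^+ m = (4%:R * r ^+ m)%:C%C :> R[i].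
  by rewrite zr rmorphM rmorphXn rmorph_nat.
rewrite epsE lecR; have := hn m nm; rewrite sub0r normrN => /ltW.
exact/le_trans/ler_norm.
Qed.

End HypTail.

(** * Polynomial approximation near 0 *)

Section Near.
Variable C : numFieldType.
Implicit Types (p q r : {poly C}) (f g : C -> C) (P Q : C -> Prop).

(** Punctured neighbourhoods, because the hypotheses involve 1 / z. *)
Definition near0 P : Prop :=
  exists2 e : C, 0 < e & forall z, z != 0 -> `|z| < e -> P z.

Lemma near0_and P Q : near0 P -> near0 Q -> near0 (fun z => P z /\ Q z).
Proof.
move=> [e e0 he] [d d0 hd].
have /orP[ed|de] := real_leVge (gtr0_real e0) (gtr0_real d0).
  by exists e => // z zn ze; split; [apply: he|apply: hd => //; apply: lt_le_trans ed].
by exists d => // z zn zd; split; [apply: he => //; apply: lt_le_trans de|apply: hd].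
Qed.

Lemma near0_imp P Q : (forall z, z != 0 -> P z -> Q z) -> near0 P -> near0 Q.
Proof. by move=> PQ [e e0 he]; exists e => // z zn ze; apply: PQ => //; apply: he. Qed.

Lemma near0_all P : (forall z, P z) -> near0 P.
Proof. by move=> h; exists 1. Qed.

Lemma near0_lt d : 0 < d -> near0 (fun z => `|z| < d).
Proof. by move=> d0; exists d. Qed.

Lemma near0_ex P : near0 P -> exists2 z, z != 0 & P z.
Proof.
move=> [e e0 he]; exists (e / 2); first by rewrite mulf_neq0 ?invr_eq0 ?gt_eqF.
apply: he; first by rewrite mulf_neq0 ?invr_eq0 ?gt_eqF.
by rewrite gtr0_norm ?divr_gt0 // ltr_pdivrMr // mulr_natr mulr2n ltrDl.
Qed.

Lemma poly_bounded p : exists2 B, 0 <= B & forall z, `|z| <= 1 -> `|p.[z]| <= B.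
Proof.
elim/poly_ind: p => [|p c [B B0 hB]]; first by exists 0 => // z _; rewrite horner0 normr0.
exists (B + `|c|) => [|z z1]; first by rewrite addr_ge0.
rewrite hornerMXaddC; apply: le_trans (ler_normD _ _) _; rewrite lerD2r normrM.
by apply: le_trans (hB z z1); rewrite ler_piMr.
Qed.

Lemma poly_at0 p : exists2 B, 0 <= B & forall z, `|z| <= 1 -> `|p.[z] - p.[0]| <= B * `|z|.
Proof.
have /factor_theorem[q qE] : root (p - p.[0]%:P) 0.
  by rewrite /root hornerD hornerN hornerC subrr.
have [B B0 hB] := poly_bounded q; exists B => // z z1.
have -> : p.[z] - p.[0] = q.[z] * z.
  by rewrite -[p.[0]](hornerC _ z) -hornerN -hornerD qE hornerM hornerXsubC subr0.
by rewrite normrM ler_wpM2r ?hB.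
Qed.

Lemma near0_mul_lt B d : 0 <= B -> 0 < d -> near0 (fun z => B * `|z| < d).
Proof.
move=> B0 d0; have Bp : 0 < B + 1 by rewrite ltr_wpDl.
apply: near0_imp (near0_lt (divr_gt0 d0 Bp)) => z _ zd.
apply: le_lt_trans (_ : (B + 1) * `|z| < d); first by rewrite ler_wpM2r // lerDl.
by rewrite mulrC -ltr_pdivlMr.
Qed.

Lemma near0_le1 : near0 (fun z => `|z| <= 1).
Proof. by apply: near0_imp (near0_lt ltr01) => z _ /ltW. Qed.

Lemma near0_poly_dist p d : 0 < d -> near0 (fun z => `|p.[z] - p.[0]| < d).
Proof.
move=> d0; have [B B0 hB] := poly_at0 p.
apply: near0_imp (near0_and near0_le1 (near0_mul_lt B0 d0)) => z _ [z1].
exact/le_lt_trans/hB.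
Qed.

Lemma near0_poly_ge p : p.[0] != 0 -> near0 (fun z => `|p.[0]| / 2 <= `|p.[z]|).
Proof.
move=> p0; have d0 : 0 < `|p.[0]| / 2 by rewrite divr_gt0 // normr_gt0.
apply: near0_imp (near0_poly_dist p d0) => z _ /ltW h.
have : `|p.[0]| <= `|p.[z]| + `|p.[z] - p.[0]|.
  by rewrite -{1}[p.[0]](subKr p.[z]) (le_trans (ler_normB _ _)).
move=> h1; rewrite -(lerD2r (`|p.[0]| / 2)); apply: le_trans (_ : `|p.[0]| <= _).
  by rewrite -splitr.
by apply: le_trans h1 _; rewrite lerD2l.
Qed.

(** A polynomial that is O(z^N) is divisible by 'X^N; this is how analytic
   estimates turn into algebraic identities. *)
Lemma small_poly N r K : 0 <= K ->
  near0 (fun z => `|r.[z]| <= K * `|z| ^+ N) -> dvdX N r.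
Proof.
move=> K0; elim: N => [|N IH] h; first by exists r; rewrite expr0 mulr1.
have [s sE] : dvdX N r.
  apply: IH; apply: near0_imp (near0_and near0_le1 h) => z _ [z1 /le_trans]; apply.
  by rewrite ler_wpM2l // exprS ler_piMl ?exprn_ge0.
have hs : near0 (fun z => `|s.[z]| <= K * `|z|).
  apply: near0_imp h => z zn; rewrite sE hornerM hornerXn normrM normrX exprS mulrA.
  by rewrite ler_pM2r // exprn_gt0 // normr_gt0.
have [s0|s0] := eqVneq s.[0] 0; last first.
  have d0 : 0 < `|s.[0]| / 2 by rewrite divr_gt0 // normr_gt0.
  have [z zn [[h1 h2] h3]] := near0_ex (near0_and (near0_and hs (near0_poly_ge s0))
    (near0_mul_lt K0 d0)).
  by have := le_lt_trans (le_trans h2 h1) h3; rewrite ltxx.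
have /factor_theorem[t tE] : root s 0 by apply/eqP.
by exists t; rewrite sE tE subr0 exprS mulrA.
Qed.

(** f z = p.[z] + O(z^N) as z tends to 0. *)
Definition approx N f p : Prop :=
  exists2 K, 0 <= K & near0 (fun z => `|f z - p.[z]| <= K * `|z| ^+ N).

Lemma approx_poly N p : approx N (horner p) p.
Proof. by exists 0 => //; apply: near0_all => z; rewrite subrr normr0 mul0r. Qed.

Lemma approx_ext N f g p : near0 (fun z => f z = g z) -> approx N g p -> approx N f p.
Proof.
move=> fg [K K0 h]; exists K => //.
by apply: near0_imp (near0_and fg h) => z _ [->].
Qed.

Lemma approx_bounded N f p : approx N f p -> exists2 B, 0 <= B & near0 (fun z => `|f z| <= B).
Proof.
move=> [K K0 h]; have [B B0 hB] := poly_bounded p; exists (K + B); first exact: addr_ge0.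
apply: near0_imp (near0_and near0_le1 h) => z _ [z1 hz].
rewrite -[f z](subrK p.[z]); apply: le_trans (ler_normD _ _) _; apply: lerD (hB _ z1).
by apply: le_trans hz _; rewrite ler_piMr // exprn_ile1.
Qed.

Lemma approxD N f g p q : approx N f p -> approx N g q -> approx N (fun z => f z + g z) (p + q).
Proof.
move=> [K K0 hf] [L L0 hg]; exists (K + L); first exact: addr_ge0.
apply: near0_imp (near0_and hf hg) => z _ [h1 h2].
rewrite hornerD mulrDl opprD addrACA; apply: le_trans (ler_normD _ _) _.
exact: lerD.
Qed.

Lemma approxM N f g p q : approx N f p -> approx N g q -> approx N (fun z => f z * g z) (p * q).
Proof.
move=> hf [L L0 hg]; have [A A0 hA] := approx_bounded hf; case: hf => K K0 hf.
have [B B0 hB] := poly_bounded q; exists (A * L + K * B); first by rewrite addr_ge0 ?mulr_ge0.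
apply: near0_imp (near0_and (near0_and hf hg) (near0_and near0_le1 hA)) => z _ [[h1 h2] [h3 h4]].
have -> : f z * g z - (p * q).[z] = f z * (g z - q.[z]) + (f z - p.[z]) * q.[z].
  by rewrite hornerM; ring.
apply: le_trans (ler_normD _ _) _; rewrite !normrM mulrDl.
apply: lerD; first by rewrite -mulrA ler_pM.
by rewrite mulrAC ler_pM // hB.
Qed.

Lemma approx_comp N f p r : approx N f p -> approx N (fun z => r.[f z]) (r \Po p).
Proof.
move=> hf; elim/poly_ind: r => [|r c IH].
  by apply: (@approx_ext _ _ (horner 0)); [apply: near0_all => z; rewrite !horner0
    |rewrite comp_poly0; apply: approx_poly].
rewrite comp_poly_MXaddC; apply: (@approx_ext _ _ (fun z => r.[f z] * f z + (c%:P).[z])).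
  by apply: near0_all => z; rewrite hornerMXaddC hornerC.
by apply: approxD (approx_poly _ _); apply: approxM.
Qed.

Lemma approx_unique N f p q : approx N f p -> approx N f q -> dvdX N (p - q).
Proof.
move=> [K K0 hp] [L L0 hq]; apply: (@small_poly _ _ (K + L)); first exact: addr_ge0.
apply: near0_imp (near0_and hp hq) => z _ [h1 h2].
have -> : (p - q).[z] = (f z - q.[z]) - (f z - p.[z]) by rewrite hornerD hornerN; ring.
rewrite addrC mulrDl; apply: le_trans (ler_normD _ _) _.
by apply: lerD => //; rewrite normrN.
Qed.

(** Bezout for p and 'X^N gives an inverse of p modulo 'X^N. *)
Lemma approx_div N p q : p.[0] != 0 ->
  exists2 M, approx N (fun z => q.[z] / p.[z]) M & dvdX N (p * M - q).
Proof.
move=> p0; have cop : coprimep p ('X^N).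
  rewrite coprimep_expr // -['X]subr0 -polyC0 coprimep_XsubC //.
have /Bezout_eq1_coprimepP[[u v] /= uv] := cop.
have E : p * (q * u) - q = - (q * v) * 'X^N.
  by rewrite -[X in _ - X]mulr1 -uv; ring.
exists (q * u); last by exists (- (q * v)).
have [B B0 hB] := poly_bounded (q * v).
have d0 : 0 < `|p.[0]| / 2 by rewrite divr_gt0 // normr_gt0.
exists (B / (`|p.[0]| / 2)); first by rewrite divr_ge0 // ltW.
apply: near0_imp (near0_and near0_le1 (near0_poly_ge p0)) => z _ [z1 hz].
have pz : p.[z] != 0 by rewrite -normr_gt0 (lt_le_trans d0).
have -> : q.[z] / p.[z] - (q * u).[z] = (q * v).[z] * z ^+ N / p.[z].
  have := congr1 (fun r : {poly C} => r.[z]) E.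
  rewrite hornerD hornerN hornerM [in RHS]hornerM hornerN hornerXn => e.
  by apply: (mulIf pz); rewrite mulrBl !divfK // -[LHS]opprB mulrC e mulNr opprK.
rewrite !normrM normrV ?unitfE // normrX mulrAC ler_wpM2r ?exprn_ge0 //.
by rewrite ler_pM ?invr_ge0 ?hB // lef_pV2 ?posrE ?normr_gt0.
Qed.

End Near.

Section AnalyticOde.
Variable C : numFieldType.
Implicit Types p q r : {poly C}.

(** Hensel lifting, one power of 'X at a time. *)
Lemma cbrt_trunc N : exists2 B : {poly C}, B.[0] = 1 & dvdX N.+1 (B ^+ 3 - (1 - 'X)).
Proof.
elim: N => [|N [B B0 [r E]]].
  by exists 1; [rewrite -polyC1 hornerC|exists 1; rewrite expr1n expr1; ring].
have [s sE] : exists s, r - r.[0] *: B ^+ 2 = s * 'X.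
  have /factor_theorem[s ->] : root (r - r.[0] *: B ^+ 2) 0; last by exists s; rewrite subr0.
  by rewrite /root hornerD hornerN hornerZ horner_exp B0 expr1n mulr1 subrr.
pose c := r.[0] / 3; exists (B - c *: 'X^(N.+1)).
  by rewrite hornerD hornerN hornerZ hornerXn B0 expr0n mulr0 subr0.
have cE : r.[0]%:P = c%:P *+ 3 by rewrite -polyCMn; congr (_%:P); rewrite /c; field.
exists (s + 'X^N * (c%:P ^+ 2 * B *+ 3 - c%:P ^+ 3 * 'X^(N.+1))).
have {}sE : r = c%:P *+ 3 * B ^+ 2 + s * 'X.
  by rewrite -sE -mul_polyC cE addrC subrK.
transitivity ((B ^+ 3 - (1 - 'X)) - c%:P *+ 3 * B ^+ 2 * 'X^(N.+1)
  + 'X^(N.+1) ^+ 2 * (c%:P ^+ 2 * B *+ 3 - c%:P ^+ 3 * 'X^(N.+1))).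
  by rewrite -mul_polyC; ring.
by rewrite E {1}sE !exprS; ring.
Qed.

(** Both g and B are near 1 and have cubes that agree up to O(z^N), and
   g^3 - B^3 = (g - B) u with u = g^2 + g B + B^2 near 3, so that g - B is O(z^N).
   This is the only use of the choice of branch. *)
Lemma approx_cbrt N (g : C -> C) : near0 (fun z => `|g z - 1| < 1 / 4) ->
  near0 (fun z => g z ^+ 3 = 1 - z) ->
  exists2 B, approx N.+1 g B & dvdX N.+1 (B ^+ 3 - (1 - 'X)).
Proof.
move=> g1 g3; have [B B0 dB] := cbrt_trunc N; exists B => //.
case: dB => r rE; have [K K0 hK] := poly_bounded r.
have q0 : 0 < 1 / 4 :> C by rewrite divr_gt0.
exists K => //; have hB := near0_poly_dist B q0.
apply: near0_imp (near0_and (near0_and g1 g3) (near0_and (near0_le1 C) hB)) => z _ [[h1 h2] [z1 h3]].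
rewrite B0 in h3; set a := g z - 1 in h1; set b := B.[z] - 1 in h3.
pose u := g z ^+ 2 + g z * B.[z] + B.[z] ^+ 2.
have uE : u = 3 + (a *+ 3 + b *+ 3 + (a ^+ 2 + a * b + b ^+ 2)) by rewrite /u /a /b; ring.
have u1 : 1 <= `|u|.
  have h4 : `|a *+ 3 + b *+ 3 + (a ^+ 2 + a * b + b ^+ 2)| <= 2.
    have la := ltW h1; have lb := ltW h3.
    have sq (x y : C) : `|x| <= 1 / 4 -> `|y| <= 1 / 4 -> `|x * y| <= 1 / 16.
      move=> hx hy; rewrite normrM (_ : 1 / 16 = (1 / 4) * (1 / 4)); last by field.
      exact: ler_pM.
    have l3 (x : C) : `|x| <= 1 / 4 -> `|x *+ 3| <= 3 / 4.
      by move=> hx; rewrite normrMn (_ : 3 / 4 = (1 / 4) *+ 3) ?lerMn2r //; field.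
    rewrite (_ : 2 = (3 / 4 + 3 / 4) + (1 / 16 + 1 / 16 + 1 / 16) + 5 / 16); last by field.
    apply: ler_wpDr; first by rewrite divr_ge0.
    do ?[apply: le_trans (ler_normD _ _) _; apply: lerD]; rewrite ?l3 ?expr2 ?sq //.
  have : `|3 : C| <= `|u| + 2.
    rewrite (_ : 3 = u - (a *+ 3 + b *+ 3 + (a ^+ 2 + a * b + b ^+ 2))); last first.
      by rewrite uE; ring.
    by apply: le_trans (ler_normB _ _) _; rewrite lerD2l.
  by rewrite normr_nat -lerBlDr (_ : 3 - 2 = 1) //; ring.
have e : (g z - B.[z]) * u = - (r.[z] * z ^+ N.+1).
  have := congr1 (fun p : {poly C} => p.[z]) rE.
  rewrite hornerM hornerXn -polyC1 !(hornerD, hornerN, horner_exp, hornerX, hornerC).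
  by move=> <-; rewrite -h2 /u; ring.
have u0 : u != 0 by rewrite -normr_gt0 (lt_le_trans ltr01).
have -> : g z - B.[z] = - (r.[z] * z ^+ N.+1) / u by rewrite -e mulfK.
rewrite normrM normrN normrV ?unitfE // ler_pdivrMr ?normr_gt0 // normrM normrX.
apply: (@le_trans _ _ (K * `|z| ^+ N.+1)).
  by rewrite ler_wpM2r ?exprn_ge0 // hK.
by rewrite ler_peMr // mulr_ge0 ?exprn_ge0.
Qed.

Variables (F : C -> C) (a : nat -> C).
Hypothesis a0 : a 0%N = 1.
Hypothesis aS : forall n, a n.+1 * (n.+1%:R * (3%:R * n%:R + 4%:R)) =
   a n * ((3%:R * n%:R + 1) * (n%:R + 2%:R / 3%:R)).
Hypothesis Ftail : forall z N, `|z| <= 1 / 2 -> `|F z - (trunc a N).[z]| <= 4 * `|z| ^+ N.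

(** Composition with a function vanishing at 0, as expressed by the factor 'X. *)
Lemma approx_series N (h : C -> C) (H : {poly C}) : (0 < N)%N -> approx N h ('X * H) ->
  approx N (fun z => F (h z)) (trunc a N \Po ('X * H)).
Proof.
move=> N0 hH; have [K K0 hK] := hH; have [B B0 hB] := poly_bounded H.
have small : near0 (fun z => `|h z| <= (K + B) * `|z|).
  apply: near0_imp (near0_and (near0_le1 C) hK) => z _ [z1 hz].
  rewrite -[h z](subrK ('X * H).[z]); apply: le_trans (ler_normD _ _) _.
  rewrite mulrDl; apply: lerD; last by rewrite hornerM hornerX normrM mulrC ler_wpM2r ?hB.
  apply: le_trans hz _; rewrite ler_wpM2l //.
  by case: (N) N0 => // n _; rewrite exprS ler_piMr // exprn_ile1.
have half0 : 0 < 1 / 2 :> C by rewrite divr_gt0.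
have [L L0 hL] := approx_comp (trunc a N) hH.
exists (4 * (K + B) ^+ N + L); first by rewrite addr_ge0 ?mulr_ge0 ?exprn_ge0 ?addr_ge0.
apply: near0_imp (near0_and (near0_and small hL)
  (near0_mul_lt (addr_ge0 K0 B0) half0)) => z _ [[h1 h2] /ltW h3].
have -> : F (h z) - (trunc a N \Po ('X * H)).[z] = (F (h z) - (trunc a N).[h z])
   + ((trunc a N).[h z] - (trunc a N \Po ('X * H)).[z]) by ring.
apply: le_trans (ler_normD _ _) _; rewrite mulrDl; apply: lerD => //.
apply: le_trans (Ftail _ (le_trans h1 h3)) _.
by rewrite -mulrA -exprMn ler_wpM2l // lerXn2r ?nnegrE ?mulr_ge0 ?addr_ge0.
Qed.

(** Replaces all functions by Taylor polynomials, so that [ode_of_series] applies;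
   by uniqueness of Taylor polynomials the identity for F holds modulo
   'X^(N.+1). *)
Lemma analytic_ode (k : C) (m : C -> C) (P Q e : {poly C}) : Q != 0 ->
  near0 (fun z => F z = k * m z * F (z * m z ^+ 3)) ->
  (forall N, exists2 M, approx N.+1 m M & dvdX N.+1 (P ^+ 3 * ('X * M ^+ 3) - e * Q ^+ 3)) ->
  (P ^+ 3 - e * Q ^+ 3) ^+ 2 * e ^+ 2 = k ^+ 3 *: ((1 - 'X) ^+ 2 * 'X ^+ 2 *
     (e^`() * P * Q + e * (P * Q^`() - P^`() * Q) *+ 3) ^+ 3).
Proof.
move=> Q0 hF hM; apply: (ode_of_series a0 aS) => // -[|N].
  by exists 0; split; [exists (trunc a 0 - k *: (0 * (trunc a 0 \Po ('X * 0 ^+ 3))))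
    |exists (P ^+ 3 * ('X * 0 ^+ 3) - e * Q ^+ 3)]; rewrite expr0 mulr1.
have [M mM dM] := hM N; exists M; split=> //.
have hh : approx N.+1 (fun z => z * m z ^+ 3) ('X * M ^+ 3).
  apply: (@approx_ext _ _ _ (fun z => 'X.[z] * (m z * (m z * m z)))).
    by apply: near0_all => z; rewrite hornerX; ring.
  rewrite (_ : M ^+ 3 = M * (M * M)); last by ring.
  by apply: approxM; [apply: approx_poly|do ?apply: approxM].
have FX : approx N.+1 F (trunc a N.+1).
  have := @approx_series N.+1 (horner 'X) 1 isT.
  rewrite mulr1 comp_polyXr => /(_ (approx_poly _ _)).
  by apply: approx_ext; apply: near0_all => z; rewrite hornerX.
apply: approx_unique FX _; apply: approx_ext hF _.
rewrite -mul_polyC mulrA; apply: approxM; last exact: approx_series.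
by apply: (@approx_ext _ _ _ (fun z => (k%:P).[z] * m z));
  [apply: near0_all => z; rewrite hornerC|apply: approxM => //; apply: approx_poly].
Qed.

End AnalyticOde.

(** * Reversal of polynomials and the limit at infinity *)

Section Reversal.
Variable C : numFieldType.
Implicit Types p q r : {poly C}.

(** The reversal 'X^d p(1 / 'X), for d at least the degree of p. *)
Definition revp d p : {poly C} := hom (@polyC C) d p 1 'X.

Lemma horner_revp d p z : (revp d p).[z] = hom (@idfun C) d p 1 z.
Proof.
have := @hom_morph C {poly C} (@polyC C) C (@idfun C) (horner_eval z) d p 1 'X.
rewrite /= !horner_evalE hornerX -polyC1 hornerC => -> // c.
by rewrite horner_evalE hornerC.
Qed.

Lemma revp_at0 d p : (revp d p).[0] = p`_d.
Proof. by rewrite horner_revp hom_at0 expr1n mulr1. Qed.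

Lemma horner_revpV d p z : z != 0 -> (size p <= d.+1)%N ->
  (revp d p).[z] = z ^+ d * p.[z^-1].
Proof. by move=> z0 sp; rewrite horner_revp hom_horner // div1r. Qed.

Lemma revp_eq0 d p : (size p <= d.+1)%N -> revp d p = 0 -> p = 0.
Proof.
move=> sp h; apply/polyP => k; rewrite coef0.
have [dk|kd] := ltnP d k; first by rewrite nth_default // (leq_trans sp).
have := congr1 (fun r : {poly C} => r`_(d - k)) h; rewrite coef0 coef_sum.
rewrite (bigD1 (inord k : 'I_d.+1)) //= inordK ?ltnS // expr1n mulr1 coefCM coefXn eqxx mulr1.
rewrite big1 ?addr0 // => j jk; rewrite expr1n mulr1 coefCM coefXn.
case: eqP => [e|]; last by rewrite mulr0.
case/eqP: jk; apply: val_inj; rewrite /= inordK ?ltnS //.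
by rewrite -(subKn kd) e subKn // -ltnS.
Qed.

Lemma wronsk_revp d p q : (size p <= d.+1)%N -> (size q <= d.+1)%N ->
  revp d p * (revp d q)^`() - (revp d p)^`() * revp d q =
  revp (d.-1 + d.-1) (wronsk p q).
Proof.
move=> sp sq; have DM (f g : {poly C}) : (f * g)^`() = f^`() * g + f * g^`() by rewrite derivM.
have DD : {morph (@deriv C) : f g / f + g} by move=> f g; rewrite derivD.
have := hom_wronsk DD DM (@derivC C) 1 'X sp sq.
rewrite -/(revp d p) -/(revp d q) -/(revp _ (wronsk p q)) derivX -polyC1 derivC polyC1.
by rewrite mulr0 mulr1 sub0r mulrN1 => h; rewrite -[RHS]opprK -h; ring.
Qed.

Lemma size_lwronsk d (l p q : {poly C}) : (size l <= 3)%N -> (size p <= d.+1)%N ->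
  (size q <= d.+1)%N -> (size (l * wronsk p q)%R <= (d + d).+1)%N.
Proof.
case: d => [|d] sl sp sq.
  rewrite (size1_polyC sp) (size1_polyC sq) /wronsk !derivC mul0r mulr0 subr0 mulr0.
  by rewrite size_poly0.
by rewrite (_ : d.+1 + d.+1 = 2 + (d + d))%N ?size_mul_leq ?size_wronsk // addSn addnS.
Qed.

(** The equation for P and Q in z = 1 / s is the homogenisation of the one for p
   and q in s, evaluated at (1, z), and homogenisation is injective. *)
Lemma odeA_revp d (k : C) p q : (size p <= d.+1)%N -> (size q <= d.+1)%N ->
  let P := revp d p in let Q := revp d q in
  (P ^+ 3 - 'X * Q ^+ 3) ^+ 2 * 'X ^+ 2 = k ^+ 3 *: ((1 - 'X) ^+ 2 * 'X ^+ 2 *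
     (('X)^`() * P * Q + 'X * (P * Q^`() - P^`() * Q) *+ 3) ^+ 3) ->
  ('X * p ^+ 3 - q ^+ 3) ^+ 2 =
    (k ^+ 3)%:P * ('X - 1) ^+ 2 * (p * q + 'X * wronsk p q *+ 3) ^+ 3.
Proof.
move=> sp sq P Q; rewrite /P /Q wronsk_revp // derivX mul1r -/P -/Q => h.
have X0 : ('X : {poly C}) ^+ 2 != 0 by rewrite expf_neq0 // -size_poly_eq0 size_polyX.
have {}h : (P ^+ 3 - 'X * Q ^+ 3) ^+ 2 = k ^+ 3 *: ((1 - 'X) ^+ 2 *
     (P * Q + 'X * revp (d.-1 + d.-1) (wronsk p q) *+ 3) ^+ 3).
  by apply: (mulIf X0); rewrite h -scalerAl; congr (_ *: _); ring.
pose G := p * q + 'X * wronsk p q *+ 3.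
have sX : (size ('X : {poly C}) <= 3)%N by rewrite size_polyX.
have sG : (size G <= (d + d).+1)%N.
  apply: (leq_trans (size_polyD _ _)); rewrite geq_max size_mul_leq //=.
  by rewrite -scaler_nat (leq_trans (size_scale_leq _ _)) ?size_lwronsk.
have GE : hom (@polyC C) (d + d) G 1 'X = P * Q + 'X * revp (d.-1 + d.-1) (wronsk p q) *+ 3.
  by rewrite homD homMn homM // -homM_wronsk // hom2X mul1r.
pose U := 'X * p ^+ 3 - q ^+ 3.
have s1 (r : {poly C}) : (size r <= d.+1)%N -> (size (r ^+ 3)%R <= (3 * d).+1)%N.
  exact: size_exp_hom.
have sU : (size U <= (1 + 3 * d).+1)%N.
  apply: (leq_trans (size_polyD _ _)); rewrite size_polyN geq_max.
  rewrite size_mul_leq ?size_polyX ?s1 //=.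
  by apply: (leq_trans (s1 _ sq)); rewrite ltnS leq_addl.
have UE : hom (@polyC C) (1 + 3 * d) U 1 'X = P ^+ 3 - 'X * Q ^+ 3.
  have -> : U = 'X * p ^+ 3 - 1 * q ^+ 3 by rewrite mul1r.
  rewrite homB !(@homM _ _ _ _ _ 1) ?s1 ?size_polyX ?size_poly1 //.
  by rewrite hom1X hom11 !homX // mul1r.
have sX1 : (size ('X - 1 : {poly C})%R <= 2)%N by rewrite -polyC1 size_XsubC.
have X1E : hom (@polyC C) 1 ('X - 1) 1 'X = 1 - 'X by rewrite homB hom1X hom11.
apply/eqP; rewrite -subr_eq0; apply/eqP; rewrite -mulrA mul_polyC.
have nE : (2 * (1 + 3 * d) = 2 * 1 + 3 * (d + d))%N.
  by rewrite mulnDr mulnCA [(2 * d)%N]mul2n -addnn.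
apply: (@revp_eq0 (2 * (1 + 3 * d))).
  apply: (leq_trans (size_polyD _ _)); rewrite size_polyN geq_max size_exp_hom //=.
  apply: (leq_trans (size_scale_leq _ _)).
  by rewrite nE size_mul_leq ?size_exp_hom.
rewrite /revp homB homX // UE homZ nE homM ?size_exp_hom // !homX // X1E GE h.
by rewrite -mul_polyC subrr.
Qed.

(** The same argument as for [odeA_revp]. *)
Lemma odeB_revp d (k : C) p q : (size p <= d.+1)%N -> (size q <= d.+1)%N ->
  let P := revp d p in let Q := revp d q in let e := 'X * ('X - 1) in
  (P ^+ 3 - e * Q ^+ 3) ^+ 2 * e ^+ 2 = k ^+ 3 *: ((1 - 'X) ^+ 2 * 'X ^+ 2 *
     (e^`() * P * Q + e * (P * Q^`() - P^`() * Q) *+ 3) ^+ 3) ->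
  ('X ^+ 2 * p ^+ 3 - (1 - 'X) * q ^+ 3) ^+ 2 = (k ^+ 3)%:P * 'X *
    ((2%:R - 'X) * (p * q) + 'X * (1 - 'X) * wronsk p q *+ 3) ^+ 3.
Proof.
move=> sp sq P Q e; rewrite wronsk_revp //.
have -> : e^`() = 2%:R * 'X - 1.
  by rewrite /e derivM derivB derivX -polyC1 derivC polyC1; ring.
rewrite /e => h.
have e0 : ('X * ('X - 1) : {poly C}) ^+ 2 != 0.
  by rewrite expf_neq0 // mulf_neq0 // -?polyC1 ?polyXsubC_eq0 // -size_poly_eq0 size_polyX.
set W := revp _ (wronsk p q) in h.
have {}h : (P ^+ 3 - 'X * ('X - 1) * Q ^+ 3) ^+ 2 = k ^+ 3 *:
     ((2%:R * 'X - 1) * (P * Q) + 'X * (('X - 1) * W *+ 3)) ^+ 3.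
  by apply: (mulIf e0); rewrite h -scalerAl; congr (_ *: _); ring.
pose G := (2%:R - 'X) * (p * q) + 'X * (1 - 'X) * wronsk p q *+ 3.
have s2X : (size (2%:R - 'X : {poly C})%R <= 2)%N.
  by rewrite -size_polyN opprB -(rmorph_nat (@polyC C)) size_XsubC.
have slw : (size ('X * (1 - 'X) * wronsk p q *+ 3)%R <= (d + d).+1)%N.
  by rewrite -scaler_nat (leq_trans (size_scale_leq _ _)) ?size_lwronsk ?sizeXBX.
have sG : (size G <= (1 + (d + d)).+1)%N.
  apply: (leq_trans (size_polyD _ _)); rewrite geq_max !size_mul_leq //=.
  by apply: (leq_trans slw); rewrite ltnS leq_addl.
have GE : hom (@polyC C) (1 + (d + d)) G 1 'X =
    (2%:R * 'X - 1) * (P * Q) + 'X * (('X - 1) * W *+ 3).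
  rewrite homD; congr (_ + _).
    rewrite (@homM _ _ _ _ _ 1) ?size_mul_leq // homM // homB hom1X.
    by rewrite -[2%:R]mulr1 mulr_natl homMn hom11 mulr_natl.
  by rewrite hom_widen // homMn -homM_wronsk ?sizeXBX // hom2XBX mul1r.
pose U := 'X ^+ 2 * p ^+ 3 - (1 - 'X) * q ^+ 3.
have s1 (r : {poly C}) : (size r <= d.+1)%N -> (size (r ^+ 3)%R <= (3 * d).+1)%N.
  exact: size_exp_hom.
have sX2 : (size ('X ^+ 2 : {poly C})%R <= 3)%N by rewrite size_polyXn.
have s12 : (size (1 - 'X : {poly C})%R <= 3)%N by rewrite size1BX.
have sU : (size U <= (2 + 3 * d).+1)%N.
  apply: (leq_trans (size_polyD _ _)); rewrite size_polyN geq_max.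
  by apply/andP; split; apply: size_mul_leq; rewrite ?s1.
have UE : hom (@polyC C) (2 + 3 * d) U 1 'X = P ^+ 3 - 'X * ('X - 1) * Q ^+ 3.
  rewrite homB (homM _ _ _ sX2 (s1 _ sp)) (homM _ _ _ s12 (s1 _ sq)).
  rewrite hom2BX (homX _ _ _ _ sp) (homX _ _ _ _ sq).
  have -> : 'X ^+ 2 = 1 * 'X * 'X :> {poly C} by ring.
  rewrite !homMX -polyC1 homC /= -/(revp d p) -/(revp d q) -/P -/Q; ring.
apply/eqP; rewrite -subr_eq0; apply/eqP; rewrite -mulrA mul_polyC.
have nE : (2 * (2 + 3 * d) = 1 + 3 * (1 + (d + d)))%N.
  by rewrite [in LHS]mulnDr mulnCA [(2 * d)%N]mul2n -addnn [in RHS]mulnDr addnA.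
apply: (@revp_eq0 (2 * (2 + 3 * d))).
  apply: (leq_trans (size_polyD _ _)); rewrite size_polyN geq_max size_exp_hom //=.
  apply: (leq_trans (size_scale_leq _ _)).
  by rewrite nE size_mul_leq ?size_exp_hom ?size_polyX.
rewrite /revp homB homX // UE homZ nE (@homM _ _ _ _ _ 1) ?size_exp_hom ?size_polyX //.
by rewrite hom1X mul1r homX // GE h -mul_polyC subrr.
Qed.

(** Let n be the larger of the two degrees. The reversals of p and mu0 q have the
   same value at 0, because their difference is the bounded reversal of q times
   p / q - mu0 and so tends to 0. Hence p and q have coefficients at n that are
   proportional with the nonzero factor mu0. *)
Lemma sizes_of_limit p q (mu0 : C) : q != 0 -> mu0 != 0 ->
  (forall eps, 0 < eps -> near0 (fun z => `|mu0 - p.[z^-1] / q.[z^-1]| < eps)) ->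
  size p = size q /\ lead_coef p = mu0 * lead_coef q.
Proof.
move=> q0 m0 lim; pose n := (maxn (size p) (size q)).-1.
have nE : maxn (size p) (size q) = n.+1.
  by rewrite /n prednK // leq_max !size_poly_gt0 q0 orbT.
have sp : (size p <= n.+1)%N by rewrite -nE leq_maxl.
have sq : (size q <= n.+1)%N by rewrite -nE leq_maxr.
pose T := revp n p - mu0 *: revp n q.
have [B B0 hB] := poly_bounded (revp n q).
have T0 : T.[0] = 0.
  apply/eqP; apply: contraT => T0.
  have t0 : 0 < `|T.[0]| / 2 by rewrite divr_gt0 // normr_gt0.
  have B1 : 0 < B + 1 by rewrite ltr_wpDl.
  have m1 : 0 < `|mu0| by rewrite normr_gt0.
  have [z zn [[[h1 h2] h3] h4]] := near0_ex (near0_and (near0_and (near0_and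
    (lim _ m1) (lim _ (divr_gt0 t0 B1))) (near0_poly_ge T0)) (near0_le1 C)).
  have qz : q.[z^-1] != 0.
    by apply/eqP => qz; move: h1; rewrite qz invr0 mulr0 subr0 ltxx.
  have TE : T.[z] = - ((revp n q).[z] * (mu0 - p.[z^-1] / q.[z^-1])).
    rewrite hornerD hornerN hornerZ !horner_revpV //; field.
    exact: qz.
  have : `|T.[z]| < `|T.[0]| / 2.
    rewrite TE normrN normrM; apply: (@le_lt_trans _ _ (B * (`|T.[0]| / 2 / (B + 1)))).
      by rewrite ler_pM ?hB // ltW.
    rewrite mulrCA gtr_pMr // -?lt0r_neq0 // ltr_pdivrMr // mul1r ltrDl //.
  by move=> /(le_lt_trans h3); rewrite ltxx.
have topE : p`_n = mu0 * q`_n.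
  apply/eqP; rewrite -subr_eq0 -[X in _ == X]T0.
  by rewrite hornerD hornerN hornerZ !revp_at0.
have sz (r : {poly C}) : (size r <= n.+1)%N -> r`_n != 0 -> size r = n.+1.
  move=> sr rn; apply/eqP; rewrite eqn_leq sr ltnNge; apply: contraNN rn => h.
  by rewrite nth_default.
have ln (r : {poly C}) : size r = n.+1 -> r`_n != 0.
  by move=> sr; have := lead_coef_eq0 r; rewrite lead_coefE sr /= => ->;
    rewrite -size_poly_eq0 sr.
suff [spn sqn] : size p = n.+1 /\ size q = n.+1.
  by rewrite spn sqn !lead_coefE spn sqn.
have /orP[/eqP e|/eqP e] : (size p == n.+1) || (size q == n.+1).
- by rewrite -nE /maxn; case: ifP => _; rewrite eqxx ?orbT.
- split=> //; apply: sz => //; have := ln _ e.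
  by apply: contraNN => /eqP h; rewrite topE h mulr0.
split=> //; apply: sz => //; rewrite topE mulf_neq0 //; exact: ln.
Qed.

End Reversal.

(** * Isogenies from hypergeometric identities *)

Section Filters.
Variable R : realType.
Local Notation C := (Cplx R).

Lemma near0_dnbhs (P : C -> Prop) : (\forall z \near (0 : C)^', P z) -> near0 P.
Proof.
rewrite /dnbhs /within /= => /nbhs_ballP[e /= e0 he]; exists e => // z z0 ze.
by apply: he => //; rewrite /ball /= sub0r normrN.
Qed.

Lemma near0_nbhs (P : C -> Prop) : (\forall z \near (0 : C), P z) -> near0 P.
Proof.
move=> /nbhs_ballP[e /= e0 he]; exists e => // z z0 ze.
by apply: he => //; rewrite /ball /= sub0r normrN.
Qed.

(** The substitution z |-> 1 / z exchanges the neighbourhoods of 0 and infinity. *)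
Lemma near0_cinfty (f : C -> C) (l : C) : f s @[s --> cinfty_nbhs R] --> l ->
  forall eps, 0 < eps -> near0 (fun z => `|l - f z^-1| < eps).
Proof.
move=> fl eps e0; have [M [Mr hM]] := fl (ball l eps) (nbhsx_ballx l eps e0).
have M1 : 0 < `|M| + 1 by rewrite ltr_wpDl.
exists (`|M| + 1)^-1; rewrite ?invr_gt0 // => z z0 zM; apply: hM.
rewrite normfV; apply: le_lt_trans (real_ler_norm Mr) _.
apply: lt_trans (_ : `|M| + 1 < _); first by rewrite ltrDl.
by rewrite -[ltLHS]invrK ltf_pV2 // posrE ?invr_gt0 // normr_gt0.
Qed.

Lemma near0_cbrt (g : C -> C) : is_cbrt_branch g ->
  near0 (fun z => `|g z - 1| < 1 / 4) /\ near0 (fun z => g z ^+ 3 = 1 - z).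
Proof.
move=> [g0 gc g3]; split; last exact: near0_nbhs.
have /nbhs_singleton gc0 := gc; have q0 : 0 < 1 / 4 :> C by rewrite divr_gt0.
have /cvgrPdist_lt/(_ _ q0) h := gc0.
by apply: near0_imp (near0_nbhs h) => z _; rewrite g0 distrC.
Qed.

End Filters.

Section Transport.
Variable R : realType.
Local Notation C := (Cplx R).
Local Notation F := (hyp2F1 (1 / 3 : C) (2 / 3 : C) (4 / 3 : C)).
Implicit Types p q : {poly C}.

Lemma ratfun_revp d p q (z : C) : z != 0 -> (size p <= d.+1)%N -> (size q <= d.+1)%N ->
  (ratfun p q z^-1)^-1 = (revp d q).[z] / (revp d p).[z].
Proof.
move=> z0 sp sq; rewrite /ratfun !horner_revpV // invfM invrK.
have zd : z ^+ d != 0 by rewrite expf_neq0.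
by rewrite invfM mulrACA divff // mul1r mulrC.
Qed.

(** [analytic_ode] with m = 1 / mu(1 / z), the rational function Q / P, and
   e = 'X. *)
Lemma odeA_of_hyp p q (mu0 : C) d : (size p <= d.+1)%N -> (size q <= d.+1)%N ->
  q != 0 -> p`_d != 0 ->
  near0 (fun z => F z = mu0 / ratfun p q z^-1 * F (z / ratfun p q z^-1 ^+ 3)) ->
  ('X * p ^+ 3 - q ^+ 3) ^+ 2 =
    (mu0 ^+ 3)%:P * ('X - 1) ^+ 2 * (p * q + 'X * wronsk p q *+ 3) ^+ 3.
Proof.
move=> sp sq q0 pd hF; apply: (odeA_revp sp sq).
have P0 : (revp d p).[0] != 0 by rewrite revp_at0.
apply: (analytic_ode (@hyp_coef0 R) (@hyp_coefS R) (@hyp_tail R)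
  (m := fun z => (revp d q).[z] / (revp d p).[z])).
- by apply: contraNneq q0 => /(revp_eq0 sq)/eqP.
- apply: near0_imp hF => z z0.
  by rewrite -exprVn (ratfun_revp z0 sp sq).
move=> N; have [M mM [r rE]] := approx_div N.+1 (revp d q) P0; exists M => //.
set P := revp d p in rE *; set Q := revp d q in rE *.
exists ('X * r * ((P * M) ^+ 2 + P * M * Q + Q ^+ 2)).
transitivity ('X * (P * M - Q) * ((P * M) ^+ 2 + P * M * Q + Q ^+ 2)); first by ring.
by rewrite rE; ring.
Qed.

(** Here z (z - 1) / eta^3 = z m^3 with m = - cbrt z / eta, since the cube of cbrt z is
   1 - z near 0. The sign of m is the reason why - eta0 appears in place of
   mu0. *)
Lemma odeB_of_hyp p q (eta0 : C) d (g : C -> C) : (size p <= d.+1)%N -> (size q <= d.+1)%N ->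
  q != 0 -> p`_d != 0 -> is_cbrt_branch g ->
  near0 (fun z => F z = g z * eta0 / ratfun p q z^-1 *
                        F (z * (z - 1) / ratfun p q z^-1 ^+ 3)) ->
  ('X ^+ 2 * p ^+ 3 - (1 - 'X) * q ^+ 3) ^+ 2 = ((- eta0) ^+ 3)%:P * 'X *
    ((2%:R - 'X) * (p * q) + 'X * (1 - 'X) * wronsk p q *+ 3) ^+ 3.
Proof.
move=> sp sq q0 pd /near0_cbrt[g1 g3] hF; apply: (odeB_revp sp sq).
have P0 : (revp d p).[0] != 0 by rewrite revp_at0.
apply: (analytic_ode (@hyp_coef0 R) (@hyp_coefS R) (@hyp_tail R)
  (m := fun z => - g z * ((revp d q).[z] / (revp d p).[z]))).
- by apply: contraNneq q0 => /(revp_eq0 sq)/eqP.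
- apply: near0_imp (near0_and hF g3) => z z0 [-> g3z].
  rewrite -!exprVn !(ratfun_revp z0 sp sq); congr (_ * F _); first by ring.
  by rewrite [in RHS]exprMn exprNn g3z; ring.
move=> N; have [M mM [r rE]] := approx_div N.+1 (revp d q) P0.
have [B mB [s sE]] := approx_cbrt N g1 g3; exists (- B * M).
  have polyCN1 : (-1)%:P = -1 :> {poly C} by rewrite polyCN polyC1.
  have mNB : approx N.+1 (fun z => - g z) (- B).
    apply: (@approx_ext _ _ _ (fun z => ((-1)%:P).[z] * g z)).
      by apply: near0_all => z; rewrite hornerC mulN1r.
    by rewrite -[- B]mulN1r -polyCN1; apply: (approxM (approx_poly _ _) mB).
  exact: (approxM mNB mM).
set P := revp d p in rE *; set Q := revp d q in rE *.
exists (- 'X * (s * (P * M) ^+ 3 + (1 - 'X) * r * ((P * M) ^+ 2 + P * M * Q + Q ^+ 2))).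
transitivity (- 'X * ((B ^+ 3 - (1 - 'X)) * (P * M) ^+ 3
  + (1 - 'X) * (P * M - Q) * ((P * M) ^+ 2 + P * M * Q + Q ^+ 2))); first by ring.
by rewrite rE sE; ring.
Qed.

End Transport.

Theorem theorem4p2 (R : realType) :
  let C := Cplx R in
  let F := hyp2F1 (1 / 3 : C) (2 / 3 : C) (4 / 3 : C) in
  (forall (p q : {poly C}) (mu0 : C),
     let mu := ratfun p q in
     q != 0 ->
     mu s @[s --> cinfty_nbhs R] --> mu0 ->
     mu0 != 0 ->
     (\forall z \near (0 : C)^',
        F z = mu0 / mu z^-1 * F (z / mu z^-1 ^+ 3)) ->
     exists phi : E3 R -> E3 R,
       let dom (x y : C) := q.[x ^+ 3] != 0 in
       let f (x y : C) := x * mu (x ^+ 3) in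
       [/\ isogeny phi, nonzero_map phi
         & transforms_coord phi iX dom f \/ transforms_coord phi iY dom f]) /\
  (forall (p q : {poly C}) (eta0 : C) (cbrt : C -> C),
     let eta := ratfun p q in
     q != 0 ->
     eta s @[s --> cinfty_nbhs R] --> eta0 ->
     eta0 != 0 ->
     is_cbrt_branch cbrt ->
     (\forall z \near (0 : C)^',
        F z = cbrt z * eta0 / eta z^-1 * F (z * (z - 1) / eta z^-1 ^+ 3)) ->
     exists phi : E3 R -> E3 R,
       let dom (x y : C) := q.[x ^+ 3] != 0 /\ y != 0 in
       let f (x y : C) := eta (x ^+ 3) * x ^+ 2 / y in
       [/\ isogeny phi, nonzero_map phi
         & transforms_coord phi iX dom f \/ transforms_coord phi iY dom f]).
Proof.
have sz (r : {poly Cplx R}) : r != 0 -> (size r <= (size r).-1.+1)%N /\ r`_(size r).-1 != 0.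
  by move=> r0; rewrite prednK ?size_poly_gt0 // -lead_coefE lead_coef_eq0.
move=> C F; split.
  move=> p q mu0 mu q0 lim m0 /near0_dnbhs hF.
  have [spq lpq] := sizes_of_limit q0 m0 (near0_cinfty lim).
  have pn0 : p != 0 by rewrite -size_poly_eq0 spq size_poly_eq0.
  have [sp pd] := sz p pn0; have sq := sp; rewrite {1}spq in sq.
  have ode := odeA_of_hyp sp sq q0 pd hF.
  have [phi [h1 h2 h3]] := isogeny_of_odeA q0 spq m0 lpq ode.
  by exists phi; split=> //; left.
move=> p q eta0 g eta q0 lim m0 hg /near0_dnbhs hF.
have [spq lpq] := sizes_of_limit q0 m0 (near0_cinfty lim).
have pn0 : p != 0 by rewrite -size_poly_eq0 spq size_poly_eq0.
have [sp pd] := sz p pn0; have sq := sp; rewrite {1}spq in sq.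
have ode := odeB_of_hyp sp sq q0 pd hg hF.
have [phi [h1 h2 h3]] := isogeny_of_odeB q0 spq m0 lpq ode.
by exists phi; split=> //; left.
Qed.
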